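(* Let $P\geq 3$ be a natural number and let $(u_n)_{n\geq 0}$ be the sequence defined by $u_0=0$, $u_1=1$ and $u_n=Pu_{n-1}+u_{n-2}$ for all $n\geq 2$. Let $\varphi$ denote Euler's totient function. Then the only solution of the Diophantine equation $\varphi(u_n)=u_m$ in positive integers $n,m$ is $n=m=1$, i.e. $\varphi(u_1)=\varphi(1)=1=u_1$. *)

(* Defs.v *)
From mathcomp Require Import all_boot.

Fixpoint lucas (P n : nat) : nat :=
  match n with
  | 0 => 0
  | n1.+1 => match n1 with
             | 0 => 1
             | n2.+1 => P * lucas P n1 + lucas P n2
             end
  end.

(* Main.v *)
(** For a solution with $1 < m < n$ let $k = n - m$, let $p$ run over the primes, and
    let $z(p)$ be the rank of apparition of $p$ in $u$.  From $u_{k+1} u_m \le u_n$ one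
    gets $P^k \le u_{k+1} \le \prod_{p | u_n} p / (p-1)$, so $u_n$ has many prime factors.

    If $n$ is odd, the odd primes dividing $u_n$ are all $1$ modulo $4$, so that
    $4^s | \varphi(u_n) = u_m$ for their number $s$, and the $2$-adic valuation of
    $u_m$ makes $m$ of size at least $4^s / P$.  On the other hand, the equation is an
    identity between the products of the $p$ and of the $p - 1$; bounding one prime
    after the other in terms of the preceding ones, using that the form
    $x^2 - P x y - y^2$ has no nontrivial zero, shows that $m$ is at most of
    order $s 3^s$.

    If $n$ is even, then so is $k$, and some odd prime $q$ divides $n$ to a higher power
    than $k$; take $q$ minimal.  A primitive prime divisor $p$ of $u_{2e}$, $e$ odd, is
    $1$ modulo $2e$; for $q | e$ it contributes a factor $q$ to $u_m$, whose $q$-adic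
    valuation is only $v_q(k) + v_q(u_{z(q)})$.  Hence $n$ has few divisors $e$ with
    $e \nmid k$ and $e^2$ below its odd part.  Every such $e$ is at least $q$ and the
    primes whose rank has odd part $e$ are $\pm 1$ modulo $e$, so the sum of their $1/p$
    is at most of order $\log e / e$.  Summing over $e$ contradicts the lower bound
    $\log u_{k+1}$ for $\sum_{p | u_n} \log (p / (p-1))$. *)
Require Import Defs.
From mathcomp Require Import all_boot all_order all_algebra all_field.
From mathcomp Require Import reals sequences exp Rstruct.
From mathcomp Require Import zify ring lra.

Set Implicit Arguments.
Unset Strict Implicit.
Unset Printing Implicit Defensive.

(** The odd case works because 3 < 4: a new prime is at most a constant times the square of the
    product of its predecessors, so the bound is cubed at each prime, whereas [4^s] divides [u_m].
    For even [n] only [2^s] divides [u_m], and 2 < 3 makes this comparison useless.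

    The power of 2 still serves there: [(P + 1) k <= P^k < 2^s] makes the 2-part of [m] exceed [k].
    So [n = m + k] has the same 2-adic valuation as [k], the prime [q] is odd, and the odd part of
    [n] is exponentially large in [s]. But it has at most [s + 2] divisors, because each of them
    other than 1 and 3 gives a primitive prime of its own. Ranks beyond its square root therefore
    contribute almost nothing, and only the few small ones matter.

    What they contribute is compared with [ln (P^2 + 2)]. For small [k] both sides are of the same
    size, hence the explicit logarithms and the separate cases [k = 2], [k = 4] and [k >= 6]. One
    primitive divisor is missing, for [u_6 = 360] with [P = 3]; it can interfere only if 6 divides
    [k]. *)

Fixpoint companion (P n : nat) : nat :=
  match n with
  | 0 => 2
  | n1.+1 => match n1 with
             | 0 => P
             | n2.+1 => P * companion P n1 + companion P n2
             end
  end.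

(** * Identities and gcd property of the Lucas sequence and its companion *)

Section LucasArithmetic.
Variable P : nat.
Local Notation u := (lucas P).
Local Notation v := (companion P).

Lemma lucasSS n : u n.+2 = P * u n.+1 + u n.
Proof. by []. Qed.

Lemma companionSS n : v n.+2 = P * v n.+1 + v n.
Proof. by []. Qed.

Lemma nat_ind2 (Q : nat -> Prop) :
  Q 0 -> Q 1 -> (forall n, Q n -> Q n.+1 -> Q n.+2) -> forall n, Q n.
Proof.
move=> H0 H1 HS n; suff: Q n /\ Q n.+1 by case.
by elim: n => [|n [Hn HSn]]; split=> //; apply: HS.
Qed.

Lemma lucas_add m n : u (m + n).+1 = u m.+1 * u n.+1 + u m * u n.
Proof.
elim/nat_ind2: m => [||m IH0 IH1]; first by rewrite add0n /= mul1n mul0n addn0.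
  by rewrite add1n lucasSS /=; lia.
rewrite !addSn lucasSS IH1 -addSn addSn IH0 !lucasSS; ring.
Qed.

Lemma companion_lucas n : v n.+1 = u n.+2 + u n.
Proof.
elim/nat_ind2: n => [||n IH0 IH1]; first by rewrite /=; lia.
  by rewrite /=; ring.
by rewrite companionSS IH1 IH0 !lucasSS; ring.
Qed.

Lemma companion_lucas2 n : P * u n + v n = 2 * u n.+1.
Proof. by case: n => [|n]; [rewrite /=; lia | rewrite companion_lucas lucasSS; lia]. Qed.

Lemma lucas_double n : u (2 * n) = u n * v n.
Proof.
case: n => [//|n]; have -> : 2 * n.+1 = (n.+1 + n).+1 by lia.
by rewrite lucas_add companion_lucas; ring.
Qed.

(** The sign [(-1)^n] is distributed over the two sides as the numbers [odd n] and [~~ odd n], which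
    avoids truncated subtraction. [companion_square] and [companion_double] use the same device. *)
Lemma lucas_cassini n :
  u n.+1 ^ 2 + odd n = P * u n.+1 * u n + u n ^ 2 + ~~ odd n.
Proof.
elim: n => [|n IH]; first by rewrite /=; lia.
rewrite lucasSS oddS; case: (odd n) IH => /= IH; nia.
Qed.

Lemma companion_square n :
  v n ^ 2 + 4 * odd n = (P ^ 2 + 4) * u n ^ 2 + 4 * ~~ odd n.
Proof.
have H1 := companion_lucas2 n; have H2 := lucas_cassini n.
have -> : v n = 2 * u n.+1 - P * u n by lia.
have : P * u n <= 2 * u n.+1 by lia.
by move: H2; move: (u n) (u n.+1) (odd n) => a b c H2 {}H1; nia.
Qed.

Lemma companion_double n : v (2 * n) + 2 * ~~ odd n = v n ^ 2 + 2 * odd n.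
Proof.
case: n => [|n]; first by rewrite /=; lia.
have -> : 2 * n.+1 = (n.+1 + n).+1 by lia.
rewrite companion_lucas.
have -> : (n.+1 + n).+2 = (n.+1 + n.+1).+1 by lia.
have -> : n.+1 + n = (n + n).+1 by lia.
rewrite !lucas_add companion_lucas !lucasSS.
have := lucas_cassini n; rewrite oddS; case: (odd n) => /=; nia.
Qed.

Lemma coprime_lucasS n : coprime (u n) (u n.+1).
Proof.
elim: n => [//|n IH]; rewrite lucasSS.
by rewrite /coprime gcdnMDl gcdnC.
Qed.

Lemma gcd_lucas_add m n : gcdn (u m) (u (m + n)) = gcdn (u m) (u n).
Proof.
case: m => [|m]; first by rewrite add0n.
rewrite addSn lucas_add mulnC gcdnMDl.
by rewrite Gauss_gcdr // coprime_sym coprime_lucasS.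
Qed.

Lemma gcd_lucas m n : gcdn (u m) (u n) = u (gcdn m n).
Proof.
have [k] := ubnP (m + n); elim: k m n => // k IH m n.
case: m => [|m] lt; first by rewrite !gcd0n.
case: (leqP m.+1 n) => [le_mn | lt_nm].
  have e : n = m.+1 + (n - m.+1) by lia.
  rewrite e gcd_lucas_add IH; last lia.
  by rewrite gcdnDl.
case: n lt lt_nm => [|n] lt lt_nm; first by rewrite !gcdn0.
have e : m.+1 = n.+1 + (m.+1 - n.+1) by lia.
rewrite e gcdnC gcd_lucas_add IH; last lia.
by rewrite (gcdnC _ n.+1) gcdnDl.
Qed.

Lemma dvdn_lucas m n : m %| n -> u m %| u n.
Proof. by move=> /gcdn_idPl e; apply/gcdn_idPl; rewrite gcd_lucas e. Qed.

(* The companion pair for the index [n * j], expanded to second order in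
   [u n.+1]; the factor [y ^ 2] avoids truncated exponents. *)
Lemma lucas_mul_expansion n j :
  let x := u n.+1 in let y := u n in
  exists A V c d,
  [/\ u (n.+1 * j) = x * A, u (n.+1 * j).+1 = P * x * A + V,
      V = y ^ j + x ^ 2 * c
    & y ^ 2 * A = j * y ^ j.+1 + 'C(j, 2) * P * x * y ^ j + x ^ 2 * d].
Proof.
move=> x y; elim: j => [|j [A [V [c [d [E1 E2 E3 E4]]]]]].
  exists 0, 1, 0, 0; rewrite muln0 bin0n /=; split; lia.
exists (A * (P * x + y) + V), (x ^ 2 * A + V * y), (A + c * y).
exists (d * (P * x + y) + 'C(j, 2) * P ^ 2 * y ^ j + c * y ^ 2).
have e1 : u (n.+1 * j.+1) = x * (A * (P * x + y) + V).
  have -> : n.+1 * j.+1 = (n.+1 * j + n).+1 by lia.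
  by rewrite lucas_add E1 E2 -/x -/y; ring.
have e2 : u (n.+1 * j.+1).+1 = P * x * (A * (P * x + y) + V) + (x ^ 2 * A + V * y).
  have -> : n.+1 * j.+1 = n.+1 * j + n.+1 by lia.
  by rewrite lucas_add E1 E2 lucasSS -/x -/y; ring.
split=> //; first by rewrite E3 (expnS y j); ring.
have -> : y ^ 2 * (A * (P * x + y) + V) = (y ^ 2 * A) * (P * x + y) + y ^ 2 * V.
  by ring.
rewrite E4 E3 binS bin1 (expnS y j.+1) (expnS y j); ring.
Qed.

End LucasArithmetic.

(** * Law of apparition, by the Frobenius map on 2 by 2 matrices over [F_p] *)

Section Apparition.
Import GRing.Theory.
Local Open Scope ring_scope.
Variables (P p : nat).
Hypotheses (p_pr : prime p) (p_odd : odd p).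
Local Notation u := (lucas P).
Local Notation F := 'F_p.

(** [M] is the companion matrix of [x^2 - P x - 1], and [N] is its trace-free part, with square the
    scalar [delta = (P^2 + 4) / 4]. The matrix ring replaces the field generated by a square root of
    the discriminant, so that split and inert primes need no distinction. *)
Let M : 'M[F]_2 := \matrix_(i, j) (if (i == 0) && (j == 0) then P%:R else (i != j)%:R).
Let c : F := P%:R / 2%:R.
Let delta : F := c ^+ 2 + 1.
Let N : 'M[F]_2 := M - c%:M.

Lemma Fp_nat_eq0 (n : nat) : (n%:R == 0 :> F) = (p %| n)%N.
Proof. by rewrite -(dvdn_pcharf (pchar_Fp p_pr)). Qed.

Let Fp_fermat (x : F) : x ^+ p = x.
Proof. by have := expf_card x; rewrite card_Fp. Qed.

Let two_neq0 : 2%:R != 0 :> F.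
Proof.
rewrite Fp_nat_eq0; apply/negP=> /(dvdn_leq (ltn0Sn 1)).
by move: (prime_gt1 p_pr) p_odd; case: (p) => [|[|[|]]].
Qed.

Let MM : M * M = P%:R *: M + 1.
Proof.
apply/matrixP=> i j; rewrite !mxE big_ord_recl big_ord1 !mxE /=.
by case: i j => [[|[|i]] Hi] [[|[|j]] Hj] //=; rewrite !(mulr1, mulr0, mul0r, addr0, add0r, mul1r).
Qed.

Let M_exp n : M ^+ n.+1 = (u n.+1)%:R *: M + (u n)%:R%:M.
Proof.
elim: n => [|n IH]; first by rewrite expr1 /= scale1r raddf0 addr0.
rewrite exprS IH mulrDr -scalerAr MM.
rewrite -(scalemx1 2 (u n)%:R) -scalerAr mulr1 scalerDr scalerA.
rewrite addrAC -scalerDl; congr (_ *: _ + _); last by rewrite -scalemx1.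
by rewrite lucasSS natrD natrM mulrC.
Qed.

Let N01 : N 0 1 = 1.
Proof. by rewrite !mxE /= subr0. Qed.

Let e2 : P%:R = c + c.
Proof. by rewrite -mulr2n -(mulr_natr c 2) /c mulfVK. Qed.

Let NN : N * N = delta%:M.
Proof.
apply/matrixP=> i j; rewrite !mxE big_ord_recl big_ord1 !mxE /= e2 /delta.
by case: i j => [[|[|i]] Hi] [[|[|j]] Hj] //=;
  rewrite ?(mulr1n, mulr0n); ring.
Qed.

(** By Euler's criterion this is the Legendre symbol of [P^2 + 4] modulo [p]. *)
Let eta : F := delta ^+ (p.-1)./2.

Let pcharM : p \in [pchar 'M[F]_2].
Proof.
rewrite inE p_pr /= -(rmorph_nat (@scalar_mx F 2)).
by rewrite (pcharf0 (pchar_Fp p_pr)) raddf0.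
Qed.

(** The scalar [c] commutes with [N], so the [p]-th power is additive on [c + N]. It fixes [c], and
    [N^p = N (N^2)^((p-1)/2) = eta N]. Comparing entries with [M_exp] then gives [u_p] and its two
    neighbours modulo [p]. *)
Let M_Frobenius : M ^+ p = c%:M + eta *: N.
Proof.
have -> : M = c%:M + N by rewrite /N addrC subrK.
have cN : GRing.comm c%:M N by rewrite /GRing.comm -[c%:M]scalemx1 -scalerAl -scalerAr mul1r mulr1.
rewrite -(pFrobenius_autE pcharM) pFrobenius_autD_comm // !pFrobenius_autE.
have -> : c%:M ^+ p = (c ^+ p)%:M :> 'M[F]_2 by rewrite -rmorphXn.
congr (_%:M + _); first exact: Fp_fermat.
have ep : p = (1 + 2 * (p.-1)./2)%N.
  by move: p_odd (prime_gt0 p_pr); lia.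
rewrite (congr1 (fun j => N ^+ j) ep) exprD expr1 exprM expr2 NN -rmorphXn /= -/eta.
by rewrite -scalemx1 -scalerAr mulr1.
Qed.

Let lucas_p : (u p)%:R = eta.
Proof.
have := M_Frobenius; have := M_exp p.-1; rewrite prednK ?prime_gt0 // => ->.
move=> /matrixP /(_ 0 1); rewrite !mxE /= !mulr1n => e.
by move: e; rewrite !(mulr1, mulr0n, mulr0, addr0, subr0, add0r).
Qed.

Let lucas_Sp : (u p.+1)%:R = c * (1 + eta).
Proof.
have := M_exp p; rewrite exprS M_Frobenius.
move=> /matrixP /(_ 0 1); rewrite !mxE /= !big_ord_recl big_ord0 !mxE /= e2.
rewrite !(mulr1n, mulr0n, mulr1, mulr0, addr0, subr0, add0r, mul1r) => <-.
ring.
Qed.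

Let lucas_predp : (u p.-1)%:R = c * (1 - eta).
Proof.
have := lucasSS P p.-1; rewrite prednK ?prime_gt0 // => /(congr1 (fun x => x%:R : F)).
rewrite natrD natrM lucas_Sp lucas_p e2 => e.
by rewrite -[LHS](addKr ((c + c) * eta)) -e; ring.
Qed.

Let delta4 : (P ^ 2 + 4)%:R = delta * 4%:R.
Proof. by rewrite natrD natrX e2 /delta; ring. Qed.

Let four_neq0 : 4%:R != 0 :> F.
Proof. by rewrite -[4%N]/(2 * 2)%N natrM mulf_neq0. Qed.

Lemma dvdn_lucas_discr : (p %| P ^ 2 + 4)%N -> (p %| u p)%N.
Proof.
rewrite -!Fp_nat_eq0 delta4 mulf_eq0 (negPf four_neq0) orbF lucas_p /eta => /eqP ->.
rewrite expr0n; have : (2 < p)%N by rewrite odd_prime_gt2.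
by case: (p) => [|[|[|n]]].
Qed.

Lemma dvdn_lucas_apparition :
  ~~ (p %| P ^ 2 + 4)%N -> (p %| u p.-1)%N || (p %| u p.+1)%N.
Proof.
rewrite -!Fp_nat_eq0 delta4 mulf_eq0 (negPf four_neq0) orbF => d0.
rewrite lucas_predp lucas_Sp.
have : eta ^+ 2 = 1.
  rewrite /eta -exprM.
  have -> : ((p.-1)./2 * 2 = p.-1)%N by move: p_odd (prime_gt0 p_pr); lia.
  apply: (mulfI d0); rewrite mulr1 -exprS prednK ?prime_gt0 //.
move/eqP; rewrite sqrf_eq1 => /orP[] /eqP ->.
  by rewrite subrr mulr0 eqxx.
by rewrite subrr mulr0 eqxx orbT.
Qed.

(** The hypothesis says that [P^2 + 4] is a nonzero square modulo [p], so that [eta = 1]. *)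
Lemma dvdn_lucas_pred (x : nat) :
  ((P ^ 2 + 4) * x ^ 2 = 4 %[mod p])%N -> (p %| u p.-1)%N.
Proof.
move=> e; rewrite -Fp_nat_eq0 lucas_predp.
suff -> : eta = 1 by rewrite subrr mulr0.
have {}e : ((P ^ 2 + 4) * x ^ 2)%:R = 4%:R :> F.
  by rewrite -Fp_nat_mod // e Fp_nat_mod.
have dx : delta * x%:R ^+ 2 = 1.
  apply: (mulfI four_neq0); rewrite mulr1 -[RHS]e natrM delta4 natrX; ring.
have x0 : x%:R != 0 :> F.
  by apply: contra_eq_neq dx => ->; rewrite expr0n mulr0 eq_sym oner_neq0.
have -> : eta = (delta * x%:R ^+ 2) ^+ (p.-1)./2 / x%:R ^+ p.-1.
  rewrite exprMn -exprM -/eta.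
  have -> : (2 * (p.-1)./2 = p.-1)%N by move: p_odd (prime_gt0 p_pr); lia.
  by rewrite mulfK // expf_neq0.
rewrite dx expr1n div1r; apply/eqP; rewrite invr_eq1; apply/eqP.
apply: (mulfI x0); rewrite mulr1 -exprS prednK ?prime_gt0 //.
Qed.
End Apparition.

Arguments lucas : simpl never.
Arguments companion : simpl never.

Lemma prime_dvd_sqrS_mod4 p x : prime p -> odd p -> p %| x ^ 2 + 1 -> p %% 4 = 1.
Proof.
move=> p_pr p_odd; rewrite -Fp_nat_eq0 // GRing.natrD GRing.natrX => e.
pose h := (p.-1)./2; have ep : p.-1 = (2 * h)%N by move: p_odd (prime_gt0 p_pr); lia.
suff : ~~ odd h by move: ep (prime_gt0 p_pr); lia.
have x2 : (x%:R ^+ 2 = -1 :> 'F_p)%R by apply/eqP; rewrite -GRing.addr_eq0.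
have x0 : (x%:R != 0 :> 'F_p)%R.
  apply: contra_eq_neq x2 => ->; rewrite GRing.expr0n /=.
  by rewrite eq_sym GRing.oppr_eq0 GRing.oner_neq0.
have xp : (x%:R ^+ p.-1 = 1 :> 'F_p)%R.
  apply: (GRing.mulfI x0); rewrite GRing.mulr1 -GRing.exprS prednK ?prime_gt0 //.
  by have := expf_card (x%:R : 'F_p)%R; rewrite card_Fp.
apply/negP => ho; move: xp; rewrite ep GRing.exprM x2 -GRing.signr_odd ho GRing.expr1.
move/eqP; rewrite eq_sym -GRing.addr_eq0 -(GRing.natrD _ 1 1) Fp_nat_eq0 //.
move/(dvdn_leq (ltn0Sn 1)).
by move: (prime_gt1 p_pr) p_odd; case: (p) => [|[|[|]]].
Qed.

(** * Rank of apparition, growth, and valuations of Lucas numbers *)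

Section Rank.
Variable P : nat.
Hypothesis hP : 2 < P.
Local Notation u := (lucas P).
Local Notation v := (companion P).

Lemma lucas_gt0 n : 0 < n -> 0 < u n.
Proof.
case: n => // n _; elim/nat_ind2: n => [||n H0 H1] //.
  by rewrite /lucas; lia.
by rewrite lucasSS; lia.
Qed.

(** In [u_{nj} = u_n A] the cofactor is congruent to [j u_{n-1}^(j-1)] modulo [p]. This is a unit,
    because [u_{n-1}] is coprime to [u_n]. *)
Lemma logn_lucas_coprime p n j : prime p -> 0 < n -> 0 < j -> p %| u n ->
  coprime p j -> logn p (u (n * j)) = logn p (u n).
Proof.
case: n => // n p_pr _ j0 px cop.
have [A [V [c [d [E1 _ E3 E4]]]]] := lucas_mul_expansion P n j.
have x0 : 0 < u n.+1 by apply: lucas_gt0.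
have coy : coprime p (u n).
  by apply: coprime_dvdl px _; rewrite coprime_sym coprime_lucasS.
have A0 : ~~ (p %| A).
  apply/negP=> pA.
  have : p %| j * u n ^ j.+1 + 'C(j, 2) * P * u n.+1 * u n ^ j + u n.+1 ^ 2 * d.
    by rewrite -E4 dvdn_mull.
  rewrite dvdn_addl ?dvdn_addl.
  - by rewrite Gauss_dvdl ?coprimeXr //; apply/negP; rewrite -prime_coprime.
  - by rewrite dvdn_mulr // dvdn_mull.
  - by rewrite dvdn_mulr // expnS dvdn_mulr.
have A00 : 0 < A by case: A A0 {E1 E4} => //; rewrite dvdn0.
rewrite E1 lognM // -[RHS]addn0; congr (_ + _).
by rewrite logn_coprime // prime_coprime.
Qed.

(** Lifting the exponent: as [p] is odd it divides ['C(p, 2)], so only the linear term of the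
    expansion survives modulo [p^2] and contributes exactly one factor [p]. The prime 2 is treated
    in [lucas_two_part_le]. *)
Lemma logn_lucas_prime p n : prime p -> odd p -> 0 < n -> p %| u n ->
  logn p (u (n * p)) = (logn p (u n)).+1.
Proof.
case: n => // n p_pr p_odd _ px.
have [A [V [c [d [E1 _ E3 E4]]]]] := lucas_mul_expansion P n p.
have x0 : 0 < u n.+1 by apply: lucas_gt0.
have coy : coprime p (u n).
  by apply: coprime_dvdl px _; rewrite coprime_sym coprime_lucasS.
have pbin : p %| 'C(p, 2) by rewrite prime_dvd_bin //= odd_prime_gt2.
have [r Er] : exists r, 'C(p, 2) * P * u n.+1 * u n ^ p + u n.+1 ^ 2 * d = p ^ 2 * r.
  case/dvdnP: px => x' ->; case/dvdnP: pbin => b ->.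
  by exists (b * P * x' * u n ^ p + x' ^ 2 * d); ring.
have E5 : u n ^ 2 * A = p * (u n ^ p.+1 + p * r).
  by rewrite E4 -addnA Er; ring.
have pA : p %| A.
  have : p %| u n ^ 2 * A by rewrite E5 dvdn_mulr.
  by rewrite Gauss_dvdr // coprimeXr.
have [A' EA] := dvdnP pA.
have p0 := prime_gt0 p_pr.
have E6 : u n ^ 2 * A' = u n ^ p.+1 + p * r.
  by apply/eqP; rewrite -(eqn_pmul2l p0) -E5 EA; apply/eqP; ring.
have A0 : ~~ (p %| A').
  apply/negP=> pA'; have : p %| u n ^ p.+1 + p * r by rewrite -E6 dvdn_mull.
  rewrite dvdn_addl ?dvdn_mulr // Euclid_dvdX // andbT.
  by apply/negP; rewrite -prime_coprime.
have A00 : 0 < A' by case: A' A0 {EA E6} => //; rewrite dvdn0.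
rewrite E1 EA !lognM ?muln_gt0 ?A00 ?p0 // (logn_prime _ p_pr) eqxx.
by rewrite (logn_coprime (m := A')) ?prime_coprime // add0n addn1.
Qed.

Lemma logn_lucas_mul p n j : prime p -> odd p -> 0 < n -> 0 < j -> p %| u n ->
  logn p (u (n * j)) = logn p (u n) + logn p j.
Proof.
move=> p_pr p_odd n0 j0 pn.
have [r cop ej] := pfactor_coprime p_pr j0.
have r0 : 0 < r by move: j0; rewrite ej; case: (r).
rewrite {1}ej mulnCA mulnC.
have key i : p %| u (n * p ^ i) /\ logn p (u (n * p ^ i)) = logn p (u n) + i.
  elim: i => [|i [d IH]]; first by rewrite expn0 muln1 addn0.
  rewrite expnSr mulnA; split; first by apply: dvdn_trans d _; apply/dvdn_lucas/dvdn_mulr.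
  by rewrite logn_lucas_prime ?IH ?addnS // muln_gt0 n0 expn_gt0 prime_gt0.
have [d e] := key (logn p j).
by rewrite logn_lucas_coprime // muln_gt0 n0 expn_gt0 prime_gt0.
Qed.

(** For a prime the search over the indices [1 .. p + 1] succeeds by [prime_apparition]; a failed
    search returns [p + 2]. *)
Definition lrank p := (find (fun i => p %| u i.+1) (iota 0 p.+1)).+1.

Lemma prime_apparition p : prime p -> has (fun i => p %| u i.+1) (iota 0 p.+1).
Proof.
move=> p_pr; have [p2|p_odd] := even_prime p_pr.
  apply/hasP; exists (1 + odd P); first by rewrite mem_iota p2; case: (odd P).
  by case E: (odd P); rewrite p2 dvdn2 /lucas !(oddD, oddM, E).
have p2 := odd_prime_gt2 p_odd p_pr.
have [pd|npd] := boolP (p %| P ^ 2 + 4).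
  apply/hasP; exists p.-1; first by rewrite mem_iota; lia.
  by rewrite prednK ?prime_gt0 // dvdn_lucas_discr.
case/orP: (dvdn_lucas_apparition p_pr p_odd npd) => h; apply/hasP.
  exists p.-2; first by rewrite mem_iota; lia.
  by have -> : p.-2.+1 = p.-1 by lia.
by exists p; first by rewrite mem_iota; lia.
Qed.

Lemma dvdn_lucas_rank p : prime p -> p %| u (lrank p).
Proof.
move=> p_pr; have := nth_find 0 (prime_apparition p_pr).
by rewrite nth_iota // -[X in _ < X](size_iota 0) -has_find prime_apparition.
Qed.

Lemma lrank_le p n : prime p -> 0 < n -> p %| u n -> lrank p <= n.
Proof.
case: n => // n p_pr _ pn; rewrite leqNgt; apply/negP=> lt.
have {}lt : n < find (fun i => p %| u i.+1) (iota 0 p.+1) by [].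
have := before_find 0 lt; rewrite nth_iota ?add0n ?pn //; apply: leq_trans lt _.
by rewrite -[X in _ <= X](size_iota 0) find_size.
Qed.

Lemma dvdn_lucasE p n : prime p -> (p %| u n) = (lrank p %| n).
Proof.
move=> p_pr; apply/idP/idP => [pn | /(dvdn_lucas P)]; last first.
  by apply: dvdn_trans; apply: dvdn_lucas_rank.
have g0 : 0 < gcdn n (lrank p) by rewrite gcdn_gt0 orbT.
have : p %| u (gcdn n (lrank p)) by rewrite -gcd_lucas dvdn_gcd pn dvdn_lucas_rank.
move=> /(lrank_le p_pr g0) le; apply/gcdn_idPr/eqP.
by rewrite eqn_leq le dvdn_leq // dvdn_gcdr.
Qed.

Lemma lrank_gt1 p : prime p -> 1 < lrank p.
Proof.
move=> p_pr; rewrite ltn_neqAle andbT eq_sym; apply/eqP=> e.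
by have := dvdn_lucas_rank p_pr; rewrite e dvdn1 => /eqP p1; move: p_pr; rewrite p1.
Qed.

Lemma lrank_discr p : prime p -> odd p -> p %| P ^ 2 + 4 -> lrank p = p.
Proof.
move=> p_pr p_odd pd; have := dvdn_lucas_discr p_pr p_odd pd.
rewrite dvdn_lucasE // => /(primeP p_pr).2 /orP[] /eqP // e.
by have := lrank_gt1 p_pr; rewrite e.
Qed.

Lemma lrank_mod p : prime p -> odd p -> ~~ (p %| P ^ 2 + 4) ->
  (lrank p %| p.-1) || (lrank p %| p.+1).
Proof. by move=> p_pr p_odd /(dvdn_lucas_apparition p_pr p_odd); rewrite !dvdn_lucasE. Qed.

(** At an odd index Cassini's identity gives [u_{n-1}^2 = -1] modulo [u_n], so [-1] is a square
    modulo [p]. *)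
Lemma lucas_odd_prime_mod4 p n : prime p -> odd p -> odd n -> p %| u n -> p %% 4 = 1.
Proof.
move=> p_pr p_odd; case: n => // n /=; rewrite -[~~ odd n]/(odd n.+1) => no pn.
apply: (@prime_dvd_sqrS_mod4 p (u n) p_pr p_odd).
have := lucas_cassini P n; move: no; rewrite oddS => /negPf -> /=; rewrite addn0 => H.
have pm : p %| P * u n.+1 * u n by rewrite dvdn_mulr // dvdn_mull.
by rewrite -(dvdn_addr _ pm) addnA -H expnS dvdn_mulr.
Qed.

(** The same congruence modulo 4, where [-1] is not a square. *)
Lemma lucas_odd_dvd4 n : odd n -> ~~ (4 %| u n).
Proof.
case: n => // n /=; move=> no; apply/negP=> /dvdnP[c e].
have := lucas_cassini P n; rewrite (negPf no) e /= addn0 => H.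
have [b Eb] : exists b, u n = 2 * b \/ u n = 2 * b + 1.
  by exists ((u n)./2); lia.
have : 4 %| u n ^ 2 + 1.
  have pm : 4 %| P * (c * 4) * u n by rewrite dvdn_mulr // dvdn_mull // dvdn_mull.
  by rewrite -(dvdn_addr _ pm) addnA -H expnS dvdn_mulr // dvdn_mull.
case: Eb => ->.
  have -> : (2 * b) ^ 2 + 1 = 4 * (b * b) + 1 by ring.
  by lia.
have -> : (2 * b + 1) ^ 2 + 1 = 4 * (b * b + b) + 2 by ring.
by lia.
Qed.

(** For odd [e] one has [v_e^2 + 4 = (P^2 + 4) u_e^2], so a prime divisor of [v_e] makes the
    discriminant a square. *)
Lemma lrank_double_dvd p e : prime p -> odd p -> odd e -> p %| v e -> lrank p %| p.-1.
Proof.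
move=> p_pr p_odd e_odd pv; rewrite -dvdn_lucasE //.
apply: (dvdn_lucas_pred p_pr p_odd (x := u e)).
have := companion_square P e; rewrite e_odd /= addn0 muln1 => <-.
have pv2 : p %| v e ^ 2 by rewrite expnS dvdn_mulr.
by rewrite -modnDml (eqP pv2).
Qed.

Lemma leq_lucasS n : u n <= u n.+1.
Proof. by case: n => // n; rewrite lucasSS; nia. Qed.

Lemma lucas_mono m n : m <= n -> u m <= u n.
Proof.
move=> /subnK <-; elim: (n - m) => // i IH.
by rewrite addSn; apply: leq_trans IH _; apply: leq_lucasS.
Qed.

Lemma lucasS_ge n : P * u n <= u n.+1.
Proof. by case: n => [|n]; [rewrite muln0 | rewrite lucasSS; lia]. Qed.

Lemma lucasS_le n : 0 < n -> u n.+1 <= P.+1 * u n.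
Proof. by case: n => // n _; rewrite lucasSS; have := leq_lucasS n; nia. Qed.

Lemma lucas_exp_ge n : P ^ n <= u n.+1.
Proof.
elim: n => // n IH; rewrite expnS; apply: leq_trans (lucasS_ge n.+1).
by rewrite leq_mul2l IH orbT.
Qed.

Lemma lucas_exp_le n : u n.+2 <= P * P.+1 ^ n.
Proof.
elim: n => [|n IH]; first by rewrite /lucas; lia.
apply: leq_trans (lucasS_le _) _ => //; rewrite expnS mulnCA leq_mul2l.
by rewrite IH orbT.
Qed.

Lemma lucas_mul_le m k : u k.+1 * u m <= u (k + m).
Proof.
case: m => [|m]; first by rewrite muln0.
by rewrite addnS lucas_add; lia.
Qed.

Lemma companion_gt0 n : 0 < v n.
Proof.
elim/nat_ind2: n => [||n H0 H1] //; first by rewrite /companion; lia.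
by rewrite companionSS; lia.
Qed.

Lemma companion_mono m n : 0 < m -> m <= n -> v m <= v n.
Proof.
move=> m0 /subnK <-; elim: (n - m) => // i IH.
rewrite addSn; apply: leq_trans IH _.
have : 0 < i + m by lia.
by case: (i + m) => // j _; rewrite companionSS; nia.
Qed.

Lemma companion_exp_lt n : 0 < n -> v n < P.+1 ^ n.
Proof.
case: n => // n _; elim/nat_ind2: n => [||n H0 H1].
- by rewrite /companion expn1.
- by rewrite /companion; nia.
have le1 : v n.+1 <= v n.+2 by apply: companion_mono.
by rewrite companionSS expnS; nia.
Qed.

(** The base is [v_2], with equality at [n = 2]. Steps of two suffice because
    [v_{n+4} = (P^2 + 2) v_{n+2} - v_n]. The logarithm of this base is the unit of measure in the
    final estimates for even [n]. *)
Lemma companion_sqr_le n : 0 < n -> v n ^ 2 <= (P ^ 2 + 2) ^ n.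
Proof.
case: n => // [[_|n _]]; first by rewrite /companion; lia.
elim/nat_ind2: n => [||n H0 _]; first by rewrite /companion; nia.
  by rewrite /companion; nia.
have le : v n.+4 <= (P ^ 2 + 2) * v n.+2 by rewrite !companionSS; nia.
have -> : (P ^ 2 + 2) ^ n.+4 = (P ^ 2 + 2) ^ 2 * (P ^ 2 + 2) ^ n.+2 by rewrite -expnD.
apply: leq_trans (leq_mul (leqnn _) H0).
by rewrite -expnMn leq_exp2r.
Qed.

Lemma lucas_le_companion n : u n <= v n.
Proof. by case: n => // n; rewrite companion_lucas; have := leq_lucasS n.+1; lia. Qed.

(* Since [z = lrank q] divides [q - 1] or [q + 1], either [z] is even and the
   power of [q] divides [v (z / 2)], or [z <= (q + 1) / 2]. *)
Lemma lucas_rank_part_le q : prime q -> odd q -> ~~ (q %| P ^ 2 + 4) ->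
  (q ^ logn q (u (lrank q))) ^ 4 <= (P ^ 2 + 2) ^ q.+1.
Proof.
move=> q_pr q_odd nq; set z := lrank q; set b := logn q _.
have q2 := odd_prime_gt2 q_odd q_pr; have z1 := lrank_gt1 q_pr.
suff [j [j0 jq le]] : exists j, [/\ 0 < j, j <= (q.+1)./2 & q ^ b <= v j].
  apply: (leq_trans (n := (v (q.+1)./2 ^ 2) ^ 2)).
    by rewrite -(expnM (v _) 2 2) leq_exp2r //; apply: leq_trans le _; apply: companion_mono.
  apply: (leq_trans (n := ((P ^ 2 + 2) ^ (q.+1)./2) ^ 2)).
    by rewrite leq_exp2r // companion_sqr_le //; lia.
  by rewrite -expnM; have -> : (q.+1)./2 * 2 = q.+1 by lia.
have zq : (z %| q.-1) || (z %| q.+1) by apply: lrank_mod.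
have uz0 : 0 < u z by apply: lucas_gt0; lia.
have [z_odd|z_even] := boolP (odd z).
  exists z; split; first lia.
    case/orP: zq => /dvdnP[c e]; have : ~~ odd (c * z) by rewrite -e; lia.
      by rewrite oddM z_odd andbT => ce; case: c ce e => [|[|c]] //= _; nia.
    by rewrite oddM z_odd andbT => ce; case: c ce e => [|[|c]] //= _; nia.
  apply: leq_trans (lucas_le_companion z); apply: dvdn_leq => //.
  exact: pfactor_dvdnn.
exists z./2; split; first lia.
  case/orP: zq => /dvdn_leq le; apply: half_leq; apply: leq_trans (le _) _; lia.
apply: dvdn_leq; first exact: companion_gt0.
have ez : z = 2 * z./2 by lia.
have coq : coprime (q ^ b) (u z./2).
  apply: coprimeXl; rewrite prime_coprime // dvdn_lucasE // -/z.
  by apply/negP=> /dvdn_leq; lia.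
by rewrite -(Gauss_dvdr _ coq) -lucas_double -ez pfactor_dvdnn.
Qed.

(* Expansion at the double root to second order in [D = P ^ 2 + 4]; the factor
   [P ^ 3] avoids truncated exponents. *)
Lemma lucas_discr_expansion n : let D := P ^ 2 + 4 in exists c d,
  P ^ 3 * 2 ^ n * u n = 2 * n * P ^ n.+2 + 2 * 'C(n, 3) * P ^ n * D + D ^ 2 * c
  /\ P ^ 3 * 2 ^ n * v n = 2 * P ^ n.+3 + 2 * 'C(n, 2) * P ^ n.+1 * D + D ^ 2 * d.
Proof.
move=> D.
have hv i : 2 * v i.+1 = P * v i + D * u i.
  elim/nat_ind2: i => [||i IH0 IH1].
  - by rewrite /companion /lucas; ring.
  - by rewrite /companion /lucas /D; ring.
  have -> : 2 * v i.+3 = P * (2 * v i.+2) + 2 * v i.+1 by rewrite companionSS; ring.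
  rewrite IH1 IH0 (companionSS P i) (lucasSS P i); ring.
elim: n => [|n [c [d [E1 E2]]]].
  by exists 0, 0; rewrite /lucas /companion !bin0n /=; split; ring.
exists (P * c + d), (P * d + 2 * 'C(n, 3) * P ^ n + D * c); split.
  have -> : P ^ 3 * 2 ^ n.+1 * u n.+1 = P ^ 3 * 2 ^ n * (P * u n + v n).
    by rewrite companion_lucas2 (expnS 2); ring.
  rewrite mulnDr mulnCA E1 E2 binS (expnS P n.+2) (expnS P n.+1) (expnS P n); ring.
have -> : P ^ 3 * 2 ^ n.+1 * v n.+1 = P ^ 3 * 2 ^ n * (P * v n + D * u n).
  by rewrite -hv (expnS 2); ring.
have -> : P ^ 3 * 2 ^ n * (P * v n + D * u n) =
  P * (P ^ 3 * 2 ^ n * v n) + D * (P ^ 3 * 2 ^ n * u n) by ring.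
rewrite E1 E2 binS bin1 (expnS P n.+3) (expnS P n.+2) (expnS P n.+1) (expnS P n); ring.
Qed.

(** Squares are 0 or 1 modulo 3. The bound makes [q] divide ['C(q, 3)] in [logn_lucas_discr]. *)
Lemma discr_prime_gt3 q : prime q -> odd q -> q %| P ^ 2 + 4 -> 3 < q.
Proof.
move=> q_pr q_odd qD; have q2 := odd_prime_gt2 q_odd q_pr.
rewrite ltn_neqAle q2 andbT; apply/eqP=> e3; move: qD; rewrite -e3.
have : P %% 3 = 0 \/ P %% 3 = 1 \/ P %% 3 = 2 by lia.
rewrite /dvdn -modnDml -modnXm.
by case=> [->|[->|->]].
Qed.

(** Modulo [q^2] the expansion at the double root reads [P^3 2^q u_q = 2 q P^(q+2)], and [q] divides
    neither 2 nor [P]. *)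
Lemma logn_lucas_discr q : prime q -> odd q -> q %| P ^ 2 + 4 -> logn q (u q) = 1.
Proof.
move=> q_pr q_odd qD; have q2 := odd_prime_gt2 q_odd q_pr; have q0 := prime_gt0 q_pr.
have q3 := discr_prime_gt3 q_pr q_odd qD.
have qu := dvdn_lucas_discr q_pr q_odd qD.
have uq0 : 0 < u q by apply: lucas_gt0.
apply/eqP; rewrite eqn_leq logn_gt0 mem_primes q_pr uq0 qu !andbT leqNgt.
rewrite -pfactor_dvdn //; apply/negP=> q2u.
have [c [d [E _]]] := lucas_discr_expansion q.
have [D' ED] := dvdnP qD; have [b Eb] := dvdnP (prime_dvd_bin q_pr (k := 3) q3).
have : q ^ 2 %| 2 * q * P ^ q.+2.
  have h2 : q ^ 2 %| 2 * 'C(q, 3) * P ^ q * (P ^ 2 + 4) + (P ^ 2 + 4) ^ 2 * c.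
    rewrite ED Eb; apply/dvdnP; exists (2 * b * P ^ q * D' + D' ^ 2 * c); ring.
  by rewrite -(dvdn_addl _ h2) addnA -E dvdn_mull.
have -> : 2 * q * P ^ q.+2 = q * (2 * P ^ q.+2) by ring.
rewrite expnS expn1 dvdn_pmul2l // Euclid_dvdM // Euclid_dvdX // andbT.
case/orP=> [/dvdn_leq|qP]; first by lia.
have : q %| 4 by rewrite -(dvdn_addr _ (m := P ^ 2)) // expnS dvdn_mulr.
by move/(dvdn_leq); case: q q3 q_odd {q_pr qD qu uq0 q2u E ED Eb qP q2 q0} => [|[|[|[|[|]]]]] //= q _ _; lia.
Qed.

(** Doubling an even index multiplies [u] by some [v_{2j} = v_j^2 + 2] or [v_j^2 - 2], never
    divisible by 4, so the 2-part at most doubles. The factor [P + 1] pays for the first doubling,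
    that of an odd index. *)
Lemma lucas_two_part_le m : 0 < m -> 2 ^ logn 2 (u m) <= P.+1 * 2 ^ logn 2 m.
Proof.
move=> m0; have [j] := ubnP m; elim: j m m0 => // j IH m m0 lt.
have [m_odd|m_even] := boolP (odd m).
  have l1 : logn 2 (u m) <= 1.
    rewrite leqNgt -pfactor_dvdn ?lucas_gt0 //; exact: lucas_odd_dvd4.
  have : 2 ^ logn 2 (u m) <= 2 ^ 1 by rewrite leq_exp2l.
  have : 0 < 2 ^ logn 2 m by rewrite expn_gt0.
  by nia.
have em : m = 2 * m./2 by lia.
have h0 : 0 < m./2 by lia.
have eu : u m = u m./2 * v m./2 by rewrite -lucas_double -em.
have lm : logn 2 m = (logn 2 m./2).+1 by rewrite {1}em lognM // lognE /= add1n.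
have [h_odd|h_even] := boolP (odd m./2); last first.
  have lv : logn 2 (v m./2) <= 1.
    rewrite leqNgt -pfactor_dvdn ?companion_gt0 //.
    have ej : m./2 = 2 * (m./2)./2 by lia.
    have := companion_double P (m./2)./2; rewrite -ej.
    move: (v (m./2)./2) (odd (m./2)./2) => a b E; apply/negP=> /dvdnP[c Ec].
    have [d Ed] : exists d, a = 2 * d \/ a = 2 * d + 1 by exists a./2; lia.
    by rewrite Ec in E; case: b E => /=; case: Ed => -> ; nia.
  have hlt : m./2 < j by lia.
  have := IH m./2 h0 hlt; rewrite lm eu lognM ?lucas_gt0 ?companion_gt0 // expnD.
  have : 2 ^ logn 2 (v m./2) <= 2 ^ 1 by rewrite leq_exp2l.
  rewrite expn1 [2 ^ (_).+1]expnS => leV leA.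
  apply: leq_trans (leq_mul leA leV) _; nia.
have lh : logn 2 m./2 = 0 by rewrite logn_coprime // coprime2n.
rewrite lm lh expn1.
have [P_odd|P_even] := boolP (odd P).
  (* With [h] the half of [m], [u_h] contributes at most 2 and [v_h] at most 4, and
     [8 <= 2 (P + 1)]. *)
  suff : logn 2 (u m) <= 3.
    move=> l3; have : 2 ^ logn 2 (u m) <= 2 ^ 3 by rewrite leq_exp2l.
    by lia.
  rewrite eu lognM ?lucas_gt0 ?companion_gt0 //.
  have l1 : logn 2 (u m./2) <= 1.
    by rewrite leqNgt -pfactor_dvdn ?lucas_gt0 //; exact: lucas_odd_dvd4.
  suff : logn 2 (v m./2) <= 2 by lia.
  rewrite leqNgt -pfactor_dvdn ?companion_gt0 //.
  have := companion_square P m./2; rewrite h_odd /= addn0 muln1.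
  move: (v m./2) (u m./2) => a b E; apply/negP=> /dvdnP[c Ec].
  have [d Ed] : exists d, b = 2 * d \/ b = 2 * d + 1 by exists b./2; lia.
  have [f Ef] : exists f, P = 2 * f + 1 by exists P./2; lia.
  have [r Er] : exists r, f * f + f = 2 * r.
    have : ~~ odd (f * f + f) by rewrite oddD oddM; case: (odd f).
    by exists (f * f + f)./2; lia.
  (* If 8 divided [v_h], then [u_h = 2 d] with [16 c^2 + 1 = (P^2 + 4) d^2], which is impossible
     modulo 8 since [P^2 + 4] is 5 there. *)
  have EP : P ^ 2 + 4 = 8 * r + 5 by rewrite Ef; nia.
  rewrite EP Ec in E; case: Ed => Ed; rewrite Ed in E; last by nia.
  have {}E : 16 * c ^ 2 + 1 = (8 * r + 5) * d ^ 2 by nia.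
  have [g [Eg|Eg]] : exists g, d = 2 * g \/ d = 2 * g + 1 by exists d./2; lia.
    by rewrite Eg in E; nia.
  have [w Ew] : exists w, g * g + g = 2 * w.
    have : ~~ odd (g * g + g) by rewrite oddD oddM; case: (odd g).
    by exists (g * g + g)./2; lia.
  have Ed2 : d ^ 2 = 8 * w + 1 by rewrite Eg; nia.
  by rewrite Ed2 in E; nia.
(* For even [P], [u_m = P A] where [A] has the parity of the odd number [m / 2]. *)
have [A [V [c [d [E1 _ _ E4]]]]] := lucas_mul_expansion P 1 m./2.
have u1 : u 1 = 1 by [].
have u2 : u 2 = P by rewrite /lucas; lia.
rewrite em E1 u2; rewrite u2 u1 !exp1n !muln1 mul1n in E4.
have oA : odd A by rewrite E4 !oddD !oddM h_odd (negPf P_even) !(andbF, andFb).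
rewrite lognM; [|lia|by case: (A) oA].
rewrite (logn_coprime (m := A)) ?coprime2n // addn0.
have : 2 ^ logn 2 P <= P by apply: dvdn_leq; [lia|exact: pfactor_dvdnn].
by lia.
Qed.

End Rank.

(** * Euler products over increasing lists of primes *)

Lemma prod_primes_logn N : 0 < N -> \prod_(p <- primes N) p ^ logn p N = N.
Proof. by move=> N0; rewrite [RHS]prod_prime_decomp // prime_decompE big_map. Qed.

Lemma totient_radical N : 0 < N -> exists w,
  N = (\prod_(p <- primes N) p) * w /\ totient N = (\prod_(p <- primes N) p.-1) * w.
Proof.
move=> N0; exists (\prod_(p <- primes N) p ^ (logn p N).-1); split.
  rewrite -{1}(prod_primes_logn N0) -big_split /= big_seq [RHS]big_seq.
  by apply: eq_bigr => p; rewrite -logn_gt0 => l; rewrite -expnS prednK.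
by rewrite totientE // -big_split.
Qed.

Lemma prod_primes_gt0 N : 0 < \prod_(p <- primes N) p.
Proof.
rewrite big_seq prodn_cond_gt0 // => p.
by rewrite mem_primes => /and3P[/prime_gt0].
Qed.

Lemma prod_gt0 (l : seq nat) : all (leq 1) l -> 0 < \prod_(p <- l) p.
Proof. by move=> /allP al; rewrite big_seq prodn_cond_gt0. Qed.

Lemma prod_pred_gt0 (l : seq nat) : all (leq 2) l -> 0 < \prod_(p <- l) p.-1.
Proof. by move=> /allP al; rewrite big_seq prodn_cond_gt0 // => p /al; case: p => [|[]]. Qed.

Lemma primes_ge2 N : all (leq 2) (primes N).
Proof. by apply/allP=> p; rewrite mem_primes => /and3P[/prime_gt1]. Qed.

(* Telescoping: the quotients [q / (q - 1)] of distinct integers from [p] on are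
   dominated by those of consecutive integers. *)
Lemma prod_sorted_le p l : 1 < p -> path ltn p.-1 l ->
  (\prod_(q <- l) q) * p.-1 <= (\prod_(q <- l) q.-1) * (p.-1 + size l).
Proof.
elim: l p => [|q l IH] p p1; first by rewrite !big_nil addn0.
rewrite /= !big_cons => /andP[lt ph].
have q1 : 1 < q.+1 by lia.
have := IH q.+1 q1 ph; rewrite /=; have pq : p <= q by lia.
move: (\prod_(j <- l) j) (\prod_(j <- l) j.-1) (size l) => R S s le.
apply: (leq_trans (n := S * (q + s) * p.-1)); first by rewrite mulnC (mulnC q) mulnC leq_mul2r le orbT.
have -> : q.-1 * S * (p.-1 + s.+1) = S * (q.-1 * (p.-1 + s.+1)) by ring.
by rewrite -mulnA leq_mul2l; apply/orP; right; nia.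
Qed.

Lemma path_ltn_last_mod c l p :
  0 < c -> sorted ltn (rcons l p) -> all (fun q => (1 < q) && (q %% c == 1)) (rcons l p) ->
  c * (size l).+1 < p.
Proof.
move=> c0; elim/last_ind: l p => [|l q IH] p.
  rewrite /= andbT muln1 => _ /andP[p1 /eqP pc].
  by have := divn_eq p c; rewrite pc; case: (p %/ c) => [|d]; nia.
rewrite all_rcons => so /andP[/andP[p1 /eqP pc] al].
have so' : sorted ltn (rcons l q).
  by move: so; rewrite -[rcons (rcons _ _) _]cats1 => /cat_sorted2 [].
have qp : q < p by move: so; rewrite -[rcons (rcons _ _) _]cats1 -[rcons l q]cats1 -catA => /cat_sorted2 [_] /= /andP[].
have := IH q so' al; rewrite size_rcons => lt.
have := divn_eq p c; rewrite pc => E.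
move: (p %/ c) E => d E; have : (size l).+1 < d by nia.
by nia.
Qed.

(** The [j]-th entry is at least [4j + 1], and [((4j + 1) / (4j))^4 <= (2j + 1) / (2j - 1)]
    telescopes to [2s + 1]. The congruence modulo 4 thus gives growth like a fourth root, against a
    square root in [prod_odd_le]. *)
Lemma prod_mod4_le l : sorted ltn l -> all (fun q => (1 < q) && (q %% 4 == 1)) l ->
  (\prod_(q <- l) q) ^ 4 <= (2 * size l).+1 * (\prod_(q <- l) q.-1) ^ 4.
Proof.
elim/last_ind: l => [|l p IH]; first by rewrite !big_nil.
move=> so al; have := path_ltn_last_mod (isT : 0 < 4) so al.
have so' : sorted ltn l by move: so; rewrite -cats1 => /cat_sorted2 [].
have al' : all (fun q => (1 < q) && (q %% 4 == 1)) l by move: al; rewrite all_rcons => /andP[].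
have {IH so al so' al'} := IH so' al'.
rewrite -cats1 !big_cat !big_seq1 size_cat /= addn1.
move: (\prod_(j <- l) j) (\prod_(j <- l) j.-1) (size l) => R S s le lt.
rewrite !expnMn.
suff : p ^ 4 * (2 * s).+1 <= p.-1 ^ 4 * (2 * s.+1).+1.
  move=> H; have h1 := leq_mul le (leqnn (p ^ 4)); have h2 := leq_mul (leqnn (S ^ 4)) H.
  move: h1 h2; move: (R ^ 4) (S ^ 4) (p ^ 4) (p.-1 ^ 4) => a b c d; nia.
pose j := s.+1; have j0 : 0 < (4 * j) ^ 4 by rewrite expn_gt0; lia.
have h1 : p * (4 * j) <= (4 * j).+1 * p.-1 by rewrite /j; nia.
have h2 : (p * (4 * j)) ^ 4 <= ((4 * j).+1 * p.-1) ^ 4 by rewrite leq_exp2r.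
have h3 : (4 * j).+1 ^ 4 * (2 * s).+1 <= (4 * j) ^ 4 * (2 * j).+1.
  rewrite /j.
  have -> : (4 * s.+1) ^ 4 * (2 * s.+1).+1 =
    (4 * s.+1).+1 ^ 4 * (2 * s).+1 + 64 * s.+1 ^ 3 + 64 * s.+1 ^ 2 + 14 * s.+1 + 1.
    have -> : (4 * s.+1).+1 = 4 * s.+1 + 1 by lia.
    have -> : (2 * s.+1).+1 = 2 * s.+1 + 1 by lia.
    have -> : (2 * s).+1 = 2 * s + 1 by lia.
    by rewrite -[s.+1]addn1; ring.
  by rewrite -!addnA leq_addr.
rewrite -(leq_pmul2l j0); move: h2 h3; rewrite !expnMn.
move: (p ^ 4) (p.-1 ^ 4) ((4 * j).+1 ^ 4) (4 ^ 4 * j ^ 4) => a b c d h2 h3.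
have h4 := leq_mul h2 (leqnn (2 * s).+1); have h5 := leq_mul h3 (leqnn b).
by rewrite -/j; move: (2 * s).+1 (2 * j).+1 h4 h5 => e f; nia.
Qed.

Lemma exp4_dominates s : 39 < s -> 4 * s ^ 2 * 3 ^ s <= 4 ^ s.
Proof.
move=> lt; have -> : s = 40 + (s - 40) by lia.
elim: (s - 40) => [|i IH]; last first.
  by rewrite addnS !(expnS _ (40 + i)); move: (3 ^ _) (4 ^ _) IH => a b IH; nia.
(* The base case rests on [4 * 3^5 = 972 <= 1024 = 4^5], raised to the eighth power. *)
have h e : 4 ^ e * 3 ^ (5 * e) <= 4 ^ (5 * e).
  by rewrite !expnM -expnMn; case: e => // e; rewrite leq_exp2r.
have := h 8; rewrite addn0 -[5 * 8]/40.
have -> : 4 ^ 8 = 256 * 256 by rewrite (expnD 4 4 4).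
by move: (3 ^ _) (4 ^ _) => a b; lia.
Qed.

Lemma exp2_dominates s : 39 < s -> 6 * s ^ 2 * s.+1 + 1 <= 2 ^ s.
Proof.
move=> lt; have -> : s = 20 + (s - 20) by lia.
elim: (s - 20) => [|i IH].
  by rewrite addn0 (expnD 2 10 10); have -> : 2 ^ 10 = 1024 by []; lia.
rewrite (addnS 20 i) (expnS 2); move: (20 + i) (leq_addr i 20) IH => x x20.
move: (2 ^ x) => y IH; have h1 : 20 * x <= x * x by rewrite leq_mul2r x20 orbT.
have h2 : 20 * (x * x) <= x * (x * x) by rewrite leq_mul2r x20 orbT.
have -> : 6 * x.+1 ^ 2 * x.+2 = 6 * (x * (x * x) + 4 * (x * x) + 5 * x + 2) by rewrite -[x.+2]addn2 -[x.+1]addn1; ring.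
have E : 6 * x ^ 2 * x.+1 = 6 * (x * (x * x) + x * x) by rewrite -[x.+1]addn1; ring.
by rewrite E in IH; lia.
Qed.

Lemma perm_primes_odd N : 0 < N ->
  perm_eq (primes N) ((if 2 %| N then [:: 2] else [::]) ++ [seq p <- primes N | odd p]).
Proof.
move=> N0; have <- : [seq p <- primes N | p == 2] = if 2 %| N then [:: 2] else [::].
  have -> : (2 %| N) = (2 \in primes N) by rewrite mem_primes /= N0.
  case: ifP => [in2|nin]; first by apply: filter_pred1_uniq; rewrite ?primes_uniq.
  by apply/eqP; apply: negbNE; rewrite -has_filter has_pred1 nin.
rewrite -(perm_filterC (fun p => p == 2) (primes N)) perm_cat2l.
apply/permP=> a; congr (count _ _).
apply: eq_in_filter => p; rewrite mem_primes => /and3P[p_pr _ _] /=.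
by case: (even_prime p_pr) => [->|p_odd] //; rewrite p_odd; case: eqP p_odd => // ->.
Qed.

(** * Odd [n]: a Liouville inequality against a power of 4 *)

Section OddIndex.
Variable P : nat.
Hypothesis hP : 2 < P.
Local Notation u := (lucas P).
Local Notation v := (companion P).

(* The discriminant of the form is [P ^ 2 + 4], which is not a square. *)
Lemma form_neq0 x y : 0 < y -> x ^ 2 <> P * x * y + y ^ 2.
Proof.
move=> y0 E; have g0 : 0 < gcdn x y by rewrite gcdn_gt0 y0 orbT.
have [x' Ex] := dvdnP (dvdn_gcdl x y); have [y' Ey] := dvdnP (dvdn_gcdr x y).
have co : coprime x' y'.
  by rewrite /coprime -(eqn_pmul2r g0) mul1n muln_gcdl -Ex -Ey.
move: (gcdn x y) g0 Ex Ey => g g0 Ex Ey; rewrite {}Ex {}Ey in E.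
have E' : x' ^ 2 = (P * x' + y') * y'.
  apply/eqP; rewrite -(eqn_pmul2r (m := g ^ 2)) ?expn_gt0 ?g0 //; apply/eqP.
  have -> : x' ^ 2 * g ^ 2 = (x' * g) ^ 2 by ring.
  by rewrite E; ring.
have : y' %| x' ^ 2 by rewrite E' dvdn_mull.
have : coprime y' (x' ^ 2) by rewrite coprimeXr // coprime_sym.
rewrite /coprime => /eqP c1 /gcdn_idPl; rewrite c1 => y1.
move: E'; rewrite -y1; case: (leqP x' P) => [le|lt]; last by nia.
by have := leq_mul le (leqnn x'); nia.
Qed.

(** With [w = u_{m+2}] and [t = u_{m+1}], the addition formula turns the hypothesis into
    [x t = y w + X], where [x = A u_k] and [y = B - A u_{k+1}]. Since [x^2 - P x y - y^2] takes the
    value 1 or -1 at [(w, t)], a small [X] would make it smaller than 1 in absolute value at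
    [(x, y)], where it is a nonzero integer. *)
Lemma liouville_ge m k A B X : 0 < k -> 0 < A -> A * u (k + m.+2) = B * u m.+2 + X -> 0 < X ->
  2 * B <= u m.+1 ->
  4 * X * (X + 2 * B * u m.+2) >= 3 * u m.+1 ^ 2.
Proof.
move=> k0 A0 EX X0 leB; set w := u m.+2; set t := u m.+1.
have t0 : 0 < t by apply: lucas_gt0.
have uk0 : 0 < u k by apply: lucas_gt0.
have EX' : A * u k.+1 * w + A * u k * t = B * w + X.
  by rewrite -EX addnS lucas_add; ring.
have wt : P * t <= w by apply: lucasS_ge.
have cas := lucas_cassini P m.+1; rewrite -/w -/t in cas.
(* If [B <= A u_{k+1}], then already [X >= t]. *)
have [le|lt] := leqP B (A * u k.+1).
  have h1 : t <= A * u k * t by rewrite leq_pmull // muln_gt0 A0.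
  have h2 : B * w <= A * u k.+1 * w by rewrite leq_mul2r le orbT.
  have : t <= X by lia.
  by nia.
pose y := B - A * u k.+1; pose x := A * u k.
have y0 : 0 < y by rewrite /y; lia.
have yB : y <= B by rewrite /y; lia.
have {}EX : x * t = y * w + X by move: EX'; rewrite /x /y mulnBl; nia.
have nz := @form_neq0 x y y0.
clearbody x y; clear EX' lt uk0.
have e1 : w ^ 2 + 1 >= P * w * t + t ^ 2 by move: cas; case: (odd _) => /=; lia.
have e2 : w ^ 2 <= P * w * t + t ^ 2 + 1 by move: cas; case: (odd _) => /=; lia.
have h1 : x ^ 2 * t ^ 2 = (y * w + X) ^ 2 by rewrite -EX; ring.
have h2 : P * x * y * t ^ 2 = P * t * y * (y * w + X) by rewrite -EX; ring.
have m1 := leq_mul (leqnn (y ^ 2)) e1; have m2 := leq_mul (leqnn (y ^ 2)) e2.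
have m3 := leq_mul (leqnn (y * X)) wt.
have t2 : 0 < t ^ 2 by rewrite expn_gt0 t0.
have y4 : 4 * y ^ 2 <= t ^ 2.
  by rewrite -(expnMn 2 y 2) leq_exp2r //; apply: leq_trans leB; rewrite leq_mul2l.
have [ge|le] := leqP (P * x * y + y ^ 2 + 1) (x ^ 2).
  have m4 := leq_mul ge (leqnn (t ^ 2)).
  have h3 : t ^ 2 <= X ^ 2 + 2 * (X * y * w) + y ^ 2 by clear t2 y4; nia.
  have h4 : X * y * w <= X * B * w by rewrite leq_mul2r leq_mul2l yB !orbT.
  have -> : 4 * X * (X + 2 * B * w) = 4 * X ^ 2 + 8 * (X * B * w) by ring.
  by move: h3 h4 y4; move: (t ^ 2) (X ^ 2) (y ^ 2) (_ * w) (_ * w); clear; lia.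
(* Because [x t > y w], a negative value of the form would force [t <= y], against [2 y <= t]. *)
have {}le : x ^ 2 + 1 <= P * x * y + y ^ 2 by lia.
have m4 := leq_mul le (leqnn (t ^ 2)).
have : t ^ 2 + X ^ 2 + y * X * w <= y ^ 2 by clear t2 y4; nia.
rewrite -addnA => /(leq_trans (leq_addr _ _)) h3.
by move: h3 y4 t2; move: (t ^ 2) (y ^ 2); clear; lia.
Qed.

Variables (n m : nat).
Hypotheses (m2 : 1 < m) (mn : m < n) (Ephi : totient (u n) = u m).
Let k := n - m.
Let pr := primes (u n).

Let un0 : 0 < u n. Proof. by apply: lucas_gt0; lia. Qed.
Let um0 : 0 < u m. Proof. by apply: lucas_gt0; lia. Qed.

Lemma lucas_ratio_prod : u k.+1 * \prod_(p <- pr) p.-1 <= \prod_(p <- pr) p.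
Proof.
have [w [E1 E2]] := totient_radical un0; rewrite Ephi -/pr in E1 E2.
have := @lucas_mul_le P hP m k; have -> : k + m = n by rewrite /k; lia.
have w0 : 0 < w by move: un0; rewrite E1; case: (w) => //; rewrite muln0.
by rewrite {1}E1 E2 mulnA leq_pmul2r.
Qed.

(** The cofactor [w] of the radical divides both [u_n] and [u_m], hence [u_gcd(n, m)] and [u_k]. So
    [u_k u_m <= u_n], and [u_n] is at most [u_k] times the radical. *)
Lemma lucas_le_radical : u m <= \prod_(p <- pr) p.
Proof.
have [w [E1 E2]] := totient_radical un0; rewrite Ephi -/pr in E1 E2.
have wk : w <= u k.
  have k0 : 0 < k by rewrite /k; lia.
  apply: dvdn_leq; first exact: lucas_gt0.
  apply: (@dvdn_trans (gcdn (u n) (u m))); first by rewrite dvdn_gcd E1 E2 !dvdn_mull.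
  rewrite gcd_lucas; apply: dvdn_lucas.
  by rewrite /k dvdn_subr ?dvdn_gcdl ?dvdn_gcdr // ltnW.
have := @lucas_mul_le P hP m k; have -> : k + m = n by rewrite /k; lia.
have uk0 : 0 < u k by apply: lucas_gt0; rewrite /k; lia.
rewrite {1}E1 => le; rewrite -(leq_pmul2l uk0).
apply: (leq_trans (n := u k.+1 * u m)); first by rewrite leq_mul2r leq_lucasS ?orbT.
by apply: leq_trans le _; rewrite mulnC leq_mul2r wk orbT.
Qed.

Let s := size pr.
Let K := 6 * P.+1 ^ 2 * s + 1.
Let B i := \prod_(p <- take i pr) p.

(** Once the first [i] primes are split off, [A u_n] and [B_i u_m] differ by the Euler factor of the
    remaining ones. Hence [X = A u_n - B_i u_m] is positive, and by telescoping at most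
    [s B_i u_m / (p - 1)]. The Liouville inequality bounds [X] from below, so [p] cannot be
    large. *)
Lemma next_prime_le i : i < s -> 2 * B i <= u m.-1 -> nth 0 pr i <= K * B i ^ 2.
Proof.
move=> lti leB; set p := nth 0 pr i; pose A := \prod_(p <- take i pr) p.-1.
pose l := drop i pr; have lE : l = p :: drop i.+1 pr by rewrite /l (drop_nth 0).
have pp : p \in pr by apply: mem_nth.
have p1 : 1 < p by have /allP := primes_ge2 (u n); apply.
have ge2 : all (leq 2) pr by apply: primes_ge2.
have sl : path ltn p.-1 l.
  have : sorted ltn (take i pr ++ l) by rewrite cat_take_drop sorted_primes.
  by move=> /cat_sorted2 [_]; rewrite lE /= => ->; rewrite andbT; lia.
have A0 : 0 < A by apply: prod_pred_gt0; move: ge2; rewrite -{1}(cat_take_drop i pr) all_cat => /andP[].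
have B0 : 0 < B i.
  by apply: prod_gt0; apply: sub_all (take i pr) _ => [j|]; [exact: ltnW | move: ge2; rewrite -{1}(cat_take_drop i pr) all_cat => /andP[]].
have S0 : 0 < \prod_(q <- l) q.-1 by apply: prod_pred_gt0; move: ge2; rewrite -{1}(cat_take_drop i pr) all_cat => /andP[].
have E : A * u n * \prod_(q <- l) q.-1 = B i * u m * \prod_(q <- l) q.
  have [w [E1 E2]] := totient_radical un0; rewrite Ephi -/pr in E1 E2.
  rewrite {1}E1 E2 -(cat_take_drop i pr) !big_cat /= -/A -/(B i) -/l.
  by ring.
have ltRS : \prod_(q <- l) q.-1 < \prod_(q <- l) q.
  rewrite lE !big_cons.
  have : \prod_(q <- drop i.+1 pr) q.-1 <= \prod_(q <- drop i.+1 pr) q.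
    by apply: leq_prod => q _; exact: leq_pred.
  have : 0 < \prod_(q <- drop i.+1 pr) q.-1.
    by apply: prod_pred_gt0; move: ge2; rewrite -{1}(cat_take_drop i.+1 pr) all_cat => /andP[].
  by nia.
have tele := prod_sorted_le p1 sl.
have sls : size l <= s by rewrite /l size_drop leq_subr.
have ABX : B i * u m < A * u n.
  rewrite ltnNge; apply/negP=> le.
  have := leq_mul le (leqnn (\prod_(q <- l) q.-1)); rewrite E leq_pmul2l ?muln_gt0 ?B0 //.
  by rewrite leqNgt ltRS.
pose X := A * u n - B i * u m; have X0 : 0 < X by rewrite /X subn_gt0.
have EX : A * u n = B i * u m + X by rewrite /X; lia.
have XE : X * p.-1 <= s * (B i * u m).
  have : A * u n * p.-1 <= B i * u m * (p.-1 + size l).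
    have EE : A * u n * p.-1 * \prod_(q <- l) q.-1 = B i * u m * (\prod_(q <- l) q * p.-1).
      by rewrite mulnAC E mulnA.
    rewrite -(leq_pmul2r S0) EE -[X in _ <= X]mulnA leq_mul2l; apply/orP; right.
    by rewrite [X in _ <= X]mulnC.
  rewrite EX; have : B i * u m * size l <= B i * u m * s by rewrite leq_mul2l sls orbT.
  by move: (B i * u m) => b; nia.
have k0 : 0 < k by rewrite /k; lia.
have Em : m = (m.-2).+2 by lia.
have liou := @liouville_ge m.-2 k A (B i) X k0 A0.
rewrite -Em -[m.-2.+1]/(m.-1.-1.+1) prednK in liou; last by lia.
have {}liou := liou _ X0 leB.
have en : k + m = n by rewrite /k; lia.
rewrite en in liou; have {}liou := liou EX.
have t0 : 0 < u m.-1 by apply: lucas_gt0; lia.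
have wt : u m <= P.+1 * u m.-1 by rewrite -{1}[m](@prednK m) ?lucasS_le //; lia.
move: (u m) (u m.-1) (B i) um0 B0 t0 wt liou XE => w t b w0 b0 t0 wt liou XE.
have s0 : 0 < s by apply: leq_ltn_trans lti.
have bw0 : 0 < b * w by rewrite muln_gt0 b0.
suff H : p.-1 <= 6 * P.+1 ^ 2 * s * b ^ 2.
  rewrite /K mulnDl mul1n; have : 0 < b ^ 2 by rewrite expn_gt0 b0.
  by move: H; move: (6 * P.+1 ^ 2 * s * b ^ 2) (b ^ 2); lia.
have [geX|ltX] := leqP (2 * b * w) X.
  have ps : p.-1 <= s.
    rewrite -(leq_pmul2r bw0); apply: leq_trans XE; rewrite mulnC leq_mul2r.
    by apply/orP; right; apply: leq_trans geX; rewrite -mulnA leq_pmull.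
  apply: leq_trans ps _; rewrite -mulnA mulnCA leq_pmulr //.
  by rewrite !muln_gt0 b0.
(* From here on [3 (p - 1) <= 16 s b^2 (P + 1)^2]; the factor 6 in [K] is [16 / 3] rounded up. *)
have h1 : 3 * t ^ 2 <= 4 * X * (4 * (b * w)).
  apply: leq_trans liou _; rewrite leq_mul2l; apply/orP; right; lia.
have h2 : 3 * t ^ 2 * p.-1 <= 16 * b * w * (s * (b * w)).
  apply: leq_trans (leq_mul h1 (leqnn _)) _.
  have := leq_mul (leqnn (16 * b * w)) XE.
  by have -> : 4 * X * (4 * (b * w)) * p.-1 = 16 * b * w * (X * p.-1) by ring.
have h3 : w ^ 2 <= (P.+1 * t) ^ 2 by rewrite leq_exp2r.
have h4 : 16 * b * w * (s * (b * w)) <= 16 * s * b ^ 2 * (P.+1 * t) ^ 2.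
  have := leq_mul (leqnn (16 * s * b ^ 2)) h3.
  by have -> : 16 * b * w * (s * (b * w)) = 16 * s * b ^ 2 * w ^ 2 by ring.
have t20 : 0 < t ^ 2 by rewrite expn_gt0 t0.
have h5 := leq_trans h2 h4.
have h6 : 3 * p.-1 <= 16 * s * b ^ 2 * P.+1 ^ 2.
  rewrite -(leq_pmul2r t20); move: h5; rewrite expnMn.
  have -> : 3 * t ^ 2 * p.-1 = 3 * p.-1 * t ^ 2 by ring.
  by have -> : 16 * s * b ^ 2 * (P.+1 ^ 2 * t ^ 2) = 16 * s * b ^ 2 * P.+1 ^ 2 * t ^ 2 by ring.
have e1 : 16 * s * b ^ 2 * P.+1 ^ 2 = 16 * (s * b ^ 2 * P.+1 ^ 2) by ring.
have -> : 6 * P.+1 ^ 2 * s * b ^ 2 = 6 * (s * b ^ 2 * P.+1 ^ 2) by ring.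
by rewrite e1 in h6; move: (s * _ * _) h6; lia.
Qed.

(** [next_prime_le] gives [K B_{i+1}^2 <= (K B_i^2)^3], whence the exponent [3^i]. The iteration
    stops at the first [i] with [2 B_i > u_{m-1}], which exists because the full product is the
    radical and is at least [u_m]. *)
Lemma lucas_liouville : u m.-1 ^ 2 <= K ^ (3 ^ s).
Proof.
have K4 : 3 < K.
  have : 0 < s.
    rewrite /s lt0n; apply/eqP=> /size0nil e; have := lucas_le_radical.
    rewrite e big_nil; have := @lucas_mono P hP 2 m m2.
    have -> : u 2 = P by rewrite /lucas; lia.
    by lia.
  by rewrite /K; nia.
have Bs : u m.-1 < 2 * B s.
  rewrite /B take_size; have := lucas_le_radical.
  by have := @lucas_mono P hP m.-1 m (leq_pred m); have := um0; lia.
have bnd i : i <= s -> (forall j, j < i -> 2 * B j <= u m.-1) -> K * B i ^ 2 <= K ^ (3 ^ i).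
  elim: i => [|i IH] les H; first by rewrite /B take0 big_nil exp1n muln1 expn0 expn1.
  have := next_prime_le les (H _ (leqnn _)).
  have IHi := IH (ltnW les) (fun j lt => H j (ltnW lt)).
  have -> : B i.+1 = B i * nth 0 pr i by rewrite /B (take_nth 0) // -cats1 big_cat big_seq1.
  move=> le; rewrite (expnSr 3 i) expnM.
  apply: (leq_trans (n := (K * B i ^ 2) ^ 3)); last by rewrite leq_exp2r.
  have := leq_mul (leqnn (K * B i ^ 2)) (leq_mul le le).
  move: (B i) (nth 0 pr i) => b p; rewrite !expnS !expn0 !muln1.
  have -> : K * (b * p * (b * p)) = K * (b * b) * (p * p) by ring.
  by move=> ?; lia.
have ex : exists i, u m.-1 < 2 * B i by exists s.
case: (ex_minnP ex) => i Hi mini.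
have les : i <= s by apply: mini.
have le : K * B i ^ 2 <= K ^ (3 ^ i).
  by apply: bnd les _ => j lt; rewrite leqNgt; apply/negP=> /mini; lia.
apply: (leq_trans (n := K ^ (3 ^ i))); last by rewrite leq_pexp2l ?leq_pexp2l //; lia.
apply: leq_trans le; have : u m.-1 ^ 2 <= (2 * B i) ^ 2 by rewrite leq_exp2r // ltnW.
by rewrite expnMn; nia.
Qed.

Hypothesis n_odd : odd n.

Let l := [seq p <- pr | odd p].
Let s' := size l.

Let l_mod4 : all (fun q => (1 < q) && (q %% 4 == 1)) l.
Proof.
apply/allP=> p; rewrite mem_filter mem_primes => /andP[p_odd /and3P[p_pr _ pu]].
by rewrite prime_gt1 //= (lucas_odd_prime_mod4 p_pr p_odd n_odd pu).
Qed.

Let l_sorted : sorted ltn l.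
Proof. by apply: sorted_filter; [exact: ltn_trans | exact: sorted_primes]. Qed.

Let pr_perm := perm_primes_odd un0.

Let s_le : s <= s'.+1.
Proof.
rewrite /s (perm_size pr_perm) size_cat.
by case: ifP => _ /=; rewrite /s' /l /pr; lia.
Qed.

Lemma odd_index_pow4 : 4 ^ s' <= P.+1 * m.
Proof.
have : 4 ^ s' %| u m.
  have [w [_ E2]] := totient_radical un0; rewrite Ephi -/pr in E2.
  rewrite E2 dvdn_mulr // (perm_big _ pr_perm) big_cat /= -/pr -/l dvdn_mull //.
  rewrite /s'; elim: l l_mod4 => [|p r IH] /=; first by rewrite big_nil.
  case/andP=> /andP[p1 /eqP p4] /IH d; rewrite big_cons expnS dvdn_mul //.
  by lia.
have -> : 4 ^ s' = 2 ^ (2 * s') by rewrite expnM.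
rewrite pfactor_dvdn // => le.
apply: (leq_trans (n := 2 ^ logn 2 (u m))); first by rewrite leq_exp2l.
apply: leq_trans (lucas_two_part_le hP _) _; first lia.
by rewrite leq_mul2l dvdn_leq ?orbT ?pfactor_dvdnn //; lia.
Qed.

(** The prime 2 doubles the Euler product, hence the factor [16 = 2^4]. As [n] is odd, it divides
    [u_n] only if its rank is 3; then 3 divides [n] and [m], hence [k], and the larger [u_{k+1}]
    compensates for the 16. *)
Lemma odd_index_ratio :
  (~~ (2 %| u n) /\ u k.+1 ^ 4 <= (2 * s').+1) \/
  (2 < k /\ u k.+1 ^ 4 <= 16 * (2 * s').+1).
Proof.
have := lucas_ratio_prod; rewrite !(perm_big _ pr_perm) !big_cat /= -/pr -/l.
have := prod_mod4_le l_sorted l_mod4; rewrite -/s'.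
have : 0 < \prod_(q <- l) q.-1.
  by apply: prod_pred_gt0; apply: sub_all l_mod4 => q /andP[].
move: (\prod_(q <- l) q.-1) (\prod_(q <- l) q) => S R S0 le.
have S40 : 0 < S ^ 4 by rewrite expn_gt0 S0.
case: ifP => u2; rewrite ?big_seq1 ?big_nil ?mul1n => le2; [right|left]; split=> //; last first.
- rewrite -(leq_pmul2r S40) -expnMn; apply: leq_trans le; by rewrite leq_exp2r.
- rewrite -(leq_pmul2r S40) -expnMn -mulnA.
  apply: (leq_trans (n := (2 * R) ^ 4)); first by rewrite leq_exp2r.
  by rewrite expnMn leq_mul2l le.
have k0 : 0 < k by rewrite /k; lia.
have s0 : 0 < s'.
  rewrite lt0n; apply/eqP=> e; move: le le2; rewrite e muln0 mul1n leq_exp2r // => le le2.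
  have := @lucas_mono P hP 2 k.+1 k0; have -> : u 2 = P by rewrite /lucas; lia.
  by nia.
have um2 : 2 %| u m.
  have : 4 ^ s' %| u m.
    have [w [_ E2]] := totient_radical un0; rewrite Ephi -/pr in E2.
    rewrite E2 dvdn_mulr // (perm_big _ pr_perm) big_cat /= -/pr -/l dvdn_mull //.
    rewrite /s'; elim: l l_mod4 => [|p r IH] /=; first by rewrite big_nil.
    case/andP=> /andP[p1 /eqP p4] /IH d; rewrite big_cons expnS dvdn_mul //.
    by lia.
  by apply: dvdn_trans; rewrite -(prednK s0) expnS dvdn_mulr.
have z3 : lrank P 2 = 3.
  have [P_odd|P_even] := boolP (odd P).
    have : 2 %| u 3 by rewrite /lucas dvdn2 !(oddD, oddM) P_odd.
    rewrite dvdn_lucasE // => /(primeP (isT : prime 3)).2 /orP[/eqP e|/eqP //].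
    by have := lrank_gt1 hP (isT : prime 2); rewrite e.
  have : 2 %| u 2 by rewrite /lucas dvdn2 !(oddD, oddM) (negPf P_even).
  rewrite dvdn_lucasE // => /(primeP (isT : prime 2)).2 /orP[/eqP e|/eqP e].
    by have := lrank_gt1 hP (isT : prime 2); rewrite e.
  by move: u2; rewrite dvdn_lucasE // e dvdn2 n_odd.
move: u2 um2; rewrite !dvdn_lucasE // z3 => d1 d2.
have : 3 %| k by rewrite /k dvdn_subr // ltnW.
by move=> /(dvdn_leq k0).
Qed.

Lemma no_odd_index : False.
Proof.
have k0 : 0 < k by rewrite /k; lia.
have uk : P ^ k <= u k.+1 by apply: lucas_exp_ge.
(* The threshold comes from the first alternative: [81 <= P^4 <= 2 s' + 1]. *)
have [s40 Ps] : 39 < s' /\ P ^ 3 <= (2 * s').+1.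
  case: odd_index_ratio => [[_ le]|[k3 le]].
    have : P ^ 4 <= (2 * s').+1.
      apply: leq_trans le; rewrite leq_exp2r //; apply: leq_trans uk.
      by rewrite -{1}(expn1 P) leq_pexp2l //; lia.
    have : 3 ^ 4 <= P ^ 4 by rewrite leq_exp2r.
    rewrite (expnS P 3); move: (P ^ 3) => c; rewrite -[3 ^ 4]/81 => h1 h2; split; last by nia.
    by lia.
  have : (P ^ 3) ^ 4 <= 16 * (2 * s').+1.
    apply: leq_trans le; rewrite leq_exp2r //; apply: leq_trans uk.
    by rewrite leq_pexp2l //; lia.
  have : 3 ^ 3 <= P ^ 3 by rewrite leq_exp2r.
  move: (P ^ 3) => c; rewrite -[3 ^ 3]/27 !expnS expn0 muln1 => h1 h2.
  have h3 : 27 * 27 <= c * c by apply: leq_mul.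
  have h4 : 27 * 27 * (27 * c) <= c * c * (c * c) by apply: leq_mul => //; rewrite leq_mul2r h1 orbT.
  by split; lia.
have Ps' : P.+1 <= s'.
  rewrite leqNgt; apply/negP=> lt; have : 38 * 38 * P <= P ^ 3; last by lia.
  have h38 : 38 <= P by lia.
  have := leq_mul (leq_mul h38 h38) (leqnn P).
  by have -> : P ^ 3 = P * P * P by ring.
have K2 : K <= 2 ^ s'.
  apply: leq_trans (exp2_dominates s40); rewrite /K leq_add2r.
  by rewrite leq_mul // leq_mul2l leq_exp2r.
have h1 : 2 ^ (2 * m.-2) <= 2 ^ (s' * 3 ^ s'.+1).
  apply: (leq_trans (n := u m.-1 ^ 2)).
    rewrite mulnC expnM leq_exp2r //; apply: (leq_trans (n := P ^ m.-2)); last first.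
      by have := lucas_exp_ge hP m.-2; have -> : m.-2.+1 = m.-1 by lia.
    by case: (m.-2) => // j; rewrite leq_exp2r //; lia.
  apply: leq_trans lucas_liouville _; apply: (leq_trans (n := K ^ (3 ^ s'.+1))).
    by rewrite leq_pexp2l ?leq_pexp2l // /K; lia.
  by rewrite expnM leq_exp2r // expn_gt0.
(* What remains is [4^s' <= s' m] with [2 m <= 3 s' 3^s' + 4], against [4 s'^2 3^s' <= 4^s']. *)
rewrite leq_exp2l // expnS in h1.
have h2 := odd_index_pow4; have h3 := exp4_dominates s40.
have h4 : 0 < 3 ^ s' by rewrite expn_gt0.
move: (3 ^ s') (4 ^ s') h1 h2 h3 h4 => a b h1 h2 h3 h4.
have h5 : b <= s' * m by apply: leq_trans h2 _; rewrite leq_mul2r Ps' orbT.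
have h6 : 2 * m <= 3 * s' * a + 4 by lia.
have h7 : s' * (2 * m) <= s' * (3 * s' * a + 4) by rewrite leq_mul2l h6 orbT.
have h8 : s' <= s' * s' * a by rewrite -mulnA leq_pmulr // muln_gt0 h4; lia.
have h9 : 40 * s' <= s' * s' by rewrite leq_mul2r s40 orbT.
by nia.
Qed.

End OddIndex.

Import Order.TTheory GRing.Theory Num.Theory.

(** * Elementary properties of the real logarithm *)

Section Logarithm.
Local Open Scope ring_scope.
Variable R : realType.
Implicit Types x y : R.

Lemma ln_le_sub1 x : 0 < x -> ln x <= x - 1.
Proof. by move=> x0; rewrite -{1}[x](subrK 1) addrC le_ln1Dx //; lra. Qed.

Lemma ln_ge_1subV x : 0 < x -> 1 - x^-1 <= ln x.
Proof.
move=> x0; have := @ln_le_sub1 x^-1; rewrite invr_gt0 => /(_ x0).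
by rewrite lnV //; lra.
Qed.

Lemma ler_lnn x y : 0 < x -> x <= y -> ln x <= ln y.
Proof. by move=> x0 xy; rewrite ler_ln // posrE //; apply: lt_le_trans xy. Qed.

Lemma ln3_ge1 : 1 <= ln 3 :> R.
Proof.
have h : 6%:R^-1 <= ln (6 / 5) :> R.
  by apply: le_trans (ln_ge_1subV _); rewrite ?invf_div; lra.
apply: (le_trans (y := ln ((6 / 5) ^+ 6))); last by apply: ler_lnn; lra.
by rewrite lnXn; lra.
Qed.

Lemma ln_nat_prod (S : seq nat) (N : nat) :
  (0 < N)%N -> uniq S -> {subset primes N <= S} ->
  ln (N%:R : R) = \sum_(p <- S) (logn p N)%:R * ln (p%:R : R).
Proof.
move=> N0 uS sub.
rewrite (bigID (fun p => p \in primes N)) /= [X in _ + X]big1 ?addr0; last first.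
  by move=> p; rewrite -logn_gt0 -eqn0Ngt => /eqP ->; rewrite mul0r.
rewrite -big_filter.
have pm : perm_eq [seq p <- S | p \in primes N] (primes N).
  apply: uniq_perm; rewrite ?filter_uniq ?primes_uniq // => p.
  by rewrite mem_filter andb_idr // => /sub.
rewrite (perm_big _ pm) /= -{1}(prod_primes_logn N0).
have : all (leq 1) (primes N) by apply: sub_all (primes_ge2 N) => p; exact: ltnW.
elim: (primes N) => [|p l IH] /=; first by rewrite !big_nil ln1.
case/andP=> p0 al; rewrite !big_cons natrM lnM ?posrE ?ltr0n ?expn_gt0 ?p0 //.
  by rewrite IH // natrX lnXn ?ltr0n // mulr_natl.
by rewrite big_seq prodn_cond_gt0 // => q ql; rewrite expn_gt0 (allP al _ ql).
Qed.

End Logarithm.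

Lemma logn_prod_primes r S : prime r -> all prime S -> uniq S ->
  logn r (\prod_(q <- S) q) = (r \in S).
Proof.
move=> r_pr; elim: S => [|q S IH] /=; first by rewrite big_nil logn1.
case/andP=> q_pr al /andP[qS uS]; rewrite big_cons lognM ?(prime_gt0 q_pr) //; last first.
  by apply: prod_gt0; apply: sub_all al => p; exact: prime_gt0.
rewrite logn_prime // IH // inE; case: eqP => [->|] //=.
by rewrite (negPf qS).
Qed.

(** * Moebius sums as iterated differences *)

Section MoebiusDifference.
Local Open Scope ring_scope.
Variable R : realType.
Implicit Types (g h : nat -> R) (l : seq nat).

(* For the primes [l] of [e] and [x = e / \prod l], this is the Moebius sum
   [\sum_(d | e) mu (e / d) g d]. *)
Fixpoint mobius_diff l g (x : nat) : R :=
  if l is q :: l' then mobius_diff l' g (q * x)%N - mobius_diff l' g x else g x.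

(** A condition met by all arguments at which [mobius_diff l g x] evaluates [g]. *)
Definition between l (x y : nat) := (x %| y)%N && (y %| x * \prod_(q <- l) q)%N.

Lemma between_head q l x y : between l (q * x) y -> between (q :: l) x y.
Proof.
case/andP=> h1 h2; apply/andP; split; first by apply: dvdn_trans h1; apply: dvdn_mull.
by rewrite big_cons mulnA (mulnC x).
Qed.

Lemma between_tail q l x y : between l x y -> between (q :: l) x y.
Proof.
case/andP=> h1 h2; rewrite /between h1 big_cons mulnCA.
by apply: dvdn_trans h2 _; apply: dvdn_mull.
Qed.

Lemma eq_mobius_diff l g h x :
  (forall y, between l x y -> g y = h y) -> mobius_diff l g x = mobius_diff l h x.
Proof.
elim: l x => [|q l IH] x H /=.
  by apply: H; rewrite /between big_nil muln1 dvdnn.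
by rewrite !IH // => y hy; apply: H; [apply: between_tail | apply: between_head].
Qed.

Lemma mobius_diff_shift l g q x :
  mobius_diff l g (q * x) = mobius_diff l (fun y => g (q * y)%N) x.
Proof. by elim: l x => //= q' l IH x; rewrite mulnCA !IH. Qed.

Lemma mobius_diffB l g h x :
  mobius_diff l (fun y => g y - h y) x = mobius_diff l g x - mobius_diff l h x.
Proof. by elim: l x => //= q l IH x; rewrite !IH; ring. Qed.

Lemma mobius_diffD l g h x :
  mobius_diff l (fun y => g y + h y) x = mobius_diff l g x + mobius_diff l h x.
Proof. by elim: l x => //= q l IH x; rewrite !IH; ring. Qed.

Lemma mobius_diffZ l g c x :
  mobius_diff l (fun y => g y * c) x = mobius_diff l g x * c.
Proof. by elim: l x => //= q l IH x; rewrite !IH; ring. Qed.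

Lemma mobius_diff_sum (I : Type) (S : seq I) (G : I -> nat -> R) l x :
  mobius_diff l (fun y => \sum_(i <- S) G i y) x = \sum_(i <- S) mobius_diff l (G i) x.
Proof.
elim: l x => //= q l IH x.
by rewrite !IH -sumrB.
Qed.

Lemma mobius_diff_linear l c x :
  mobius_diff l (fun y => y%:R * c) x = (x%:R * \prod_(q <- l) (q%:R - 1)) * c.
Proof.
elim: l x => /= [|q l IH] x; first by rewrite big_nil mulr1.
by rewrite !IH big_cons natrM; ring.
Qed.

Lemma mobius_diff_bound l g c x :
  (forall y, between l x y -> `|g y| <= c) -> `|mobius_diff l g x| <= 2 ^+ size l * c.
Proof.
elim: l x => [|q l IH] x H /=.
  by rewrite expr0 mul1r; apply: H; rewrite /between big_nil muln1 dvdnn.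
apply: le_trans (ler_normB _ _) _; rewrite exprS -mulrA mulrDl mul1r.
by apply: lerD; apply: IH => y hy; apply: H; [apply: between_head | apply: between_tail].
Qed.

Lemma mobius_diff_perm l1 l2 g x : perm_eq l1 l2 ->
  mobius_diff l1 g x = mobius_diff l2 g x.
Proof.
have swap a b l y : mobius_diff (a :: b :: l) g y = mobius_diff (b :: a :: l) g y.
  by rewrite /= (mulnCA a b); ring.
have front q a b y : mobius_diff (a ++ q :: b) g y = mobius_diff (q :: a ++ b) g y.
  elim: a y => //= r a IH y; rewrite !IH.
  by have := swap r q (a ++ b) y; rewrite /= => ->.
elim: l1 l2 x => [|q l1 IH] l2 x pe.
  by move/perm_size: pe => /esym/size0nil ->.
have /path.splitPr : q \in l2 by rewrite -(perm_mem pe) mem_head.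
case E : l2 / => [a b]; rewrite front /=; rewrite E in pe.
have pe' : perm_eq l1 (a ++ b).
  by rewrite -(perm_cons q) (perm_trans pe) // perm_catC /= perm_cons perm_catC.
by rewrite !(IH (a ++ b)).
Qed.

(** Pairing [y] with [q y] leaves only the increment of [g] along [q]. With [h = 0] the sum of a
    function insensitive to [q] vanishes. *)
Lemma mobius_diff_rem l g h q x : q \in l ->
  (forall y, between (rem q l) x y -> g (q * y)%N = g y + h y) ->
  mobius_diff l g x = mobius_diff (rem q l) h x.
Proof.
move=> ql H; rewrite (mobius_diff_perm _ _ (perm_to_rem ql)) /=.
rewrite mobius_diff_shift (eq_mobius_diff H) mobius_diffD; ring.
Qed.

Lemma mobius_diff_zero l x : mobius_diff l (fun=> 0) x = 0.
Proof. by elim: l x => //= q l IH x; rewrite !IH subrr. Qed.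

Lemma mobius_diff_top l g x : uniq l ->
  (forall q y, q \in l -> between (rem q l) x y -> g y = 0) ->
  mobius_diff l g x = g (x * \prod_(q <- l) q)%N.
Proof.
elim: l x => [|q l IH] x /=; first by rewrite big_nil muln1.
case/andP=> ql ul H; rewrite big_cons.
rewrite (eq_mobius_diff (g := g) (h := fun=> 0) (x := x)); last first.
  by move=> y hy; apply: (H q); rewrite ?mem_head // eqxx.
rewrite mobius_diff_zero subr0 IH //; first by rewrite mulnCA mulnA.
move=> r y rl hy; apply: (H r); first by rewrite inE rl orbT.
case: eqP => [e|_]; first by rewrite e rl in ql.
exact: between_head.
Qed.

End MoebiusDifference.

(** * Primitive prime divisors of [u_{2e}] for odd [e] *)

Section PrimitiveDivisor.
Variable P : nat.
Hypothesis hP : 2 < P.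
Local Notation u := (lucas P).
Local Notation v := (companion P).
Local Notation lrank := (lrank P).

Lemma lrank2 : lrank 2 = if odd P then 3 else 2.
Proof.
have z1 := lrank_gt1 hP (isT : prime 2); case: ifP => hodd.
  have : 2 %| u 3 by rewrite /lucas dvdn2 !(oddD, oddM) hodd.
  by rewrite dvdn_lucasE // => /(primeP (isT : prime 3)).2 /orP[/eqP e|/eqP //]; rewrite e in z1.
have : 2 %| u 2 by rewrite /lucas dvdn2 !(oddD, oddM) hodd.
by rewrite dvdn_lucasE // => /(primeP (isT : prime 2)).2 /orP[/eqP e|/eqP //]; rewrite e in z1.
Qed.

(** Here [v_y = u_{2y} / u_y]. An odd [p] of odd rank contributes equally to both; if its rank is
    [2 d], it does not divide [u_y] for odd [y], and lifting the exponent gives the valuation of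
    [u_{2y}]. The prime 2 has rank 2 or 3, so that [d] is 1 or 3, and [y / d] is odd. *)
Lemma companion_valuation p e : prime p -> odd e ->
  (forall y, y %| e -> logn p (v y) = 0) \/
  exists d c, [/\ d %| e, odd p -> lrank p = 2 * d, ~~ odd p -> d <= 3
    & forall y, y %| e -> logn p (v y) = if d %| y then c + logn p (y %/ d) else 0].
Proof.
move=> p_pr e_odd.
have odd_dvd y : y %| e -> odd y by move=> /dvdnP[c E]; move: e_odd; rewrite E oddM => /andP[].
have split y : y %| e -> logn p (u (2 * y)) = logn p (u y) + logn p (v y).
  move=> /odd_dvd; case: y => // y _.
  by rewrite lucas_double lognM ?lucas_gt0 ?companion_gt0.
have nodvd y : ~~ (lrank p %| y) -> logn p (u y) = 0.
  by move=> h; apply: logn_coprime; rewrite prime_coprime // dvdn_lucasE.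
have [p2|p_odd] := even_prime p_pr.
  have cop y : y %| e -> coprime 2 y by move=> /odd_dvd; rewrite coprime2n.
  have l0 y d : y %| e -> d %| y -> logn 2 (y %/ d) = 0.
    move=> ye dy; apply: logn_coprime; apply: cop; apply: dvdn_trans ye.
    by apply/dvdnP; exists d; rewrite mulnC divnK.
  subst p; have z2 := lrank2; case: ifP z2 => hodd z2.
    have [e3|ne3] := boolP (3 %| e); last first.
      left=> y ye.
      have n3 : ~~ (3 %| y) by apply/negP=> h; case/negP: ne3; apply: dvdn_trans h ye.
      have h1 : logn 2 (u y) = 0 by apply: nodvd; rewrite z2.
      have h2 : logn 2 (u (2 * y)) = 0 by apply: nodvd; rewrite z2 Gauss_dvdr.
      by have := split y ye; rewrite h1 h2 add0n => <-.
    right; exists 3, (logn 2 (u 6) - logn 2 (u 3)); split=> //.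
    move=> y ye; have := split y ye.
    case: ifP => [y3|/negbT ny3]; last first.
      have -> : logn 2 (u (2 * y)) = 0 by apply: nodvd; rewrite z2 Gauss_dvdr.
      by case: (logn 2 (v y)) => // a; rewrite addnS.
    rewrite l0 // addn0; have [i Ei] := dvdnP y3.
    have ci : coprime 2 i by apply: cop; apply: dvdn_trans ye; rewrite Ei dvdn_mulr.
    have i0 : 0 < i by case: (i) ci.
    have -> : 2 * y = 6 * i by rewrite Ei; lia.
    rewrite logn_lucas_coprime // ?dvdn_lucasE ?z2 // Ei mulnC.
    by rewrite (@logn_lucas_coprime _ _ 2 3) // ?dvdn_lucasE ?z2 //; lia.
  right; exists 1, (logn 2 (u 2)); split=> //.
  move=> y ye; have := split y ye; rewrite dvd1n l0 // addn0.
  have y0 : 0 < y by case: (y) (odd_dvd _ ye).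
  rewrite logn_lucas_coprime ?dvdn_lucasE ?z2 ?cop // => ->.
  have -> : logn 2 (u y) = 0 by apply: nodvd; rewrite z2 dvdn2 odd_dvd.
  by [].
have [z_odd|z_even] := boolP (odd (lrank p)).
  left=> y ye; have := split y ye; have y0 : 0 < y by case: (y) (odd_dvd _ ye).
  have [zy|nzy] := boolP (lrank p %| y); last first.
    rewrite !nodvd // ?Gauss_dvdr ?coprimen2 //; by rewrite add0n => <-.
  have l2 : logn p 2 = 0 by apply: logn_coprime; rewrite coprimen2.
  rewrite mulnC logn_lucas_mul ?dvdn_lucasE // l2 addn0.
  by move/eqP; rewrite -{1}[logn p (u y)]addn0 eqn_add2l => /eqP <-.
have ez : lrank p = 2 * (lrank p)./2 by lia.
have [de|nde] := boolP ((lrank p)./2 %| e); last first.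
  left=> y ye; have := split y ye; rewrite nodvd.
    by case: (logn p (v y)) => // a; rewrite addnS.
  rewrite ez dvdn_pmul2l //; by apply: contra nde => /dvdn_trans; apply.
right; exists (lrank p)./2, (logn p (u (lrank p))); split=> //; first by rewrite p_odd.
move=> y ye; have := split y ye; have y0 : 0 < y by case: (y) (odd_dvd _ ye).
rewrite (nodvd y); last first.
  by apply/negP=> /dvdnP[c E]; have := odd_dvd _ ye; rewrite E oddM (negPf z_even) andbF.
rewrite add0n => <-; case: ifP => [dy|/negbT ndy]; last first.
  by apply: nodvd; rewrite ez dvdn_pmul2l.
have {1}-> : 2 * y = lrank p * (y %/ (lrank p)./2).
  by rewrite {1}ez -mulnA [(lrank p)./2 * _]mulnC divnK.
rewrite logn_lucas_mul ?dvdn_lucas_rank //.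
have h0 : 0 < (lrank p)./2 by rewrite half_gt0 lrank_gt1.
by rewrite divn_gt0 // dvdn_leq.
Qed.

(** [v_3 = P (P^2 + 3)], and a prime other than 2 and 3 dividing [P^2 + 3] has rank 6. The primes 2
    and 3 account for at most 12 in [P^2 + 3], which exceeds 12 for [P > 3] and equals it for
    [P = 3]. The general argument leaves out [e = 3], where 2 may divide [v_3] but not [v_1]. *)
Lemma primitive_divisor3 : 3 < P -> exists p, [/\ prime p, odd p & lrank p = 6].
Proof.
move=> P4; set N := P ^ 2 + 3.
have vE : v 3 = P * N by rewrite /companion /N; ring.
have N19 : 19 <= N by rewrite /N; nia.
pose x := if odd P then 4 else 1; pose y := if 3 %| P then 3 else 1.
have N2 : if odd P then N %% 8 = 4 else odd N.
  case: ifP => h; rewrite /N; last by rewrite oddD oddX h.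
  have [f Ef] : exists f, P = 2 * f + 1 by exists P./2; lia.
  have fo : ~~ odd (f * f + f) by rewrite oddD oddM; case: (odd f).
  have -> : P ^ 2 + 3 = 4 * (f * f + f) + 4 by rewrite Ef; ring.
  by lia.
have N3 : if 3 %| P then N %% 9 = 3 else N %% 3 <> 0.
  have [g Eg] : exists g, [\/ P = 3 * g, P = 3 * g + 1 | P = 3 * g + 2].
    exists (P %/ 3); have := divn_eq P 3; have := ltn_mod P 3.
    by case: (P %% 3) => [|[|[|]]] // _ ->; [constructor 1|constructor 2|constructor 3]; lia.
  rewrite /N; case: Eg => ->.
  - have -> : (3 * g) ^ 2 + 3 = 9 * (g * g) + 3 by ring.
    by case: ifP; lia.
  - have -> : (3 * g + 1) ^ 2 + 3 = 3 * (3 * g * g + 2 * g + 1) + 1 by ring.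
    by case: ifP; lia.
  - have -> : (3 * g + 2) ^ 2 + 3 = 3 * (3 * g * g + 4 * g + 2) + 1 by ring.
    by case: ifP; lia.
have [N' EN] : exists N', N = x * y * N'.
  exists (N %/ (x * y)); rewrite mulnC divnK // Gauss_dvd ?/x ?/y.
    apply/andP; split; first by move: N2; rewrite /x; case: ifP => // _; lia.
    by move: N3; rewrite /y; case: ifP => // _; lia.
  by rewrite /x /y; case: ifP; case: ifP.
have N'1 : 1 < N' by move: N19; rewrite EN /x /y; case: ifP; case: ifP => _ _; lia.
have p_pr := pdiv_prime N'1; have pN' := pdiv_dvd N'; set p := pdiv N' in p_pr pN'.
have N'o : odd N' by move: N2; rewrite EN /x /y; case: (odd P); case: (3 %| P) => /=; lia.
have N'3 : ~~ (3 %| N') by move: N3; rewrite EN /x /y; case: (odd P); case: (3 %| P) => /=; lia.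
have p_odd : odd p by case/dvdnP: pN' N'o => c ->; rewrite oddM => /andP[].
have pN : p %| N by rewrite EN dvdn_mull.
exists p; split=> //.
have z6 : lrank p %| 6 by rewrite -dvdn_lucasE // -[6]/(2 * 3) lucas_double vE !dvdn_mull.
have p3 : p != 3 by apply: contra N'3 => /eqP <-.
have npP : ~~ (p %| P).
  apply/negP=> pP; have : p %| 3.
    by rewrite -(dvdn_addr _ (m := P ^ 2)) // expnS dvdn_mulr.
  by rewrite dvdn_prime2 // (negPf p3).
have nz2 : ~~ (lrank p %| 2).
  by rewrite -dvdn_lucasE //; have -> : u 2 = P by rewrite /lucas; lia.
have nz3 : ~~ (lrank p %| 3).
  apply/negP; rewrite -dvdn_lucasE //.
  have -> : u 3 = P ^ 2 + 1 by rewrite /lucas; ring.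
  move=> p1; have : p %| P ^ 2 + 1 + 2 by rewrite -addnA.
  rewrite dvdn_addr //.
  by rewrite dvdn_prime2 // => /eqP p2; move: p_odd; rewrite p2.
have z0 := dvdn_leq (isT : 0 < 6) z6; move: z6 nz2 nz3.
by case: (lrank p) z0 => [|[|[|[|[|[|[|]]]]]]].
Qed.

Section Real.
Variable R : realType.
Local Open Scope ring_scope.

Let alpha : R := (P%:R + Num.sqrt (P%:R ^+ 2 + 4)) / 2.

Let alpha_sqr : alpha ^+ 2 = P%:R * alpha + 1.
Proof.
have := @sqr_sqrtr R (P%:R ^+ 2 + 4); rewrite addr_ge0 ?exprn_ge0 // => /(_ isT).
by rewrite /alpha; set s := Num.sqrt _ => e; move: e; rewrite !expr2 => e; field: e.
Qed.

Let alpha_ge3 : 3 <= alpha.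
Proof.
have P3 : 3 <= P%:R :> R by rewrite (ler_nat _ 3).
have : P%:R <= Num.sqrt (P%:R ^+ 2 + 4) :> R.
  by rewrite -{1}[P%:R]ger0_norm // -sqrtr_sqr ler_wsqrtr // lerDl.
by rewrite /alpha; lra.
Qed.

Let companion_alpha n : (v n)%:R = alpha ^+ n + (- alpha^-1) ^+ n.
Proof.
have a0 : alpha != 0 by apply/eqP=> e; have := alpha_ge3; rewrite e; lra.
have e1 : - alpha^-1 = P%:R - alpha.
  by apply: (mulfI a0); rewrite mulrN mulfV // mulrBr -expr2 alpha_sqr; ring.
have e2 : (- alpha^-1) ^+ 2 = P%:R * (- alpha^-1) + 1.
  by rewrite e1 expr2 -[(_ - alpha) * _]/(_) ; have := alpha_sqr; rewrite expr2 => h; ring: h.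
elim/nat_ind2: n => [||n IH0 IH1].
- by rewrite !expr0.
- by rewrite !expr1 e1 /companion; ring.
have s2 (x : R) : x ^+ n.+2 = x ^+ n * x ^+ 2 by rewrite -exprD addn2.
rewrite companionSS natrD natrM IH0 IH1 (s2 alpha) (s2 (- alpha^-1)) e2 alpha_sqr.
by rewrite !(exprSr _ n); ring.
Qed.

(** With [x = alpha^(-2y) <= 1/9] the difference is [ln (1 - x)], which lies between [-1/8] and
    0. *)
Let ln_companion_err y : odd y -> `|ln (v y)%:R - y%:R * ln alpha| <= 8^-1.
Proof.
move=> y_odd; have a3 := alpha_ge3; have a0 : 0 < alpha by lra.
have ay0 : 0 < alpha ^+ y by apply: exprn_gt0.
have Ev : (v y)%:R = alpha ^+ y * (1 - (alpha ^+ y) ^- 2).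
  rewrite companion_alpha exprNn -signr_odd y_odd expr1 exprVn mulrBr mulr1.
  by rewrite expr2 invfM mulrA mulfV ?gt_eqF // mul1r mulN1r.
have h9 : (alpha ^+ y) ^- 2 <= 9^-1.
  have y1 : alpha <= alpha ^+ y by rewrite -{1}[alpha]expr1 ler_weXn2l //; [lra|case: (y) y_odd].
  have e9 : 9 <= (alpha ^+ y) ^+ 2.
    have y3 : 3 <= alpha ^+ y by lra.
    by have := ler_pM (ler0n R 3) (ler0n R 3) y3 y3; rewrite expr2; lra.
  by rewrite lef_pV2 ?posrE ?exprn_gt0 //; lra.
have hp : 0 <= (alpha ^+ y) ^- 2 by rewrite invr_ge0 exprn_ge0 // ltW.
move: ((alpha ^+ y) ^- 2) Ev h9 hp => x Ev h9 hp.
have x1 : 0 < 1 - x by lra.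
rewrite Ev lnM ?posrE // lnXn // mulr_natl addrC addKr.
have h1 := ln_ge_1subV x1; have h2 := ln_le_sub1 x1.
have h3 : (1 - x)^-1 <= 9 / 8.
  by rewrite -[9 / 8]invf_div lef_pV2 ?posrE; lra.
by rewrite ler_norml; apply/andP; split; lra.
Qed.

(** For odd [e] this is the valuation at [p] of the primitive part of [u_{2e}], the value of the
    homogeneous cyclotomic polynomial of index [2e] at the two roots: the quotients
    [v_y = u_{2y} / u_y] absorb the factor 2 of the index. *)
Let T e p := mobius_diff (primes e) (fun y => (logn p (v y))%:R : R)
             (e %/ \prod_(q <- primes e) q)%N.

(** If a prime [r] other than [p] divides [e / d], pairing [y] with [r y] cancels the whole sum.
    Otherwise [e / d] is a power of [p], larger than 1 as [p] is not primitive. The increment along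
    [p] is the indicator of [d | y], whose Moebius sum is at most 1. *)
Lemma no_primitive_divisor_diff e p : odd e -> prime p ->
  ~~ (odd p && (lrank p == 2 * e)%N) -> (e != 3)%N -> (1 < e)%N ->
  T e p <= 1 /\ (p != max_pdiv e -> T e p = 0).
Proof.
move=> e_odd p_pr np e3 e1; rewrite /T; set l := primes e; set f := (e %/ _)%N.
have e0 : (0 < e)%N by lia.
have l_pr : all prime l by apply/allP=> q; rewrite mem_primes => /and3P[].
have fe : (f * \prod_(q <- l) q = e)%N.
  by have [w [E _]] := totient_radical e0; rewrite /f {1}E -/l mulKn ?prod_primes_gt0 // mulnC -E.
have f0 : (0 < f)%N by move: e0; rewrite -fe muln_gt0 => /andP[].
have ye x y : between l x y -> x = f -> (y %| e)%N by move=> /andP[_ h] xf; rewrite -fe -xf.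
have between_rem r x y : r \in l -> between (rem r l) x y -> between l x y.
  move=> rl /andP[h1 h2]; rewrite /between h1 (perm_big _ (perm_to_rem rl)) big_cons /= mulnCA.
  by apply: dvdn_trans h2 _; apply: dvdn_mull.
(* [f] contains all factors [r] of [e] but one, hence the [r]-part of [d] as soon as [r] divides
   [e / d]. *)
have up d r y : (d %| e)%N -> (r %| e %/ d)%N -> r \in l -> (f %| y)%N -> (0 < y)%N ->
    (d %| r * y)%N = (d %| y)%N.
  move=> de red rl fy y0; apply/idP/idP => [dry|]; last by move=> h; apply: dvdn_mull.
  have rpr := allP l_pr _ rl; have d0 := dvdn_gt0 e0 de.
  have ed0 : (0 < e %/ d)%N by rewrite divn_gt0 // dvdn_leq.
  have ld : (logn r d <= logn r y)%N.
    have h1 : logn r e = (logn r (e %/ d) + logn r d)%N by rewrite -lognM // divnK.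
    have h2 : (0 < logn r (e %/ d))%N by rewrite logn_gt0 mem_primes rpr ed0.
    have h3 : logn r e = (logn r f + 1)%N.
      rewrite -{1}fe lognM ?prod_primes_gt0 //; congr (_ + _)%N.
      by rewrite (logn_prod_primes rpr l_pr) ?primes_uniq ?rl.
    apply: leq_trans (dvdn_leq_log r y0 fy).
    by rewrite -ltnS -(addn1 (logn r f)) -h3 h1 -add1n leq_add2r.
  have [d' cop Ed] := pfactor_coprime rpr d0.
  rewrite Ed in dry *; rewrite Gauss_dvd ?coprimeXr 1?coprime_sym // ?pfactor_dvdn // ld andbT.
  have : (d' %| r * y)%N by apply: dvdn_trans dry; apply: dvdn_mulr.
  by rewrite Gauss_dvdr // coprime_sym.
have fdv y : between l f y -> (f %| y)%N && (0 < y)%N.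
  by move=> h; rewrite (dvdn_gt0 e0 (ye _ _ h erefl)) andbT; case/andP: h.
have [g0|[d [c [de dp d2 gE]]]] := companion_valuation p_pr e_odd.
  rewrite (eq_mobius_diff (h := fun=> 0)) ?mobius_diff_zero; last first.
    by move=> y hy; rewrite g0 //; apply: ye hy erefl.
  by split=> //; exact: ler01.
have d_neq : d != e.
  apply/eqP=> d_e; have [p2|p_odd] := even_prime p_pr.
    have : (e <= 3)%N by rewrite -d_e d2 // p2.
    by move: e_odd e3 e1; case: (e) => [|[|[|[|]]]].
  by move: np; rewrite p_odd dp // d_e eqxx.
have d0 := dvdn_gt0 e0 de.
have ed1 : (1 < e %/ d)%N.
  have : (0 < e %/ d)%N by rewrite divn_gt0 // dvdn_leq.
  case E : (e %/ d)%N => [|[|]] // _; move: d_neq; rewrite -(divnK de) E mul1n eqxx //.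
have lg r y : prime r -> (d %| y)%N -> (0 < y)%N ->
    logn p (r * y %/ d) = ((p == r) + logn p (y %/ d))%N.
  move=> rpr dy y0; have yd0 : (0 < y %/ d)%N by rewrite divn_gt0 // dvdn_leq.
  by rewrite -(muln_divA r dy) (lognM p (prime_gt0 rpr) yd0) (logn_prime _ rpr).
have ed_e r : (r %| e %/ d)%N -> prime r -> r \in l.
  move=> h rpr; rewrite mem_primes rpr e0 /=; apply: dvdn_trans h _.
  by apply/dvdnP; exists d; rewrite mulnC divnK.
have [/hasP[r rp nrp]|/hasPn allp] := boolP (has (predC1 p) (primes (e %/ d))).
  have [rpr _ red] := and3P (etrans (esym (mem_primes _ _)) rp).
  have rl := ed_e r red rpr.
  have -> : mobius_diff l (fun y => (logn p (v y))%:R : R) f = 0.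
    rewrite (mobius_diff_rem (q := r) (h := fun=> 0)) ?mobius_diff_zero // => y hy.
    have hy' := between_rem _ _ _ rl hy; have /andP[fy y0] := fdv _ hy'.
    have rye : (r * y %| e)%N.
      case/andP: hy => _; rewrite -fe (perm_big _ (perm_to_rem rl)) big_cons /= mulnCA.
      by rewrite dvdn_pmul2l // prime_gt0.
    rewrite addr0 (gE _ rye) (gE _ (ye _ _ hy' erefl)) (up d r y) //.
    case: ifP => // dy; congr ((c + _)%N)%:R.
    by rewrite lg // eq_sym (negPf nrp).
  by split=> //; exact: ler01.
have pd : p \in primes (e %/ d).
  have : pdiv (e %/ d) \in primes (e %/ d) by rewrite pi_pdiv.
  by move=> h; have := allp _ h; rewrite /= negbK => /eqP <-.
have [_ _ ped] := and3P (etrans (esym (mem_primes _ _)) pd).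
have pl := ed_e p ped p_pr.
have pe : (p %| e)%N by move: pl; rewrite mem_primes => /and3P[].
have p_odd : odd p by case/dvdnP: pe e_odd => a ->; rewrite oddM => /andP[].
have allp' r : prime r -> (r %| e %/ d)%N -> r = p.
  move=> rpr h; apply/eqP; have := allp r; rewrite mem_primes rpr h divn_gt0 // dvdn_leq //=.
  by rewrite negbK; apply.
split; last first.
  move=> nmax; case/eqP: nmax; apply/eqP; rewrite eqn_leq max_pdiv_max ?pl //=.
  have mpr := max_pdiv_prime e1; set r := max_pdiv e in mpr *.
  have re : (r %| e)%N by apply: max_pdiv_dvd.
  (* Since [p] divides [v_e], its rank [2 d] divides [p - 1]. So the primes of [d] are smaller than
     [p], and those of [e / d] are [p]: this makes [p] the largest prime of [e]. *)
  have dv : (d %| p.-1)%N.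
    have pv : (p %| v e)%N.
      have : (0 < logn p (v e))%N.
        rewrite gE // de ltn_addl // logn_gt0 //.
      by rewrite logn_gt0 mem_primes => /and3P[].
    have := lrank_double_dvd hP p_pr p_odd e_odd pv; rewrite dp //.
    by apply: dvdn_trans; apply: dvdn_mull.
  move: re; rewrite -(divnK de) Euclid_dvdM // => /orP[/(allp' _ mpr) -> //|rd].
  apply: leq_trans (dvdn_leq _ (dvdn_trans rd dv)) (leq_pred _).
  by rewrite -subn1 subn_gt0 prime_gt1.
rewrite (mobius_diff_rem (q := p) (h := fun y => (d %| y)%:R : R)) //; last first.
  move=> y hy; have hy' := between_rem _ _ _ pl hy; have /andP[fy y0] := fdv _ hy'.
  have rye : (p * y %| e)%N.
    case/andP: hy => _; rewrite -fe (perm_big _ (perm_to_rem pl)) big_cons /= mulnCA.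
    by rewrite dvdn_pmul2l // prime_gt0.
  rewrite (gE _ rye) (gE _ (ye _ _ hy' erefl)) (up d p y) //.
  case: ifP => // dy; last by rewrite addr0.
  by rewrite lg // eqxx -natrD addnCA addnC ?dy.
(* Below the top some prime [q] other than [p] is missing from [y]; if [d] divided [y], then [q]
   would divide [e / d], a power of [p]. *)
rewrite mobius_diff_top ?rem_uniq ?primes_uniq //; first by rewrite (ler_nat _ _ 1) leq_b1.
move=> q y ql hy; suff -> : (d %| y)%N = false by [].
apply/negP=> dy.
have ql' : q \in l by apply: mem_rem ql.
have qp : q != p by apply: contraTneq ql => ->; rewrite mem_rem_uniqF ?primes_uniq.
have qpr := allP l_pr _ ql'.
have hy' : between (rem q l) f y.
  case/andP: hy => h1 h2; rewrite /between h1; apply: dvdn_trans h2 _; rewrite dvdn_pmul2l //.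
  have pq : p \in rem q l by rewrite mem_rem_uniq ?primes_uniq // !inE eq_sym qp pl.
  have : perm_eq (rem q l) (p :: rem q (rem p l)).
    have ul : uniq l by apply: primes_uniq.
    have ul' r : uniq (rem r l) by apply: rem_uniq.
    apply: uniq_perm => [|/=|x]; rewrite ?rem_uniq // ?andbT.
      by rewrite mem_rem_uniq ?ul' // inE mem_rem_uniqF // andbF.
    rewrite inE !mem_rem_uniq ?ul' // !inE mem_rem_uniq // !inE.
    by case: (eqVneq x p) => [->|] //=; rewrite eq_sym qp pl.
  by move=> pe'; rewrite (perm_big _ pe') big_cons /= dvdn_mull.
have y0 : (0 < y)%N by have /andP[] := fdv _ (between_rem _ _ _ ql' hy').
have qye : (q * y %| e)%N.
  case/andP: hy' => _; rewrite -fe (perm_big _ (perm_to_rem ql')) big_cons /= mulnCA.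
  by rewrite dvdn_pmul2l // prime_gt0.
have : (q %| e %/ d)%N.
  rewrite dvdn_divRL //; apply: dvdn_trans qye; exact: dvdn_mul.
by move/(allp' _ qpr)/eqP; rewrite (negPf qp).
Qed.

(** The main term is [f phi ln alpha], and the error is at most [2^(size l) / 8 <= phi / 8]. For the
    largest prime [r] of [e], [phi >= r - 1], which outgrows [ln r]. *)
Lemma mobius_diff_companion_gt e : odd e -> (1 < e)%N ->
  ln (max_pdiv e)%:R <
  mobius_diff (primes e) (fun y => ln (v y)%:R : R) (e %/ \prod_(q <- primes e) q)%N.
Proof.
move=> e_odd e1; set l := primes e; set f := (e %/ _)%N.
have e0 : (0 < e)%N by lia.
have l_pr : all prime l by apply/allP=> q; rewrite mem_primes => /and3P[].
have fe : (f * \prod_(q <- l) q = e)%N.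
  by have [w [E _]] := totient_radical e0; rewrite /f {1}E -/l mulKn ?prod_primes_gt0 // mulnC -E.
have f0 : (0 < f)%N by move: e0; rewrite -fe muln_gt0 => /andP[].
have l3 q : q \in l -> 3 <= q%:R :> R.
  move=> ql; have := allP l_pr _ ql => qpr; rewrite (ler_nat _ 3) odd_prime_gt2 //.
  by move: ql; rewrite mem_primes => /and3P[_ _ /dvdnP[a E]]; move: e_odd; rewrite E oddM => /andP[].
pose phi : R := \prod_(q <- l) (q%:R - 1).
have phi2 : 2 ^+ size l <= phi.
  rewrite /phi; elim: (l) l3 => [|q l' IH] H; first by rewrite big_nil.
  rewrite big_cons exprS ler_pM ?exprn_ge0 //; first by have := H q (mem_head _ _); lra.
  by apply: IH => r rl; apply: H; rewrite inE rl orbT.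
have rl : max_pdiv e \in l by rewrite -[l]/(primes e) pi_max_pdiv.
have r_phi : (max_pdiv e)%:R - 1 <= phi.
  rewrite /phi (perm_big _ (perm_to_rem rl)) big_cons /=.
  rewrite -[X in X <= _]mulr1 ler_wpM2l //; first by have := l3 _ rl; lra.
  rewrite big_seq; apply: (big_ind (fun x : R => 1 <= x)) => [|x y x1 y1|q /mem_rem /l3]; [lra|nra|lra].
have r3 := l3 _ rl.
have main : f%:R * phi * ln alpha - phi * 8^-1 <=
    mobius_diff l (fun y => ln (v y)%:R : R) f.
  have bd : `|mobius_diff l (fun y => ln (v y)%:R - y%:R * ln alpha : R) f| <= 2 ^+ size l * 8^-1.
    apply: mobius_diff_bound => y /andP[_ hy]; apply: ln_companion_err.
    by rewrite fe in hy; case/dvdnP: hy e_odd => a ->; rewrite oddM => /andP[].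
  have := mobius_diffB l (fun y => ln (v y)%:R : R) (fun y => y%:R * ln alpha) f.
  rewrite mobius_diff_linear -/phi => E; rewrite E in bd.
  by move: bd; rewrite ler_norml => /andP[h1 _]; lra.
apply: lt_le_trans main.
have la : 1 <= ln alpha.
  by apply: le_trans (ln3_ge1 R) _; apply: ler_lnn => //; lra.
have la3 : ln 3 <= ln alpha by apply: ler_lnn => //; lra.
have f1 : 1 <= f%:R :> R by rewrite (ler_nat _ 1).
have lnr : ln (max_pdiv e)%:R <= ln 3 + ((max_pdiv e)%:R / 3 - 1) :> R.
  have -> : (max_pdiv e)%:R = 3 * ((max_pdiv e)%:R / 3) :> R by field.
  rewrite lnM ?posrE; try lra.
  rewrite lerD2l; apply: le_trans (ln_le_sub1 _) _; lra.
have phi0 : 2 <= phi by lra.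
have : phi * ln alpha <= f%:R * phi * ln alpha by rewrite -mulrA ler_peMl //; nra.
nra.
Qed.

(** Without a primitive prime the valuation bounds allow the Moebius sum of [ln v] at most one term,
    the logarithm of the largest prime of [e]. This contradicts the lower bound. *)
Lemma primitive_divisor e : odd e -> (1 < e)%N -> (e != 3)%N ->
  exists p, [/\ prime p, odd p & lrank p = (2 * e)%N].
Proof.
move=> e_odd e1 e3; have e0 : (0 < e)%N by lia.
pose S := primes (u (2 * e)).
have [/hasP[p]|/hasPn no] := boolP (has (fun p => odd p && (lrank p == 2 * e)%N) S).
  by rewrite mem_primes => /and3P[pp _ _] /andP[po /eqP h]; exists p.
have big := mobius_diff_companion_gt e_odd e1.
have : mobius_diff (primes e) (fun y => ln (v y)%:R : R) (e %/ \prod_(q <- primes e) q)%N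
   <= ln (max_pdiv e)%:R.
  rewrite (eq_mobius_diff (h := fun y => \sum_(p <- S) (logn p (v y))%:R * ln p%:R)); last first.
    move=> y /andP[_ hy]; apply: ln_nat_prod; rewrite ?companion_gt0 ?primes_uniq // => p.
    have ye : (y %| e)%N.
      have [w [E _]] := totient_radical e0; move: hy.
      by rewrite {1}E mulKn ?prod_primes_gt0 // mulnC -E.
    rewrite !mem_primes companion_gt0 // => /and3P[-> _ pv] /=.
    rewrite lucas_gt0 ?muln_gt0 ?e0 //=.
    apply: dvdn_trans (dvdn_lucas P (_ : 2 * y %| _)%N); last by rewrite dvdn_pmul2l.
    by rewrite lucas_double dvdn_mull.
  rewrite mobius_diff_sum (eq_bigr (fun p => T e p * ln p%:R)); last first.
    by move=> p _; rewrite /T -mobius_diffZ.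
  have Tb p : p \in S -> T e p <= 1 /\ (p != max_pdiv e -> T e p = 0).
    move=> pS; apply: no_primitive_divisor_diff => //; last exact: no.
    by move: pS; rewrite mem_primes => /and3P[].
  have r0 : 0 <= ln (max_pdiv e)%:R :> R by rewrite ln_ge0 // (ler_nat _ 1) max_pdiv_gt0.
  have [rS|nrS] := boolP (max_pdiv e \in S).
    rewrite (perm_big _ (perm_to_rem rS)) big_cons /= big_seq big1 => [|p].
      by rewrite addr0 ler_piMl //; have [] := Tb _ rS.
    rewrite mem_rem_uniq ?primes_uniq // !inE => /andP[pr pS].
    by have [_ ->] := Tb _ pS; rewrite ?mul0r.
  rewrite big_seq big1 // => p pS; have [_ ->] := Tb _ pS; rewrite ?mul0r //.
  by apply: contraNneq nrS => <-.
by move=> le; have := lt_le_trans big le; rewrite ltxx.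
Qed.

End Real.
End PrimitiveDivisor.

(** * Euler products over odd primes and counts of divisors *)

Lemma prod_odd_le l : sorted ltn l -> all (fun q => (1 < q) && (q %% 2 == 1)) l ->
  (\prod_(q <- l) q) ^ 2 <= (2 * size l).+1 * (\prod_(q <- l) q.-1) ^ 2.
Proof.
elim/last_ind: l => [|l p IH]; first by rewrite !big_nil.
move=> so al; have := path_ltn_last_mod (isT : 0 < 2) so al.
have so' : sorted ltn l by move: so; rewrite -cats1 => /cat_sorted2 [].
have al' : all (fun q => (1 < q) && (q %% 2 == 1)) l by move: al; rewrite all_rcons => /andP[].
have {IH so al so' al'} := IH so' al'.
rewrite -cats1 !big_cat !big_seq1 size_cat /= addn1.
move: (\prod_(j <- l) j) (\prod_(j <- l) j.-1) (size l) => R S s le lt.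
rewrite !expnMn.
(* With [j = s + 1] one has [p >= 2j + 1], and [((2j + 1) / (2j))^2 <= (2j + 1) / (2j - 1)]
   telescopes. *)
suff : p ^ 2 * (2 * s).+1 <= p.-1 ^ 2 * (2 * s.+1).+1.
  move=> H; have h1 := leq_mul le (leqnn (p ^ 2)); have h2 := leq_mul (leqnn (S ^ 2)) H.
  move: h1 h2; move: (R ^ 2) (S ^ 2) (p ^ 2) (p.-1 ^ 2) => a b c d; nia.
have [r ->] : exists r, p = 2 * s.+1 + 1 + r by exists (p - (2 * s.+1 + 1)); lia.
have -> : (2 * s.+1 + 1 + r).-1 = 2 * s.+1 + r by lia.
nia.
Qed.

Lemma logn_add_lt p a b : prime p -> 0 < a -> 0 < b -> logn p b < logn p a ->
  logn p (a + b) = logn p b.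
Proof.
move=> p_pr a0 b0 lt; have ab0 : 0 < a + b by lia.
apply/eqP; rewrite eqn_leq; apply/andP; split; last first.
  by rewrite -pfactor_dvdn // dvdn_add ?pfactor_dvdn // ltnW.
rewrite leqNgt -pfactor_dvdn // dvdn_addr ?pfactor_dvdn //.
by rewrite ltnn.
Qed.

(* The involution [e |-> N / e] exchanges the divisors below and above [sqrt N]. *)
Lemma count_small_divisors N : 0 < N ->
  2 * count (fun e => e * e < N) (divisors N) <= size (divisors N).
Proof.
move=> N0; set a := fun e => e * e < N.
have uD := divisors_uniq N.
rewrite mul2n -addnn -[X in _ <= X](count_predC a) leq_add2l.
rewrite -!size_filter -(size_map (fun e => N %/ e)); apply: uniq_leq_size.
  rewrite map_inj_in_uniq ?filter_uniq // => x y.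
  rewrite !mem_filter -!dvdn_divisors // => /andP[_ xN] /andP[_ yN] e.
  have := divnK xN; rewrite e => e2.
  have : N %/ y * x == N %/ y * y by rewrite e2 (divnK yN).
  rewrite eqn_pmul2l; first by move/eqP.
  by rewrite divn_gt0 ?(dvdn_gt0 N0 yN) // dvdn_leq.
move=> y /mapP[x]; rewrite !mem_filter -!dvdn_divisors // => /andP[ax xN] ->.
apply/andP; split; last by apply/dvdnP; exists x; rewrite mulnC divnK.
have x0 := dvdn_gt0 N0 xN; rewrite /a /= -leqNgt; move: ax; rewrite /a -{1 2}(divnK xN) ltn_pmul2r //.
by move=> lt; rewrite leq_mul2l ltnW // orbT.
Qed.

(** Multiplication by [q] injects the divisors prime to [q] into the multiples of [q]. *)
Lemma count_dvd_divisors q N : prime q -> q %| N -> 0 < N ->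
  size (divisors N) <= 2 * count (fun e => q %| e) (divisors N).
Proof.
move=> q_pr qN N0; rewrite -[X in X <= _](count_predC (fun e => q %| e)) mul2n -addnn leq_add2l.
rewrite -!size_filter -(size_map (fun e => q * e)); apply: uniq_leq_size.
  rewrite map_inj_in_uniq ?filter_uniq ?divisors_uniq // => x y _ _ /eqP.
  by rewrite eqn_pmul2l ?prime_gt0 // => /eqP.
move=> y /mapP[x]; rewrite !mem_filter -!dvdn_divisors //= => /andP[nqx xN] ->.
by rewrite dvdn_mulr //= Gauss_dvd ?qN // prime_coprime.
Qed.

Lemma four_mul_lt_exp s : 35 <= s -> 4 * (2 * s).+1 < 2 ^ (s * 2).
Proof.
move=> /subnK <-; elim: (s - 35) => [|i IH].
  apply: (@leq_trans (2 ^ 10)); last by rewrite leq_exp2l.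
  by rewrite -[2 ^ 10]/1024; lia.
by rewrite addSn (mulSn (i + 35) 2) expnD -[2 ^ 2]/4; move: (2 ^ _) IH => y; lia.
Qed.

(** * Even [n]: valuations, the excess prime, and the number of divisors *)

Section EvenIndex.
Variable P : nat.
Hypothesis hP : 2 < P.
Local Notation u := (lucas P).
Local Notation v := (companion P).
Local Notation lrank := (lrank P).

Lemma primitive_prime e : odd e -> 1 < e -> ~~ ((P == 3) && (e == 3)) ->
  exists p, [/\ prime p, odd p & lrank p = 2 * e].
Proof.
move=> eo e1; case: (eqVneq e 3) => [-> | e3 _].
  by rewrite andbT => P3; apply: primitive_divisor3; rewrite // ltn_neqAle eq_sym P3.
exact: (primitive_divisor hP Rdefinitions.R).
Qed.

Lemma primitive_prime_mod p e : prime p -> odd p -> odd e -> lrank p = 2 * e -> 2 * e %| p.-1.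
Proof.
move=> p_pr po eo z; rewrite -z; apply: (lrank_double_dvd hP p_pr po eo).
have : p %| u (2 * e) by rewrite dvdn_lucasE // z.
rewrite lucas_double Euclid_dvdM // dvdn_lucasE // z => /orP[|//].
have e0 : 0 < e by case: (e) eo.
by move/dvdn_leq => /(_ e0); lia.
Qed.

Definition has_primitive e := [&& odd e, 1 < e & ~~ ((P == 3) && (e == 3))].

Lemma primitive_primes E : uniq E -> all has_primitive E -> exists L,
  [/\ uniq L, size L = size E &
     forall p, p \in L -> [/\ prime p, odd p & exists2 e, e \in E & lrank p = 2 * e]].
Proof.
elim: E => [|e E IH] /=; first by exists [::].
case/andP=> eE uE /andP[/and3P[eo e1 e3] /(IH uE)[L [uL sL HL]]].
have [p [p_pr po pz]] := primitive_prime eo e1 e3.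
exists (p :: L); rewrite /= uL sL; split=> //.
  rewrite andbT; apply/negP=> /HL[_ _ [e' e'E]]; rewrite pz => /eqP.
  by rewrite eqn_pmul2l // => /eqP ee; rewrite ee e'E in eE.
move=> r; rewrite inE => /orP[/eqP ->|/HL[r1 r2 [e' h1 h2]]].
  by split=> //; exists e; rewrite ?mem_head.
by split=> //; exists e'; rewrite // inE h1 orbT.
Qed.

Variables (n m : nat).
Hypotheses (m1 : 1 < m) (mn : m < n) (Ephi : totient (u n) = u m) (n_even : ~~ odd n).
Local Notation k := (n - m).
Local Notation l := [seq p <- primes (u n) | odd p].
Local Notation s' := (size l).

Let un0 : 0 < u n. Proof. by apply: lucas_gt0; lia. Qed.
Let um0 : 0 < u m. Proof. by apply: lucas_gt0; lia. Qed.
Let k0 : 0 < k. Proof. lia. Qed.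
Let m0 : 0 < m. Proof. lia. Qed.

Lemma dvdn_prod_pred : \prod_(p <- l) p.-1 %| u m.
Proof.
have [w [_ E2]] := totient_radical un0; rewrite Ephi in E2.
by rewrite E2 dvdn_mulr // (perm_big _ (perm_primes_odd un0)) big_cat /= dvdn_mull.
Qed.

Lemma exp_prime_count q L : uniq L -> (forall p, p \in L -> p \in l /\ q %| p.-1) ->
  q ^ size L %| u m.
Proof.
move=> uL H; apply: dvdn_trans dvdn_prod_pred.
have pm : perm_eq [seq p <- l | p \in L] L.
  apply: uniq_perm; rewrite ?filter_uniq ?primes_uniq // => p.
  by rewrite mem_filter andb_idr // => /H[].
rewrite (bigID (fun p => p \in L)) /= -big_filter (perm_big _ pm) dvdn_mulr //.
elim: L {uL pm} H => [|p L IH] H /=; first by rewrite expn0.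
rewrite big_cons expnS dvdn_mul //; first by have [] := H p (mem_head _ _).
by apply: IH => r rL; apply: H; rewrite inE rL orbT.
Qed.

Lemma two_pow_le : 2 ^ s' <= P.+1 * 2 ^ logn 2 m.
Proof.
apply: leq_trans (lucas_two_part_le hP m0); rewrite leq_exp2l // -pfactor_dvdn //.
apply: exp_prime_count; rewrite ?filter_uniq ?primes_uniq // => p pl; split=> //.
move: pl; rewrite mem_filter mem_primes => /andP[po /and3P[/prime_gt0 p0 _ _]].
by rewrite dvdn2; case: p po p0.
Qed.

Lemma even_ratio_sqr : u k.+1 ^ 2 <= (if 2 %| u n then 4 else 1) * (2 * s').+1.
Proof.
have := lucas_ratio_prod hP m1 mn Ephi; rewrite !(perm_big _ (perm_primes_odd un0)) !big_cat /=.
have l_odd : all (fun q => (1 < q) && (q %% 2 == 1)) l.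
  apply/allP=> p; rewrite mem_filter mem_primes => /andP[po /and3P[p_pr _ _]].
  by rewrite prime_gt1 // modn2 po.
have l_so : sorted ltn l by apply: sorted_filter; [exact: ltn_trans | exact: sorted_primes].
have := prod_odd_le l_so l_odd.
have : 0 < \prod_(q <- l) q.-1.
  by apply: prod_pred_gt0; apply: sub_all l_odd => q /andP[].
move: (\prod_(q <- l) q.-1) (\prod_(q <- l) q) => S R S0 le.
have S20 : 0 < S ^ 2 by rewrite expn_gt0 S0.
case: ifP => u2; rewrite ?big_seq1 ?big_nil ?mul1n => le2; rewrite -(leq_pmul2r S20) -expnMn.
  rewrite -mulnA; apply: (leq_trans (n := (2 * R) ^ 2)); first by rewrite leq_exp2r.
  by rewrite expnMn leq_mul2l le.
by apply: leq_trans le; rewrite leq_exp2r.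
Qed.

(** For odd [m], 4 does not divide [u_m], so [u_n] has at most one odd prime factor. Then
    [u_n <= 2 (3/2) u_m], less than the growth over one index. *)
Lemma even_m : ~~ odd m.
Proof.
apply/negP=> mo.
have s1 : s' <= 1.
  rewrite leqNgt; apply/negP=> lt; have := lucas_odd_dvd4 hP mo; case/negP.
  have : 2 ^ s' %| u m.
    apply: exp_prime_count; rewrite ?filter_uniq ?primes_uniq // => p pl; split=> //.
    move: pl; rewrite mem_filter mem_primes => /andP[po /and3P[/prime_gt0 p0 _ _]].
    by rewrite dvdn2; case: p po p0.
  by apply: dvdn_trans; rewrite -[4]/(2 ^ 2) dvdn_exp2l.
have [w [E1 E2]] := totient_radical un0; rewrite Ephi in E2.
have le3 : u n <= 3 * u m.
  rewrite E1 {1}E2 mulnA leq_mul2r; apply/orP; right.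
  rewrite !(perm_big _ (perm_primes_odd un0)) !big_cat /=.
  have l_odd p : p \in l -> 2 < p.
    by rewrite mem_filter mem_primes => /andP[po /and3P[p_pr _ _]]; apply: odd_prime_gt2.
  case: (l) s1 l_odd => [|p [|]] //= _ H.
    by case: ifP => _; rewrite ?big_seq1 ?big_nil.
  have := H p (mem_head _ _); case: ifP => _; rewrite ?big_seq1 ?big_nil; lia.
have : u n > 3 * u m.
  apply: leq_trans (lucas_mono hP mn).
  have [j Ej] : exists j, m = j.+2 by exists m.-2; lia.
  rewrite Ej (lucasSS P j.+1); have := lucas_gt0 hP (isT : 0 < j.+1).
  have : 3 * u j.+2 <= P * u j.+2 by rewrite leq_mul2r hP orbT.
  by lia.
by rewrite ltnNge le3.
Qed.

Lemma even_k : ~~ odd k. Proof. by rewrite oddB ?(ltnW mn) // (negPf n_even) (negPf even_m). Qed.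
Lemma k2 : 1 < k. Proof. by move: even_k k0; case: k => [|[|]]. Qed.

(** For odd [P] the rank of 2 is 3. If 3 divided [n], then [u_m] being even would make 3 divide [m]
    and [k], so 6 would divide [k]. For small [k] this removes the factor 4 of [even_ratio_sqr]. *)
Lemma lucas_n_odd : odd P -> k < 6 -> ~~ (2 %| u n) /\ ~~ (3 %| n).
Proof.
move=> Po k6; have z2 := lrank2 hP; rewrite Po in z2.
rewrite dvdn_lucasE // z2; suff : ~~ (3 %| n) by [].
apply/negP=> n3; have s0 : 0 < s'.
  have := even_ratio_sqr.
  have : u 3 <= u k.+1 by apply: lucas_mono => //; exact: k2.
  have : 10 <= u 3 by rewrite /lucas; nia.
  case: s' => // h1 h2 h3.
  have : 10 ^ 2 <= u k.+1 ^ 2 by rewrite leq_exp2r //; apply: leq_trans h2.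
  by move: h3; case: ifP => _; rewrite -[10 ^ 2]/100; lia.
have : 2 ^ s' %| u m.
  apply: exp_prime_count; rewrite ?filter_uniq ?primes_uniq // => p pl; split=> //.
  move: pl; rewrite mem_filter mem_primes => /andP[po /and3P[/prime_gt0 p0 _ _]].
  by rewrite dvdn2; case: p po p0.
move=> d; have : 2 %| u m by apply: dvdn_trans d; rewrite -{1}(expn1 2) dvdn_exp2l.
rewrite dvdn_lucasE // z2 => m3; have : 3 %| k by rewrite dvdn_subr // ltnW.
by have := even_k; have := k0; case: k k6 => [|[|[|[|[|[|]]]]]].
Qed.

(** For [P >= 4] the count comes from [u_{k+1} >= u_3 >= 17]. For [P = 3] and [k = 2], where [u_3]
    is only 10, the factor 4 has to be removed first. *)
Lemma card_odd_primes_ge : 35 <= s' /\ P ^ k < 2 ^ s'.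
Proof.
have ge2 : u 3 <= u k.+1 by apply: lucas_mono => //; exact: k2.
have u3 : u 3 = P ^ 2 + 1 by rewrite /lucas; ring.
have rat := even_ratio_sqr.
have rat4 : u k.+1 ^ 2 <= 4 * (2 * s').+1.
  by apply: leq_trans rat _; rewrite leq_mul2r; case: ifP; rewrite orbT.
have s35 : 35 <= s'.
  have [P4|P3] := leqP 4 P.
    have h : 17 ^ 2 <= u k.+1 ^ 2.
      by rewrite leq_exp2r //; apply: leq_trans ge2; rewrite u3; nia.
    by move: (leq_trans h rat4); rewrite -[17 ^ 2]/289; lia.
  have {}P3 : P = 3 by lia.
  have [k4|k4] := leqP 4 k.
    have h : 109 ^ 2 <= u k.+1 ^ 2.
      rewrite leq_exp2r //; apply: leq_trans (lucas_mono hP (_ : 5 <= _)); last by [].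
      by rewrite P3.
    by move: (leq_trans h rat4); have -> : 109 ^ 2 = 109 * 109 by []; lia.
  have Po : odd P by rewrite P3.
  have [nu _] := lucas_n_odd Po (ltn_trans k4 (isT : 4 < 6)).
  rewrite (negPf nu) mul1n in rat.
  have h : 10 ^ 2 <= u k.+1 ^ 2 by rewrite leq_exp2r //; apply: leq_trans ge2; rewrite u3 P3.
  by move: (leq_trans h rat); rewrite -[10 ^ 2]/100; lia.
split=> //; rewrite -(ltn_exp2r _ _ (isT : 0 < 2)).
apply: (leq_ltn_trans (n := u k.+1 ^ 2)); first by rewrite leq_exp2r // lucas_exp_ge.
apply: leq_ltn_trans rat4 _; rewrite -expnM.
exact: four_mul_lt_exp.
Qed.

(** [(P + 1) k <= P^k < 2^s'], and [2^s'] is at most [P + 1] times the 2-part of [m]. *)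
Lemma k_lt_two_part : k < 2 ^ logn 2 m.
Proof.
have [_ lt] := card_odd_primes_ge; have le := two_pow_le.
have : P.+1 * k <= P ^ k.
  have := k2; elim: k => // j IH; rewrite leq_eqVlt => /orP[/eqP <-|lj].
    by rewrite expnS expn1; nia.
  have {}IH := IH lj; rewrite expnS; have : 3 * (P.+1 * j) <= P * P ^ j by apply: leq_mul.
  have : P.+1 <= P.+1 * j by rewrite leq_pmulr //; lia.
  by rewrite mulnS; lia.
move=> h; have : P.+1 * k < P.+1 * 2 ^ logn 2 m by lia.
by rewrite ltn_pmul2l.
Qed.

Lemma logn2_k : logn 2 n = logn 2 k.
Proof.
have {1}-> : n = m + k by rewrite subnKC // ltnW.
apply: logn_add_lt => //; rewrite -(ltn_exp2l _ _ (isT : 1 < 2)).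
apply: leq_ltn_trans k_lt_two_part; apply: dvdn_leq => //; exact: pfactor_dvdnn.
Qed.

Lemma logn_m q : prime q -> logn q k < logn q n -> logn q m = logn q k.
Proof.
move=> q_pr lt; apply/eqP; rewrite eqn_leq; apply/andP; split.
  rewrite leqNgt; apply/negP=> h; have := logn_add_lt q_pr m0 k0 h.
  by rewrite subnKC ?(ltnW mn) // => e; rewrite e ltnn in lt.
have dn : q ^ logn q k %| n by rewrite pfactor_dvdn ?(ltnW lt) // (leq_trans m0 (ltnW mn)).
have : q ^ logn q k %| n - k by rewrite dvdn_subr ?leq_subr ?pfactor_dvdnn.
by rewrite subKn ?(ltnW mn) // pfactor_dvdn.
Qed.

Lemma prime_count_le q E : prime q -> odd q -> logn q k < logn q n ->
  uniq E -> (forall e, e \in E -> [/\ has_primitive e, q %| e & e %| n]) ->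
  size E <= logn q (u m).
Proof.
move=> q_pr qo lt uE HE.
have [L [uL <- HL]] := primitive_primes uE (introT allP (fun e eE => let: And3 h _ _ := HE e eE in h)).
rewrite -pfactor_dvdn //; apply: exp_prime_count => // p pL.
have [p_pr po [e eE pz]] := HL p pL; have [/and3P[eo e1 _] qe en] := HE e eE.
split; last by apply: dvdn_trans (primitive_prime_mod p_pr po eo pz); apply: dvdn_mull.
rewrite mem_filter po mem_primes p_pr un0 /= dvdn_lucasE // pz.
by rewrite Gauss_dvd ?coprime2n // en dvdn2 n_even.
Qed.

Lemma logn_lucas_m_le q : prime q -> odd q -> logn q k < logn q n ->
  logn q (u m) <= logn q k + logn q (u (lrank q)).
Proof.
move=> q_pr qo lt; rewrite -(logn_m q_pr lt).
have [qu|nqu] := boolP (q %| u m); last by rewrite [X in X <= _]logn_coprime // prime_coprime.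
rewrite dvdn_lucasE // in qu; have [i Ei] := dvdnP qu.
have i0 : 0 < i by case: i Ei m0 => // ->.
have z0 : 0 < lrank q by have := lrank_gt1 hP q_pr; lia.
rewrite {1}Ei mulnC logn_lucas_mul ?dvdn_lucas_rank // addnC leq_add2r.
by apply: dvdn_leq_log => //; rewrite Ei dvdn_mulr.
Qed.

(** Otherwise the rank of [q] is [q], and [u_m] has the same [q]-adic valuation as [m], namely that
    of [k], say [w]. But each of [q, q^2, ..., q^(w+1)] divides [n] and brings a primitive prime, so
    that valuation is at least [w + 1]. *)
Lemma nondiscr q : prime q -> odd q -> logn q k < logn q n -> ~~ (q %| P ^ 2 + 4).
Proof.
move=> q_pr qo lt; apply/negP=> qD.
have q3 : 3 < q by apply: discr_prime_gt3 qD.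
pose E := [seq q ^ i.+1 | i <- iota 0 (logn q k).+1].
have q1 := prime_gt1 q_pr.
have uE : uniq E.
  rewrite map_inj_uniq ?iota_uniq // => i j /eqP.
  by rewrite eqn_exp2l // eqSS => /eqP.
have HE e : e \in E -> [/\ has_primitive e, q %| e & e %| n].
  case/mapP=> i; rewrite mem_iota add0n => /andP[_ li] ->; split.
  - rewrite /has_primitive oddX qo orbT /= -{1}(expn0 q) ltn_exp2l //=.
    rewrite negb_and; apply/orP; right; rewrite neq_ltn; apply/orP; right.
    by apply: leq_trans q3 _; rewrite -{1}(expn1 q) leq_exp2l.
  - by rewrite expnS dvdn_mulr.
  - by rewrite pfactor_dvdn //; [apply: leq_trans li lt | lia].
have := prime_count_le q_pr qo lt uE HE; rewrite size_map size_iota.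
have [qu|nqu] := boolP (q %| u m); last by rewrite [X in _ <= X]logn_coprime // prime_coprime.
have z := lrank_discr hP q_pr qo qD; have qu' := qu; rewrite dvdn_lucasE // z in qu'.
have [i Ei] := dvdnP qu'.
have i0 : 0 < i by case: i Ei m0 => // ->.
have lm : logn q m = (logn q i).+1.
  by rewrite Ei lognM ?(prime_gt0 q_pr) // (logn_prime _ q_pr) eqxx addn1.
rewrite -(logn_m q_pr lt) lm Ei mulnC.
rewrite logn_lucas_mul ?(prime_gt0 q_pr) ?dvdn_lucas_discr // logn_lucas_discr // add1n.
by rewrite ltnn.
Qed.

Let n0 : 0 < n. Proof. lia. Qed.
Local Notation n1 := (n %/ 2 ^ logn 2 n).
Local Notation exc := ((P == 3) && (3 %| n1)).

Lemma n1_dvd : n1 %| n.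
Proof. by apply/dvdnP; exists (2 ^ logn 2 n); rewrite mulnC divnK // pfactor_dvdnn. Qed.

Lemma n1_gt0 : 0 < n1. Proof. exact: dvdn_gt0 n0 n1_dvd. Qed.

Lemma n1_odd : odd n1.
Proof.
have [r cop E] := pfactor_coprime (isT : prime 2) n0.
by rewrite {1}E mulnK ?expn_gt0 // -coprime2n.
Qed.

Lemma n_split : n = 2 ^ logn 2 n * n1.
Proof. by rewrite mulnC divnK // pfactor_dvdnn. Qed.

(** By [lucas_n_odd] the missing primitive divisor of [u_6] cannot interfere for [k = 2] and
    [k = 4]. *)
Lemma exc_k : exc -> 5 < k.
Proof.
case/andP=> /eqP P3 n3; rewrite ltnNge; apply/negP=> k5.
have Po : odd P by rewrite P3.
have [_ /negP] := lucas_n_odd Po (leq_ltn_trans k5 (isT : 5 < 6)).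
by case; apply: dvdn_trans n3 n1_dvd.
Qed.

(** Since [0 < k < n], [n] does not divide [k]. The prime 2 is ruled out by [logn2_k]. *)
Lemma exists_excess_prime : exists q,
  [/\ prime q, odd q, logn q k < logn q n &
    forall r, prime r -> logn r k < logn r n -> q <= r].
Proof.
have ex : exists q, prime q && (logn q k < logn q n).
  have [/hasP[q]|/hasPn H] := boolP (has (fun q => logn q k < logn q n) (primes n)).
    by rewrite mem_primes => /and3P[q_pr _ _] lt; exists q; rewrite q_pr.
  suff /(dvdn_leq k0) : n %| k by lia.
  apply/dvdn_partP => // p pn; rewrite p_part pfactor_dvdn //; last first.
    by move: pn; rewrite mem_primes => /and3P[].
  by rewrite leqNgt H.
case: (ex_minnP ex) => q /andP[q_pr lt] mini; exists q; split=> //.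
  by case: (even_prime q_pr) => // q2; move: lt; rewrite q2 logn2_k ltnn.
by move=> r r_pr ltr; apply: mini; rewrite r_pr.
Qed.

Lemma excess_dvd_n1 q : prime q -> odd q -> logn q k < logn q n -> q %| n1.
Proof.
move=> q_pr qo lt; have : q %| n.
  have : 0 < logn q n by lia.
  by rewrite logn_gt0 mem_primes => /and3P[].
by rewrite {1}n_split Gauss_dvdr // coprimeXr // coprimen2.
Qed.

(** At most half of the divisors of [n1] are below its square root, and at least half are multiples
    of [q], each of which brings a factor [q] to [u_m] unless it is the exceptional 3. The successor
    counts the divisor 1, which is small but divides [k]. *)
Lemma small_divisors_le q : prime q -> odd q -> logn q k < logn q n ->
  (count (fun e => (e * e < n1) && ~~ (e %| k)) (divisors n1)).+1
    <= logn q k + logn q (u (lrank q)) + exc.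
Proof.
move=> q_pr qo lt; have qn := excess_dvd_n1 q_pr qo lt; have n10 := n1_gt0.
have n1g1 : 1 < n1 by apply: leq_trans (prime_gt1 q_pr) _; apply: dvdn_leq.
(* [3 * exc] is 3 in the exceptional case and otherwise 0, which is no divisor of [n1]. *)
pose E := [seq e <- divisors n1 | (q %| e) && (e != 3 * exc)].
have sE : size E <= logn q k + logn q (u (lrank q)).
  apply: leq_trans (logn_lucas_m_le q_pr qo lt).
  apply: prime_count_le; rewrite ?filter_uniq ?divisors_uniq // => e.
  rewrite mem_filter -dvdn_divisors // => /andP[/andP[qe e3] en1]; split=> //; last first.
    exact: dvdn_trans en1 n1_dvd.
  rewrite /has_primitive.
  have -> : odd e by case/dvdnP: en1 n1_odd => a ->; rewrite oddM => /andP[].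
  have e0 := dvdn_gt0 n10 en1.
  have e1 : 1 < e by apply: leq_trans (prime_gt1 q_pr) _; apply: dvdn_leq.
  rewrite e1 /=; apply/negP=> /andP[P3 /eqP E3].
  by move: e3 en1; rewrite E3 P3 => + en1; rewrite en1 muln1 eqxx.
have uD := divisors_uniq n1.
have cE : count (fun e => q %| e) (divisors n1) <= size E + exc.
  have -> : count (fun e => q %| e) (divisors n1) = size E +
      count (fun e => (q %| e) && (e == 3 * exc)) (divisors n1).
    rewrite size_filter; elim: (divisors n1) => //= e D ->.
    by case: (q %| e); case: (e == _) => /=; lia.
  rewrite leq_add2l; apply: (@leq_trans (count_mem (3 * exc) (divisors n1))).
    by apply: sub_count => e /andP[].
  rewrite count_uniq_mem // -dvdn_divisors //.
  by case: exc => //=; rewrite ?leq_b1 // muln0 dvd0n eqn0Ngt n10.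
have c1 : (count (fun e => (e * e < n1) && ~~ (e %| k)) (divisors n1)).+1 <=
    count (fun e => e * e < n1) (divisors n1).
  have -> : count (fun e => e * e < n1) (divisors n1) =
      count (fun e => (e * e < n1) && ~~ (e %| k)) (divisors n1) +
      count (fun e => (e * e < n1) && (e %| k)) (divisors n1).
    elim: (divisors n1) => //= e D ->.
    by case: (e * e < n1); case: (e %| k) => /=; lia.
  rewrite -addn1 leq_add2l -has_count; apply/hasP; exists 1.
    by rewrite -dvdn_divisors // dvd1n.
  by rewrite dvd1n andbT muln1.
have c2 := count_small_divisors n10; have c3 := count_dvd_divisors q_pr qn n10.
have bc := leq_trans c2 c3; rewrite leq_pmul2l // in bc.
by apply: leq_trans c1 (leq_trans bc (leq_trans cE _)); rewrite leq_add2r.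
Qed.

(** Different divisors give primitive primes of different rank; only 1 and 3 may have none. *)
Lemma size_divisors_le : size (divisors n1) <= s' + 2.
Proof.
have n10 := n1_gt0; pose E := [seq e <- divisors n1 | has_primitive e].
have uE : uniq E by rewrite filter_uniq ?divisors_uniq.
have aE : all has_primitive E by apply: filter_all.
have [L [uL sL HL]] := primitive_primes uE aE.
have LE : size L <= s'.
  apply: uniq_leq_size => // p pL; have [p_pr po [e eE pz]] := HL p pL.
  move: eE; rewrite mem_filter -dvdn_divisors // => /andP[/and3P[eo _ _] en].
  rewrite mem_filter po mem_primes p_pr un0 /= dvdn_lucasE // pz.
  by rewrite Gauss_dvd ?coprime2n // (dvdn_trans en n1_dvd) dvdn2 n_even.
apply: leq_trans (_ : size E + 2 <= _); last by rewrite leq_add2r -sL.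
have sub : size [seq e <- divisors n1 | ~~ has_primitive e] <= size [:: 1; 3].
  apply: uniq_leq_size; first by rewrite filter_uniq ?divisors_uniq.
  move=> e; rewrite mem_filter -dvdn_divisors // => /andP[ne en].
  have e0 := dvdn_gt0 n10 en; move: ne; rewrite /has_primitive !inE.
  have -> : odd e by case/dvdnP: en n1_odd => a ->; rewrite oddM => /andP[].
  by case: e e0 en => [|[|[|[|e]]]] //=; rewrite andbF.
by rewrite -(count_predC has_primitive) -!size_filter leq_add2l.
Qed.

(** The 2-part of [n] is that of [k], so [m < n <= k n1], while [two_pow_le] makes [m] large. *)
Lemma n1_ge : 2 ^ s' <= P.+1 * k * n1.
Proof.
apply: leq_trans two_pow_le _; rewrite -mulnA leq_mul2l; apply/orP; right.
apply: (@leq_trans m); first by apply: dvdn_leq => //; exact: pfactor_dvdnn.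
apply: leq_trans (ltnW mn) _; rewrite {1}n_split leq_mul2r; apply/orP; right.
by rewrite logn2_k; apply: dvdn_leq => //; exact: pfactor_dvdnn.
Qed.

Lemma excess_part_le q : prime q -> odd q -> 2 * q ^ logn q k <= k.
Proof.
move=> q_pr qo; apply: dvdn_leq => //.
rewrite Gauss_dvd ?coprime2n ?oddX ?qo ?orbT // pfactor_dvdnn andbT.
by rewrite dvdn2 even_k.
Qed.

End EvenIndex.

(** * Sums over distinct indices, harmonic sums, and numerical logarithms *)

Section Sums.
Local Open Scope ring_scope.
Variable R : realType.
Implicit Types (F : nat -> R) (J L : seq nat).

Lemma sum_antitone_le F J : uniq J -> all (leq 1) J ->
  (forall i j, (0 < i)%N -> (i <= j)%N -> F j <= F i) ->
  \sum_(j <- J) F j <= \sum_(1 <= i < (size J).+1) F i.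
Proof.
move=> uJ J1 aF; move Es : (size J) => s; elim: s J Es uJ J1 => [|s IH] J Es uJ J1.
  by rewrite (size0nil Es) !big_nil.
have [/hasP[x xJ xs]|/hasPn H] := boolP (has (leq s.+1) J); last first.
  have : (size J <= size (iota 1 s))%N.
    apply: uniq_leq_size => // x xJ; rewrite mem_iota (allP J1 _ xJ) /= add1n ltnS.
    by have := H _ xJ; rewrite -ltnNge ltnS.
  by rewrite size_iota Es ltnn.
rewrite (perm_big _ (perm_to_rem xJ)) big_cons /= big_nat_recr //= addrC.
apply: lerD; last by apply: aF.
apply: IH; first by rewrite size_rem // Es.
  exact: rem_uniq.
by apply/allP=> y /mem_rem /(allP J1).
Qed.

(** For primes in residue classes, [idx] numbers the multiples of the modulus. With at most [W]
    primes, the worst case is that they have the indices [1 .. W]. *)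
Lemma sum_index_le (f : nat -> R) F (idx : nat -> nat) L W : uniq L ->
  {in L &, injective idx} -> (forall p, p \in L -> (0 < idx p)%N /\ f p <= F (idx p)) ->
  (forall i j, (0 < i)%N -> (i <= j)%N -> F j <= F i) -> (forall i, (0 < i)%N -> 0 <= F i) ->
  (size L <= W)%N ->
  \sum_(p <- L) f p <= \sum_(1 <= i < W.+1) F i.
Proof.
move=> uL inj H aF F0 sW.
apply: (le_trans (y := \sum_(j <- map idx L) F j)).
  by rewrite big_map big_seq [leRHS]big_seq; apply: ler_sum => p /H[].
apply: le_trans (sum_antitone_le _ _ aF) _.
- by rewrite map_inj_in_uniq.
- by apply/allP=> _ /mapP[p pL ->]; have [] := H p pL.
rewrite size_map [leRHS](big_cat_nat _ (n := (size L).+1)) //= lerDl.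
by rewrite big_nat_cond; apply: sumr_ge0 => i /andP[/andP[h _] _]; apply: F0; lia.
Qed.

Definition harmonic_sum w : R := \sum_(1 <= i < w.+1) i%:R^-1.

Lemma harmonic_sumS w : harmonic_sum w.+1 = harmonic_sum w + w.+1%:R^-1.
Proof. by rewrite /harmonic_sum big_nat_recr. Qed.

Lemma ln_succ_ge w : (0 < w)%N -> w.+1%:R^-1 <= ln w.+1%:R - ln w%:R :> R.
Proof.
move=> w0; have w0R : 0 < w%:R :> R by rewrite ltr0n.
rewrite -ln_div ?posrE ?ltr0n //.
have -> : w.+1%:R^-1 = 1 - (w.+1%:R / w%:R)^-1 :> R.
  by rewrite invf_div -natr1; field; do ?[apply/andP; split]; apply/eqP; lra.
by apply: ln_ge_1subV; rewrite divr_gt0 ?ltr0n.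
Qed.

Lemma harmonic_sum_le w : (0 < w)%N -> harmonic_sum w <= 1 + ln w%:R.
Proof.
elim: w => // [[|w] IH] _; first by rewrite /harmonic_sum big_nat1 ln1 invr1 addr0.
rewrite harmonic_sumS; have := IH isT; have := @ln_succ_ge w.+1 isT.
by move: (ln _) (ln _) (harmonic_sum _) (_^-1) => a b c d; lra.
Qed.

Lemma ln_sqr_le (a b : R) : 0 < a -> a * a <= b -> 2 * ln a <= ln b.
Proof.
move=> a0 ab; have -> : 2 * ln a = ln (a * a) by rewrite lnM ?posrE //; ring.
by apply: ler_lnn => //; apply: mulr_gt0.
Qed.

Lemma ln_sqr_ge (a b : R) : 0 < b -> b <= a * a -> 0 < a -> ln b <= 2 * ln a.
Proof.
move=> b0 ab a0; have -> : 2 * ln a = ln (a * a) by rewrite lnM ?posrE //; ring.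
exact: ler_lnn.
Qed.

(** The arguments are rational lower approximations of [3^(1/128), 3^(1/64), ..., 3^(1/2)], the
    square of each being at most the next. *)
Lemma ln3_ge : 109 / 100 <= ln 3 :> R.
Proof.
have chain (a b c d e f g h x : R) : x <= a -> 2 * a <= b -> 2 * b <= c -> 2 * c <= d ->
  2 * d <= e -> 2 * e <= f -> 2 * f <= g -> 2 * g <= h -> 128 * x <= h by lra.
have h1 : 2 * ln (1 + 43 / 5000) <= ln (1 + 1728 / 1000 / 100) :> R by apply: ln_sqr_le; clear; lra.
have h2 : 2 * ln (1 + 1728 / 1000 / 100) <= ln (1 + 3486 / 1000 / 100) :> R by apply: ln_sqr_le; clear; lra.
have h3 : 2 * ln (1 + 3486 / 1000 / 100) <= ln (1 + 71 / 1000) :> R by apply: ln_sqr_le; clear; lra.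
have h4 : 2 * ln (1 + 71 / 1000) <= ln (1 + 1471 / 100 / 100) :> R by apply: ln_sqr_le; clear; lra.
have h5 : 2 * ln (1 + 1471 / 100 / 100) <= ln (1 + 3159 / 100 / 100) :> R by apply: ln_sqr_le; clear; lra.
have h6 : 2 * ln (1 + 3159 / 100 / 100) <= ln (1 + 1829 / 2500) :> R by apply: ln_sqr_le; clear; lra.
have h7 : 2 * ln (1 + 1829 / 2500) <= ln 3 :> R by apply: ln_sqr_le; clear; lra.
have h0 : 1 - (1 + 43 / 5000)^-1 <= ln (1 + 43 / 5000) :> R by apply: ln_ge_1subV; clear; lra.
have hi : (1 + 43 / 5000)^-1 * (1 + 43 / 5000) = 1 :> R by apply: mulVf; apply/eqP; clear; lra.
apply: le_trans (chain _ _ _ _ _ _ _ _ _ h0 h1 h2 h3 h4 h5 h6 h7); move: hi; clear.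
by move: (_^-1) => z; lra.
Qed.

Lemma ln2_le : ln 2 <= 7 / 10 :> R.
Proof.
have chain (a b c d e f g x : R) : f <= x -> a <= 2 * b -> b <= 2 * c -> c <= 2 * d ->
  d <= 2 * e -> e <= 2 * g -> g <= 2 * f -> a <= 64 * x by lra.
(* These are upper approximations of [2^(1/2), 2^(1/4), ..., 2^(1/64)]. *)
have h1 : ln 2 <= 2 * ln (1 + 4143 / 100 / 100) :> R by apply: ln_sqr_ge; clear; lra.
have h2 : ln (1 + 4143 / 100 / 100) <= 2 * ln (1 + 757 / 4000) :> R by apply: ln_sqr_ge; clear; lra.
have h3 : ln (1 + 757 / 4000) <= 2 * ln (1 + 4527 / 100 / 500) :> R by apply: ln_sqr_ge; clear; lra.
have h4 : ln (1 + 4527 / 100 / 500) <= 2 * ln (1 + 443 / 100 / 100) :> R by apply: ln_sqr_ge; clear; lra.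
have h5 : ln (1 + 443 / 100 / 100) <= 2 * ln (1 + 2191 / 1000 / 100) :> R by apply: ln_sqr_ge; clear; lra.
have h6 : ln (1 + 2191 / 1000 / 100) <= 2 * ln (1 + 109 / 100 / 100) :> R by apply: ln_sqr_ge; clear; lra.
have h0 : ln (1 + 109 / 100 / 100) <= 109 / 100 / 100 :> R.
  by apply: le_trans (ln_le_sub1 _) _; clear; lra.
by apply: le_trans (chain _ _ _ _ _ _ _ _ h0 h1 h2 h3 h4 h5 h6) _; clear; lra.
Qed.

Lemma ln_pow_ge (a i j : nat) : (0 < a)%N -> (0 < i)%N -> (3 ^ j <= a ^ i)%N ->
  j%:R * (109 / 100) <= i%:R * ln a%:R :> R.
Proof.
move=> a0 i0 h; have := @ler_lnn R (3 ^ j)%:R (a ^ i)%:R.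
rewrite ltr0n expn_gt0 ler_nat => /(_ isT h).
rewrite !natrX !lnXn ?ltr0n // => le; rewrite (mulr_natl (ln a%:R) i); apply: le_trans le.
by rewrite -(mulr_natl (ln 3) j) ler_wpM2l // ln3_ge.
Qed.

(* Pairs [2 e i - 2, 2 e i]: the correction to the harmonic sum telescopes. *)
Lemma sum_pairs_le (e w : nat) : (2 < e)%N -> (0 < w)%N ->
  \sum_(1 <= i < w.+1) (2 * e%:R * i%:R - 2)^-1 + \sum_(1 <= i < w.+1) (2 * e%:R * i%:R)^-1
  <= (harmonic_sum w + (9 / 8 - 2^-1 / (w%:R + 3^-1)) / e%:R) / e%:R :> R.
Proof.
move=> e2; have e3 : 3 <= e%:R :> R by rewrite (ler_nat _ 3).
have e0 : e%:R != 0 :> R by apply/eqP; lra.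
elim: w => // [[|w] IH] _.
  rewrite /harmonic_sum !big_nat1 invr1.
  set x : R := e%:R; rewrite -/x in e3 e0.
  have -> : (2 * x * 1 - 2)^-1 = (x - 1)^-1 / 2.
    by field; apply/andP; split; apply/eqP; lra.
  have h : (x - 1)^-1 <= x^-1 + 3 / 2 / x / x.
    rewrite -subr_ge0; have -> : x^-1 + 3 / 2 / x / x - (x - 1)^-1 = (x - 3) / (2 * x * x * (x - 1)).
      by field; do ?[apply/andP; split]; apply/eqP; lra.
    by rewrite divr_ge0 ?mulr_ge0 //; lra.
  have -> : (1 + (9 / 8 - 2^-1 / (1 + 3^-1)) / x) / x = x^-1 + 3 / 4 / x / x.
    by field.
  have -> : (2 * x * 1)^-1 = x^-1 / 2 by field.
  lra.
have {}IH := IH isT.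
rewrite !(big_nat_recr w.+2) //= harmonic_sumS.
move: IH; set A := \sum_(1 <= i < w.+2) _; set B := \sum_(1 <= i < w.+2) _.
have -> : w.+2%:R = w.+1%:R + 1 :> R by rewrite natr1.
have y1 : 1 <= w.+1%:R :> R by rewrite (ler_nat _ 1).
move: A B e3 e0 (harmonic_sum _) y1; move: (e%:R) (w.+1%:R) => x y A B e3 e0 H y1 IH.
have key : (2 * x * (y + 1) - 2)^-1 + (2 * x * (y + 1))^-1 <=
  ((y + 1)^-1 + (2^-1 / (y + 3^-1) - 2^-1 / (y + 1 + 3^-1)) / x) / x.
  have d1 : 0 < x * (y + 1) - 1 by nra.
  have -> : (2 * x * (y + 1) - 2)^-1 + (2 * x * (y + 1))^-1 =
    (y + 1)^-1 / x + (2 * x * (y + 1) * (x * (y + 1) - 1))^-1.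
    by field; do ?[apply/andP; split]; apply/eqP; nra.
  have -> : ((y + 1)^-1 + (2^-1 / (y + 3^-1) - 2^-1 / (y + 1 + 3^-1)) / x) / x =
    (y + 1)^-1 / x + (2 * x * x * (y + 3^-1) * (y + 1 + 3^-1))^-1.
    by field; do ?[apply/andP; split]; apply/eqP; nra.
  rewrite lerD2l lef_pV2 ?posrE; first last.
  - by rewrite !mulr_gt0 //; lra.
  - by rewrite !mulr_gt0 //; lra.
  have -> : 2 * x * x * (y + 3^-1) * (y + 1 + 3^-1) = 2 * x * (x * ((y + 3^-1) * (y + 1 + 3^-1))) by ring.
  have -> : 2 * x * (y + 1) * (x * (y + 1) - 1) = 2 * x * ((y + 1) * (x * (y + 1) - 1)) by ring.
  rewrite ler_wpM2l; [|lra|]; nra.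
apply: (le_trans (y := (A + B) + ((2 * x * (y + 1) - 2)^-1 + (2 * x * (y + 1))^-1))); first lra.
by apply: le_trans (lerD IH key) _; rewrite -mulrDl ler_wpM2r ?invr_ge0; lra.
Qed.

End Sums.

Lemma prod_primes_dvd L N : uniq L -> (forall p, p \in L -> prime p /\ p %| N) ->
  \prod_(p <- L) p %| N.
Proof.
elim: L N => [|p L IH] N /=; first by rewrite big_nil dvd1n.
case/andP=> pL uL H; have [p_pr pN] := H p (mem_head _ _).
have HL r : r \in L -> prime r /\ r %| N by move=> rL; apply: H; rewrite inE rL orbT.
rewrite big_cons Gauss_dvd ?pN ?IH //.
rewrite prime_coprime // Euclid_dvd_prod // big_has; apply/negP=> /hasP[r /= rL].
rewrite dvdn_prime2 //; last by have [] := HL r rL.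
by move/eqP=> e; rewrite e rL in pL.
Qed.

Lemma count_large_primes P L N W : uniq L -> 0 < N -> N < P.+1 ^ W ->
  (forall p, p \in L -> [/\ prime p, P < p & p %| N]) -> size L < W.
Proof.
move=> uL N0 lt H; have d : \prod_(p <- L) p %| N.
  by apply: prod_primes_dvd => // p /H[].
have le : P.+1 ^ size L <= \prod_(p <- L) p.
  elim: L H {uL d} => [|p L IH] H; first by rewrite big_nil.
  rewrite big_cons expnS leq_mul //; first by have [] := H p (mem_head _ _).
  by apply: IH => r rL; apply: H; rewrite inE rL orbT.
have := leq_ltn_trans (leq_trans le (dvdn_leq N0 d)) lt.
by case: (ltnP (size L) W) => // Ws; rewrite ltnNge leq_pexp2l.
Qed.

(** * Logarithms of Euler products *)

Section LogRatio.
Local Open Scope ring_scope.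
Variable R : realType.

Definition log_ratio (L : seq nat) : R := \sum_(p <- L) (ln p%:R - ln p.-1%:R).

Lemma log_ratioE L : all (leq 2) L ->
  ln (\prod_(p <- L) p)%N%:R - ln (\prod_(p <- L) p.-1)%N%:R = log_ratio L.
Proof.
rewrite /log_ratio; elim: L => [|p L IH] /=; first by rewrite !big_nil subrr.
case/andP=> p2 al; rewrite !big_cons -(IH al) !natrM !lnM ?posrE ?ltr0n; first ring.
- by rewrite -ltnS prednK // ltnW.
- exact: prod_pred_gt0.
- exact: ltnW.
- by apply: prod_gt0; apply: sub_all al => j; exact: ltnW.
Qed.

Lemma log_ratio1_le p : (1 < p)%N -> ln p%:R - ln p.-1%:R <= p.-1%:R^-1 :> R.
Proof.
move=> p1; have p0 : 0 < p.-1%:R :> R by rewrite ltr0n; lia.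
have pp : p%:R = p.-1%:R + 1 :> R by rewrite natr1 prednK // ltnW.
rewrite -ln_div ?posrE ?ltr0n ?(ltnW p1) //; last by rewrite -(ltr0n R).
apply: le_trans (ln_le_sub1 _) _; first by rewrite divr_gt0 // pp; lra.
by rewrite pp mulrDl mulfV ?gt_eqF // addrC addKr mul1r.
Qed.

Lemma pair_term_le (x p : R) : 3 <= x -> 2 * x <= p + 2 -> p^-1 <= (2 * x - 2)^-1.
Proof. by move=> x3 h; rewrite lef_pV2 ?posrE; lra. Qed.

Lemma pair_term_anti (x y : R) : 3 <= x -> x <= y -> (2 * y - 2)^-1 <= (2 * x - 2)^-1.
Proof. by move=> x3 h; rewrite lef_pV2 ?posrE; lra. Qed.

Lemma double_term_anti (x y : R) : 3 <= x -> x <= y -> (2 * y)^-1 <= (2 * x)^-1.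
Proof. by move=> x3 h; rewrite lef_pV2 ?posrE; lra. Qed.

(** The constant is what [e = 3] requires: [1 + 1/2 + 9/24 = 1.875 = 1.09 + 0.785], with 1.09 the
    lower bound for [ln 3]. The term [9/8] over [e] then absorbs the difference between the
    increments of the harmonic sum and of the logarithm. *)
Lemma sum_pairs_ln (e : nat) : (2 < e)%N ->
  \sum_(1 <= i < e) (2 * e%:R * i%:R - 2)^-1 + \sum_(1 <= i < e) (2 * e%:R * i%:R)^-1
  <= (ln e%:R + 785 / 1000) / e%:R :> R.
Proof.
move=> e2; have e3 : 3 <= e%:R :> R by rewrite (ler_nat _ 3).
have Ee : e = e.-1.+1 by lia.
have := @sum_pairs_le R e e.-1 e2; rewrite -Ee => /(_ _)/le_trans; apply; first lia.
rewrite ler_wpM2r ?invr_ge0 ?ler0n //.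
have pos : 0 <= 2^-1 / (e.-1%:R + 3^-1) / e%:R :> R.
  by rewrite !divr_ge0 ?addr_ge0 ?invr_ge0 ?ler0n //; lra.
suff : harmonic_sum R e.-1 + 9 / 8 / e%:R <= ln e%:R + 785 / 1000.
  by rewrite mulrBl; lra.
have -> : e = (e - 3).+3 by lia.
elim: (e - 3)%N => [|j IH] /=.
  rewrite /harmonic_sum big_nat_recr // big_nat1 /= invr1.
  by have := ln3_ge R; lra.
rewrite harmonic_sumS; have := @ln_succ_ge R j.+3 isT.
rewrite -[j.+4%:R]natr1 /= in IH *; have x3 : 3 <= j.+3%:R :> R by rewrite (ler_nat _ 3).
move: IH x3; move: (j.+3%:R : R) => x IH x3 h.
have : x^-1 - (x + 1)^-1 - 9 / 8 * (x^-1 - (x + 1)^-1) <= 0.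
  have : (x + 1)^-1 <= x^-1 by rewrite lef_pV2 ?posrE; lra.
  lra.
lra.
Qed.

End LogRatio.

(** * Sum of [1 / (p - 1)] over the primes whose rank does not divide [k] *)

Section EvenSum.
Variable P : nat.
Hypothesis hP : 2 < P.
Local Notation u := (lucas P).
Local Notation v := (companion P).
Local Notation lrank := (lrank P).
Variables (n m : nat).
Hypotheses (m1 : 1 < m) (mn : m < n) (Ephi : totient (u n) = u m) (n_even : ~~ odd n).
Local Notation k := (n - m).
Local Notation a := (logn 2 n).
Local Notation n1 := (n %/ 2 ^ logn 2 n).
Variable R : realType.

(** [P < p] allows counting these primes against powers of [P + 1]; [p] not dividing [u_k] means
    that the rank does not divide [k]. *)
Let L3 := [seq p <- primes (u n) | [&& odd p, P < p & ~~ (p %| u k)]].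
Let odd_part p := lrank p %/ 2 ^ logn 2 (lrank p).

Let k0 : 0 < k. Proof. lia. Qed.
Let n0 : 0 < n. Proof. lia. Qed.
Let un0 : 0 < u n. Proof. exact: lucas_gt0. Qed.

Let L3P p : p \in L3 -> [/\ prime p, odd p, P < p, lrank p %| n & ~~ (lrank p %| k)].
Proof.
rewrite mem_filter mem_primes => /andP[/and3P[po Pp nk] /and3P[p_pr _ pn]].
by split=> //; rewrite -dvdn_lucasE.
Qed.

Let rank_split p : lrank p = 2 ^ logn 2 (lrank p) * odd_part p.
Proof. by rewrite /odd_part mulnC divnK // pfactor_dvdnn. Qed.

(** A prime dividing [P^2 + 4] is its own rank. It would divide [n] but not [k], contrary to
    [nondiscr]. *)
Let rank_mod p : p \in L3 -> (lrank p %| p.-1) || (lrank p %| p.+1).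
Proof.
case/L3P=> p_pr po Pp zn nzk; apply: lrank_mod => //; apply/negP=> pD.
have z := lrank_discr hP p_pr po pD; rewrite z in zn nzk.
have lt : logn p k < logn p n.
  have -> : logn p k = 0 by apply: logn_coprime; rewrite prime_coprime.
  by rewrite logn_gt0 mem_primes p_pr n0.
by have := nondiscr hP m1 mn Ephi n_even p_pr po lt; rewrite pD.
Qed.

Let odd_odd_part p : p \in L3 -> odd (odd_part p).
Proof.
case/L3P=> p_pr _ _ _ _; have z0 : 0 < lrank p by have := lrank_gt1 hP p_pr; lia.
have [r cop E] := pfactor_coprime (isT : prime 2) z0.
by rewrite /odd_part {1}E mulnK ?expn_gt0 // -coprime2n.
Qed.

Let rank_two_part p : p \in L3 -> logn 2 (lrank p) <= a.
Proof. by case/L3P=> p_pr _ _ zn _; apply: dvdn_leq_log. Qed.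

Let odd_part_dvd p : p \in L3 -> odd_part p %| n1.
Proof.
move=> pL; have [p_pr _ _ zn _] := L3P pL.
have : odd_part p %| n by apply: dvdn_trans zn; rewrite [X in _ %| X]rank_split dvdn_mull.
have En : n = 2 ^ a * n1 by rewrite mulnC divnK // pfactor_dvdnn.
by rewrite {1}En Gauss_dvdr // coprimeXr // coprimen2 odd_odd_part.
Qed.

(** The 2-part of the rank divides that of [n], which divides [k]; so it is the odd part that fails
    to divide [k]. *)
Let odd_part_ndvd p : p \in L3 -> ~~ (odd_part p %| k).
Proof.
move=> pL; have [p_pr _ _ zn nzk] := L3P pL; apply: contra nzk => ok.
rewrite rank_split Gauss_dvd; last by rewrite coprimeXl // coprime2n odd_odd_part.
rewrite ok andbT; apply: dvdn_trans (_ : 2 ^ a %| k).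
  by rewrite dvdn_exp2l // rank_two_part.
by rewrite (logn2_k hP m1 mn Ephi n_even) pfactor_dvdnn.
Qed.

Let lucas_lt_exp N : 1 < N -> u N < P.+1 ^ N.
Proof.
case: N => [|[|N]] // _; apply: leq_ltn_trans (lucas_exp_le hP N) _.
apply: (@leq_trans (P.+1 ^ N.+1)); last by rewrite leq_pexp2l.
by rewrite expnS ltn_mul2r expn_gt0 ltnSn.
Qed.

Section OddPart.
Variable e : nat.
Hypotheses (e2 : 2 < e) (e_odd : odd e).

(** [LA], [LB] and [LC] hold the primes of rank [e], of rank [2 e], and of rank [2^i e] with
    [i >= 2]. Their conditions have the form produced by two successive splittings with [bigID]. *)
Let LA := [seq p <- L3 | (odd_part p == e) && (logn 2 (lrank p) == 0)].
Let LB := [seq p <- L3 | (odd_part p == e) && (logn 2 (lrank p) != 0) && (logn 2 (lrank p) == 1)].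
Let LC := [seq p <- L3 | (odd_part p == e) && (logn 2 (lrank p) != 0) && (logn 2 (lrank p) != 1)].

Let uL (b : pred nat) : uniq [seq p <- L3 | b p].
Proof. by rewrite !filter_uniq ?primes_uniq. Qed.

Let e3R : (3 <= e%:R :> R)%R. Proof. by rewrite (ler_nat _ 3). Qed.

Let ei_ge3 i : 0 < i -> (3 <= e%:R * i%:R :> R)%R.
Proof.
move=> i0; have i1 : (1 <= i%:R :> R)%R by rewrite (ler_nat _ 1).
by have := ler_pM (ler0n R 3) (ler01) e3R i1; rewrite mulr1.
Qed.

Let ei_mono i j : i <= j -> (e%:R * i%:R <= e%:R * j%:R :> R)%R.
Proof. by move=> ij; rewrite ler_wpM2l ?ler0n // ler_nat. Qed.

Let pred_index d i p : 0 < d -> p = d * i + 1 -> (p.-1 %/ d)%N = i.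
Proof. by move=> d0 ->; rewrite addn1 /= mulKn. Qed.

(** These primes have the form [2 e i + 1] or [2 e i - 1]. For a given [i] only one of the two is 1
    modulo 4, so [i] determines [p]. They exceed [P] and divide [u_e < (P + 1)^e], so there are
    fewer than [e] of them. *)
Let class_odd_sum_le :
  (\sum_(p <- LA) p.-1%:R^-1 <= \sum_(1 <= i < e) (2 * e%:R * i%:R - 2)^-1 :> R)%R.
Proof.
have Ee : e = e.-1.+1 by lia.
have HL p : p \in LA -> [/\ p \in L3, lrank p = e & p %% 4 = 1] /\
   exists i, [/\ 0 < i, (p.+1 %/ (2 * e))%N = i & p = 2 * e * i + 1 \/ p.+1 = 2 * e * i].
  rewrite mem_filter => /andP[/andP[/eqP op /eqP l0] pL].
  have z : lrank p = e by rewrite rank_split l0 op mul1n.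
  have [p_pr po Pp zn _] := L3P pL; have rm := rank_mod pL; rewrite z in rm.
  have p1 := prime_gt1 p_pr; split.
    split=> //; apply: (lucas_odd_prime_mod4 (P := P) p_pr po (n := e)) => //.
    by rewrite dvdn_lucasE // z.
  have c2 : coprime 2 e by rewrite coprime2n.
  have e4 : 2 < 2 * e by lia.
  case/orP: rm => h.
    have : 2 * e %| p.-1 by rewrite Gauss_dvd // h andbT dvdn2; case: (p) po p1 => //= j; rewrite negbK.
    case/dvdnP=> i E; exists i; have Ep : p = 2 * e * i + 1 by rewrite mulnC -E addn1 prednK // ltnW.
    have i0 : 0 < i by case: i E Ep => // _ Ep; move: p1; rewrite Ep muln0.
    split=> //; last by left.
    by rewrite Ep -addn1 -addnA mulnC divnMDl ?divn_small ?addn0 // (ltn_trans _ e4).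
  have : 2 * e %| p.+1 by rewrite Gauss_dvd // h andbT dvdn2 /= po.
  case/dvdnP=> i E; exists i; split; [by case: i E | | by right; rewrite mulnC].
  by rewrite E mulnK // (ltn_trans _ e4).
have -> : (\sum_(1 <= i < e) (2 * e%:R * i%:R - 2)^-1 = \sum_(1 <= i < e.-1.+1) (2 * e%:R * i%:R - 2)^-1 :> R)%R by rewrite -Ee.
apply: (sum_index_le (idx := fun p => (p.+1 %/ (2 * e))%N)).
- exact: uL.
- move=> p p' /HL[[_ _ p4] [i [i0 -> hp]]] /HL[[_ _ p4'] [i' [_ -> hp']]] ii.
  by rewrite -ii in hp'; move: (2 * e * i) hp hp' => w; lia.
- move=> p /HL[[pL _ _] [i [i0 -> hp]]]; split=> //.
  have hR : (2 * (e%:R * i%:R) <= p.-1%:R + 2 :> R)%R.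
    rewrite mulrA -!natrM -(natrD _ _ 2) ler_nat.
    by move: hp; move: (2 * e * i) => w; have [/prime_gt1 p1 _ _ _ _] := L3P pL; lia.
  by rewrite -mulrA; apply: pair_term_le hR; apply: ei_ge3.
- by move=> i j i0 ij; rewrite -!mulrA; apply: pair_term_anti; [exact: ei_ge3 | exact: ei_mono].
- by move=> i i0; have := ei_ge3 i0; rewrite invr_ge0 -mulrA; lra.
rewrite -ltnS -Ee; have ue0 : 0 < u e by apply: lucas_gt0; lia.
apply: (@count_large_primes P _ (u e)) => //; first exact: uL.
  by apply: lucas_lt_exp; exact: ltnW.
move=> p /HL[[pL z _] _]; have [p_pr po Pp _ _] := L3P pL.
by split=> //; rewrite dvdn_lucasE // z.
Qed.

(** Primitive divisors are 1 modulo [2 e], and they divide [v_e < (P + 1)^e], which again leaves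
    fewer than [e]. *)
Let class_twice_odd_sum_le :
  (\sum_(p <- LB) p.-1%:R^-1 <= \sum_(1 <= i < e) (2 * e%:R * i%:R)^-1 :> R)%R.
Proof.
have Ee : e = e.-1.+1 by lia.
have d0 : 0 < 2 * e by lia.
have HL p : p \in LB -> [/\ p \in L3, lrank p = 2 * e & p %| v e] /\
   exists i, 0 < i /\ p = 2 * e * i + 1.
  rewrite mem_filter => /andP[/andP[/andP[/eqP op _] /eqP l1] pL].
  have z : lrank p = 2 * e by rewrite rank_split l1 op.
  have [p_pr po Pp zn _] := L3P pL; have p1 := prime_gt1 p_pr.
  split; first split=> //.
    have : p %| u (2 * e) by rewrite dvdn_lucasE // z.
    rewrite lucas_double Euclid_dvdM // dvdn_lucasE // z => /orP[|//].
    by move/dvdn_leq => h; have := h (ltnW (ltnW e2)); lia.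
  have /dvdnP[i E] := primitive_prime_mod hP p_pr po e_odd z.
  have Ep : p = 2 * e * i + 1 by rewrite mulnC -E addn1 prednK // ltnW.
  exists i; split=> //; by case: i E Ep => // _ Ep; move: p1; rewrite Ep muln0.
have -> : (\sum_(1 <= i < e) (2 * e%:R * i%:R)^-1 = \sum_(1 <= i < e.-1.+1) (2 * e%:R * i%:R)^-1 :> R)%R by rewrite -Ee.
apply: (sum_index_le (idx := fun p => (p.-1 %/ (2 * e))%N)).
- exact: uL.
- move=> p p' /HL[_ [i [i0 Ep]]] /HL[_ [i' [_ Ep']]].
  by rewrite (pred_index d0 Ep) (pred_index d0 Ep') Ep Ep' => ->.
- move=> p /HL[_ [i [i0 Ep]]]; rewrite (pred_index d0 Ep); split=> //.
  by rewrite Ep addn1 /= !natrM lexx.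
- by move=> i j i0 ij; rewrite -!mulrA; apply: double_term_anti; [exact: ei_ge3 | exact: ei_mono].
- by move=> i i0; have := ei_ge3 i0; rewrite invr_ge0 -mulrA; lra.
rewrite -ltnS -Ee; apply: (@count_large_primes P _ (v e)) => //; first exact: uL.
- exact: companion_gt0.
- by apply: companion_exp_lt => //; lia.
by move=> p /HL[[pL z pv] _]; have [p_pr po Pp _ _] := L3P pL.
Qed.

(** Here [p = 4 e i + 1] or [p = 4 e i - 1], and the quotient of [p - 1] by [2 e] is [2 i] or
    [2 i - 1]. Its parity records the sign, so it determines [p]. All these primes divide [u] at the
    index [2^a e], which bounds their number. *)
Let class_mult4_sum_le : 
  (\sum_(p <- LC) p.-1%:R^-1 <= (if (a <= 1)%N then 0 else
     (1 + ln (2 ^ a * e)%:R) / (2 * e%:R)) :> R)%R.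
Proof.
have d0 : 0 < 2 * e by lia.
have HL p : p \in LC -> [/\ p \in L3, 1 < logn 2 (lrank p), lrank p %| 2 ^ a * e &
   exists i, 0 < i /\ (p = 2 * e * (2 * i) + 1 \/ p.+1 = 2 * e * (2 * i))].
  rewrite mem_filter => /andP[/andP[/andP[/eqP op l0] l1] pL].
  have l2 : 1 < logn 2 (lrank p) by move: l0 l1; case: (logn 2 _) => [|[|]].
  have z : lrank p = 2 ^ logn 2 (lrank p) * e by rewrite -op -rank_split.
  have z4 : 2 * e * 2 %| lrank p.
    rewrite z mulnC mulnA dvdn_mul // -[2 * 2]/(2 ^ 2) dvdn_exp2l //.
  have [p_pr po Pp zn _] := L3P pL; have p1 := prime_gt1 p_pr.
  split=> //; first by rewrite z dvdn_mul // dvdn_exp2l // rank_two_part.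
  case/orP: (rank_mod pL) => /(dvdn_trans z4)/dvdnP[i E]; exists i.
    have Ep : p = 2 * e * (2 * i) + 1 by rewrite mulnA mulnC -E addn1 prednK // ltnW.
    split; last by left.
    by case: i E Ep => // _ Ep; move: p1; rewrite Ep !muln0.
  by split; [case: i E | right; rewrite mulnA mulnC].
have idx p i : 0 < i -> p.+1 = 2 * e * (2 * i) -> (p.-1 %/ (2 * e))%N = (2 * i).-1.
  case: i => // i _ E; have -> : p.-1 = (2 * i).+1 * (2 * e) + (2 * e - 2).
    have : p.+1 = 2 * e * (2 * i).+1 + 2 * e by rewrite E; ring.
    rewrite (mulnC (2 * i).+1); move: (2 * e * (2 * i).+1) => w pw; clear - d0 pw; lia.
  by rewrite divnMDl // divn_small ?addn0; lia.
case: ifP => [a1|a2].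
  rewrite big_seq big1 // => p /HL[pL l2 _ _].
  by have := leq_trans l2 (rank_two_part pL); rewrite ltnNge a1.
have W0 : 0 < 2 ^ a * e by rewrite muln_gt0 expn_gt0 /=; lia.
apply: (@le_trans _ _ (\sum_(1 <= i < (2 ^ a * e).+1) (2 * e%:R * i%:R)^-1 : R)%R); last first.
  rewrite (eq_bigr (fun i => i%:R^-1 / (2 * e%:R)))%R; last by move=> i _; rewrite invfM mulrC.
  rewrite -mulr_suml ler_wpM2r ?invr_ge0 ?mulr_ge0 ?ler0n //.
  exact: harmonic_sum_le.
apply: (sum_index_le (idx := fun p => (p.-1 %/ (2 * e))%N)).
- exact: uL.
- move=> p p' /HL[_ _ _ [i [i0 hp]]] /HL[_ _ _ [i' [i'0 hp']]].
  case: hp => Ep; case: hp' => Ep'.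
  + by rewrite (pred_index d0 Ep) (pred_index d0 Ep') Ep Ep' => ->.
  + by rewrite (pred_index d0 Ep) (idx _ _ i'0 Ep'); lia.
  + by rewrite (pred_index d0 Ep') (idx _ _ i0 Ep); lia.
  + rewrite (idx _ _ i0 Ep) (idx _ _ i'0 Ep') => h.
    have ii : i = i' by lia.
    by apply: succn_inj; rewrite Ep Ep' ii.
- move=> p /HL[pL _ _ [i [i0 hp]]]; have [/prime_gt1 p1 _ _ _ _] := L3P pL.
  set j := (p.-1 %/ (2 * e))%N; have j0 : 0 < j.
    by case: hp => Ep; rewrite /j ?(pred_index d0 Ep) ?(idx _ _ i0 Ep); lia.
  split=> //; have : 2 * e * j <= p.-1 by rewrite mulnC leq_trunc_div.
  rewrite -(ler_nat R) !natrM => h.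
  have w0 : (0 < 2 * e%:R * j%:R :> R)%R by have := ei_ge3 j0; rewrite -mulrA; lra.
  by rewrite lef_pV2 ?posrE //; apply: lt_le_trans h.
- by move=> i j i0 ij; rewrite -!mulrA; apply: double_term_anti; [exact: ei_ge3 | exact: ei_mono].
- by move=> i i0; have := ei_ge3 i0; rewrite invr_ge0 -mulrA; lra.
apply: ltnW; apply: (@count_large_primes P _ (u (2 ^ a * e))) => //; first exact: uL.
- exact: lucas_gt0.
- have h2 : 1 < 2 ^ a * e.
    by apply: leq_trans (_ : 1 * e <= _); [lia | rewrite leq_mul2r expn_gt0 orbT].
  exact: lucas_lt_exp.
move=> p /HL[pL _ zd _]; have [p_pr po Pp _ _] := L3P pL.
by split=> //; rewrite dvdn_lucasE.
Qed.

Lemma class_sum_le :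
  (\sum_(p <- L3 | odd_part p == e) p.-1%:R^-1 <=
   (ln e%:R + 785 / 1000) / e%:R +
   (if (a <= 1)%N then 0 else (1 + ln (2 ^ a * e)%:R) / (2 * e%:R)) :> R)%R.
Proof.
have := lerD (lerD class_odd_sum_le class_twice_odd_sum_le) class_mult4_sum_le.
rewrite /LA /LB /LC !big_filter => le.
rewrite (bigID (fun p => logn 2 (lrank p) == 0)) /=.
rewrite [X in (_ + X)%R](bigID (fun p => logn 2 (lrank p) == 1)) /= addrA.
by apply: le_trans le _; rewrite lerD2r sum_pairs_ln.
Qed.

End OddPart.

Local Open Scope ring_scope.
(** Two bounds [(al ln e + c) / e] for a class of ranks. Without ranks divisible by 4 it is
    [sum_pairs_ln]. In general [2^a <= k] adds [(1 + ln k + ln e) / (2 e)], which turns 0.785 into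
    [1.285 + ln k / 2]. *)
Variables (al c : R).
Hypothesis alc : ((a <= 1)%N /\ al = 1 /\ c = 785 / 1000) \/
  (al = 3 / 2 /\ c = 1285 / 1000 + ln k%:R / 2).

Let G (x : R) := (al * ln x + c) / x.

Let lnk0 : 0 <= ln k%:R :> R.
Proof. by apply: ln_ge0; rewrite (ler_nat _ 1). Qed.

Let class_le_G e : (2 < e)%N -> odd e ->
  \sum_(p <- L3 | odd_part p == e) p.-1%:R^-1 <= G e%:R.
Proof.
move=> e2 eo; apply: le_trans (class_sum_le e2 eo) _; rewrite /G.
have e3 : 3 <= e%:R :> R by rewrite (ler_nat _ 3).
have le0 : 0 <= ln e%:R :> R by apply: ln_ge0; lra.
case: alc => [[-> [-> ->]]|[-> ->]]; first by rewrite addr0 mul1r.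
rewrite -subr_ge0; case: ifP => _.
  rewrite addr0 -mulrBl mulr_ge0 ?invr_ge0 ?ler0n //.
  by move: lnk0 le0; move: (ln _) (ln _) => x y; lra.
have le_a : ln (2 ^ a * e)%:R <= ln k%:R + ln e%:R :> R.
  rewrite -lnM ?posrE ?ltr0n //; last by lia.
  apply: ler_lnn; first by rewrite ltr0n muln_gt0 expn_gt0 /=; lia.
  rewrite -natrM ler_nat leq_mul2r; apply/orP; right.
  by rewrite (logn2_k hP m1 mn Ephi n_even); apply: dvdn_leq => //; exact: pfactor_dvdnn.
have e0 : e%:R != 0 :> R by rewrite gt_eqF //; lra.
have -> : (3 / 2 * ln e%:R + (1285 / 1000 + ln k%:R / 2)) / e%:R -
  ((ln e%:R + 785 / 1000) / e%:R + (1 + ln (2 ^ a * e)%:R) / (2 * e%:R)) =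
  (ln k%:R + ln e%:R - ln (2 ^ a * e)%:R) / (2 * e%:R) :> R by field.
by rewrite mulr_ge0 ?invr_ge0 ?mulr_ge0 ?ler0n ?subr_ge0.
Qed.

Let c_ge : 785 / 1000 <= c.
Proof. by have := lnk0; case: alc => [[_ [_ ->]]|[_ ->]] //; lra. Qed.

Let al_ge : 1 <= al.
Proof. by case: alc => [[_ [-> _]]|[-> _]] //; lra. Qed.

(** The derivative has the sign of [al - al ln x - c], and [ln x >= 1] for [x >= 3]. *)
Let G_anti x y : 3 <= x -> x <= y -> G y <= G x.
Proof.
move=> x3 xy; have ag := al_ge; have cg := c_ge; rewrite /G.
have x0 : 0 < x by lra. have y0 : 0 < y by lra.
rewrite ler_pdivrMr // mulrAC ler_pdivlMr //.
have lx : 1 <= ln x by apply: le_trans (ln3_ge1 R) _; apply: ler_lnn => //; lra.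
have ly : ln y <= ln x + (y / x - 1).
  have Ey : y = x * (y / x) by rewrite mulrC divfK // gt_eqF.
  rewrite {1}Ey lnM ?posrE ?divr_gt0 // lerD2l; apply: ln_le_sub1; exact: divr_gt0.
have h1 : x * ln y <= x * ln x + (y - x).
  have := ler_wpM2l (ltW x0) ly; rewrite mulrDr mulrBr mulr1 [x * (y / x)]mulrC divfK //.
  by rewrite gt_eqF.
have h2 : al * (x * ln y) <= al * (x * ln x + (y - x)) by rewrite ler_wpM2l //; lra.
have h3 : al * (y - x) <= al * ln x * (y - x).
  by rewrite ler_wpM2r ?subr_ge0 // ler_peMr //; lra.
have h4 : 0 <= c * (y - x) by rewrite mulr_ge0 ?subr_ge0 //; lra.
have -> : (al * ln y + c) * x = al * (x * ln y) + c * x by ring.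
have -> : (al * ln x + c) * y = al * (x * ln x) + al * ln x * (y - x) + c * x + c * (y - x) by ring.
by move: h2; rewrite mulrDr => h2; lra.
Qed.

Let G_ge0 x : 3 <= x -> 0 <= G x.
Proof.
move=> x3; rewrite /G divr_ge0 //; last lra.
have : 0 <= ln x by apply: ln_ge0; lra.
by have := al_ge; have := c_ge; move: (ln x) => y; nra.
Qed.

Variable q : nat.
Hypotheses (q_pr : prime q) (q_odd : odd q) (q_lt : (logn q k < logn q n)%N).
Hypothesis q_min : forall r, prime r -> (logn r k < logn r n)%N -> (q <= r)%N.

Let Nsmall := count (fun e => (e * e < n1) && ~~ (e %| k))%N (divisors n1).

(** A divisor [e] of [n1] not dividing [k] contains some prime to a higher power than [k], so
    [e >= q]. Classes below the square root of [n1] are few and cost at most [G q] each; the others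
    cost at most [G x]. *)
Lemma large_rank_sum_le (x : nat) : (2 < x)%N -> (x * x <= n1)%N ->
  \sum_(p <- L3) p.-1%:R^-1 <= Nsmall%:R * G q%:R + (size (divisors n1))%:R * G x%:R.
Proof.
move=> x2 xx; have n10 : (0 < n1)%N by exact: (n1_gt0 hP m1 mn Ephi n_even).
pose D := [seq e <- divisors n1 | ~~ (e %| k)%N].
have uD : uniq D by rewrite filter_uniq ?divisors_uniq.
have ED : \sum_(p <- L3) p.-1%:R^-1 =
    \sum_(e <- D) \sum_(p <- L3 | odd_part p == e) p.-1%:R^-1 :> R.
  rewrite (exchange_big_dep xpredT) //= big_seq [RHS]big_seq; apply: eq_bigr => p pL.
  rewrite -big_filter.
  have -> : [seq e <- D | odd_part p == e] = [:: odd_part p].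
    rewrite (eq_filter (a2 := pred1 (odd_part p))); last by move=> z; rewrite /= eq_sym.
    apply: filter_pred1_uniq => //.
    by rewrite mem_filter odd_part_ndvd // -dvdn_divisors // odd_part_dvd.
  by rewrite big_seq1.
have DP e : e \in D -> [/\ odd e, (q <= e)%N & (2 < e)%N].
  rewrite mem_filter -dvdn_divisors // => /andP[nek en].
  have eo : odd e.
    by case/dvdnP: en (n1_odd hP m1 mn Ephi n_even) => w ->; rewrite oddM => /andP[].
  have qe : (q <= e)%N.
    have e0 : (0 < e)%N by case: (e) eo.
    have [/hasP[r]|/hasPn H] := boolP (has (fun r => logn r k < logn r e)%N (primes e)).
      rewrite mem_primes => /and3P[r_pr _ re] lt; apply: leq_trans (dvdn_leq e0 re).
      apply: q_min => //; apply: leq_trans lt _; apply: dvdn_leq_log => //.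
      exact: dvdn_trans en (n1_dvd _).
    case/negP: nek; apply/dvdn_partP => // r rn; rewrite p_part pfactor_dvdn //.
      by rewrite leqNgt H.
    by move: rn; rewrite mem_primes => /and3P[].
  split=> //; apply: leq_trans qe; exact: odd_prime_gt2.
have q3 : (2 < q)%N by exact: odd_prime_gt2.
rewrite ED (bigID (fun e => e * e < n1)%N) /=; apply: lerD.
  rewrite -big_filter -filter_predI.
  apply: (@le_trans _ _ (\sum_(e <- [seq e <- divisors n1 | (e * e < n1) && ~~ (e %| k)]%N) G q%:R)).
    rewrite big_seq [leRHS]big_seq; apply: ler_sum => e.
    rewrite mem_filter => /andP[/andP[_ nek] en].
    have /DP[eo qe e2] : e \in D by rewrite mem_filter nek.
    by apply: le_trans (class_le_G e2 eo) _; apply: G_anti; rewrite ?(ler_nat _ 3) ?ler_nat.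
  by rewrite big_const_seq iter_addr_0 count_predT size_filter mulr_natl.
rewrite -big_filter.
apply: (@le_trans _ _ (\sum_(e <- [seq e <- D | ~~ (e * e < n1)]%N) G x%:R)).
  rewrite big_seq [leRHS]big_seq; apply: ler_sum => e.
  rewrite mem_filter -leqNgt => /andP[le /DP[eo qe e2]].
  apply: le_trans (class_le_G e2 eo) _; apply: G_anti; rewrite ?(ler_nat _ 3) // ler_nat.
  by rewrite leqNgt; apply/negP=> lt; have := leq_ltn_trans (leq_trans xx le) (ltn_mul lt lt); rewrite ltnn.
rewrite big_const_seq iter_addr_0 count_predT -(mulr_natl (G x%:R)) ler_wpM2r ?G_ge0 ?(ler_nat _ 3) // ler_nat.
by rewrite size_filter (leq_trans (count_size _ _)) // size_filter count_size.
Qed.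

End EvenSum.

(** * Upper bound for [ln u_{k+1}] by the primes dividing [u_n] *)

Section LogBound.
Variable P : nat.
Hypothesis hP : 2 < P.
Local Notation u := (lucas P).
Variables (n m : nat).
Hypotheses (m1 : 1 < m) (mn : m < n) (Ephi : totient (u n) = u m) (n_even : ~~ odd n).
Local Notation k := (n - m).
Variable R : realType.
Let un0 : 0 < u n. Proof. by apply: lucas_gt0; lia. Qed.

(** With [prod_odd_le] this bounds the Euler product over the odd primes up to [P] by the square
    root of [P]. *)
Lemma small_primes_count : (2 * size [seq p <- primes (u n) | odd p & p <= P]).+1 <= P.
Proof.
set l := [seq p <- _ | _].
have l_odd : all (fun q => (1 < q) && (q %% 2 == 1)) l.
  apply/allP=> p; rewrite mem_filter mem_primes => /andP[/andP[po _] /and3P[p_pr _ _]].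
  by rewrite prime_gt1 // modn2 po.
have l_so : sorted ltn l by apply: sorted_filter; [exact: ltn_trans | exact: sorted_primes].
have l_le p : p \in l -> p <= P by rewrite mem_filter => /andP[/andP[]].
case/lastP E : l l_odd l_so l_le => [|r p] h1 h2 h3; first by rewrite /= ltnW // ltnW.
rewrite size_rcons; apply: leq_trans (h3 p _); first exact: path_ltn_last_mod h2 h1.
by rewrite mem_rcons mem_head.
Qed.

(** As [k] is even, [P = u_2] divides [u_k]. Primes beyond [P] divide the quotient, which is at most
    [(P + 1)^(k-2)]. *)
Lemma index_primes_count :
  size [seq p <- primes (u n) | [&& odd p, P < p & p %| u k]] <= k - 2.
Proof.
have k2' : 1 < k := k2 hP m1 mn Ephi n_even.
have u2 : u 2 = P by rewrite /lucas; lia.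
have Pu : P %| u k.
  by rewrite -{1}u2; apply: dvdn_lucas; rewrite dvdn2 (even_k hP m1 mn Ephi n_even).
have [w Ew] := dvdnP Pu; have P0 : 0 < P by lia.
have uk0 : 0 < u k by apply: lucas_gt0; lia.
have w0 : 0 < w by move: uk0; rewrite Ew muln_gt0 => /andP[].
have lt : w < P.+1 ^ (k - 2).+1.
  apply: (@leq_ltn_trans (P.+1 ^ (k - 2))); last by rewrite ltn_exp2l //; lia.
  rewrite -(leq_pmul2r P0) -Ew mulnC; have {1}-> : k = (k - 2).+2 by rewrite -addn2 subnK.
  exact: lucas_exp_le.
rewrite -ltnS; apply: (count_large_primes _ w0 lt); first by rewrite filter_uniq ?primes_uniq.
move=> p; rewrite mem_filter mem_primes => /andP[/and3P[_ Pp pk] /and3P[p_pr _ _]].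
split=> //; move: pk; rewrite Ew Euclid_dvdM // => /orP[//|/(dvdn_leq P0)].
by rewrite leqNgt Pp.
Qed.

Local Open Scope ring_scope.

(** The four terms account for the prime 2, the odd primes up to [P], the larger primes dividing
    [u_k], and all others. *)
Lemma ln_lucas_le :
  ln (u k.+1)%:R <= (if (2 %| u n)%N then ln 2 else 0) + ln P%:R / 2 + (k - 2)%:R / P%:R
    + \sum_(p <- [seq p <- primes (u n) | [&& odd p, P < p & ~~ (p %| u k)]%N]) p.-1%:R^-1 :> R.
Proof.
have un0' := un0; have P0n : (0 < P)%N by lia.
have P0 : 0 < P%:R :> R by rewrite ltr0n.
have ge2 := primes_ge2 (u n).
have h1 : ln (u k.+1)%:R <= log_ratio R (primes (u n)).
  rewrite -log_ratioE // lerBrDr -lnM ?posrE ?ltr0n ?prod_pred_gt0 ?lucas_gt0 //.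
  apply: ler_lnn; first by rewrite mulr_gt0 // ltr0n ?prod_pred_gt0 ?lucas_gt0.
  by rewrite -natrM ler_nat lucas_ratio_prod.
apply: le_trans h1 _; rewrite /log_ratio (perm_big _ (perm_primes_odd un0')) big_cat /=.
rewrite -!addrA; apply: lerD.
  by case: ifP => _; rewrite ?big_nil // big_seq1 /= ln1 subr0.
rewrite big_filter (bigID (fun p => p <= P)%N) /=; apply: lerD.
  rewrite -big_filter.
  have cnt := small_primes_count; move: cnt; set l := [seq p <- _ | _] => cnt.
  have l_odd : all (fun q => (1 < q) && (q %% 2 == 1))%N l.
    apply/allP=> p; rewrite mem_filter mem_primes => /andP[/andP[po _] /and3P[p_pr _ _]].
    by rewrite prime_gt1 // modn2 po.
  have l_so : sorted ltn l by apply: sorted_filter; [exact: ltn_trans | exact: sorted_primes].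
  have l2 : all (leq 2) l by apply: sub_all l_odd => q /andP[].
  have S0 := prod_pred_gt0 l2.
  have R0 : (0 < \prod_(q <- l) q)%N by apply: prod_gt0; apply: sub_all l2 => j; exact: ltnW.
  have := prod_odd_le l_so l_odd; rewrite -[\sum_(i <- l) _]/(log_ratio R l) -log_ratioE //.
  move: (\prod_(q <- l) q)%N (\prod_(q <- l) q.-1)%N S0 R0 => A B B0 A0 le.
  have {}le : (A * A <= P * (B * B))%N.
    by rewrite !mulnn; apply: leq_trans le _; rewrite leq_mul2r cnt orbT.
  have := @ler_lnn R (A * A)%:R (P * (B * B))%:R; rewrite ltr0n muln_gt0 A0 ler_nat => /(_ isT le).
  rewrite !natrM !lnM ?posrE ?mulr_gt0 ?ltr0n //.
  by move: (ln _) (ln _) (ln _) => x y z; lra.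
rewrite (bigID (fun p => p %| u k)%N) /=; apply: lerD.
  rewrite -big_filter.
  apply: (@le_trans _ _ (\sum_(p <- [seq p <- primes (u n) | [&& odd p, P < p & p %| u k]%N]) P%:R^-1)).
    have -> : [seq p <- primes (u n) | odd p && ~~ (p <= P)%N && (p %| u k)%N] =
       [seq p <- primes (u n) | [&& odd p, P < p & p %| u k]%N].
      by apply: eq_filter => p; rewrite -ltnNge andbA.
    rewrite big_seq [leRHS]big_seq; apply: ler_sum => p; rewrite mem_filter => /andP[/and3P[_ Pp _] pp].
    have p1 := allP ge2 _ pp; apply: le_trans (log_ratio1_le R p1) _.
    by rewrite lef_pV2 ?posrE ?ltr0n ?ler_nat //; move: Pp p1; clear; case: p => [|[]].
  rewrite big_const_seq iter_addr_0 count_predT -(mulr_natl P%:R^-1) ler_wpM2r ?invr_ge0 ?ler0n // ler_nat.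
  exact: index_primes_count.
rewrite -big_filter.
have -> : [seq p <- primes (u n) | odd p && ~~ (p <= P)%N && ~~ (p %| u k)%N] =
    [seq p <- primes (u n) | [&& odd p, P < p & ~~ (p %| u k)]%N].
  by apply: eq_filter => p; rewrite -ltnNge andbA.
rewrite big_seq [leRHS]big_seq; apply: ler_sum => p; rewrite mem_filter => /andP[_ pp].
by apply: log_ratio1_le; have := allP ge2 _ pp.
Qed.

End LogBound.

(** [3 h + 4] bounds the number of divisors of [n1]. With [ln 2 <= 7/10] and [k <= 2^h],
    [(280 h + 257) / 200] and [(140 h + 157) / 200] bound the numerator of [G] at [2^h] for the two
    choices of [al] and [c]. *)
Lemma tail_bound h : 10 < h ->
  (3 * h + 4) * (280 * h + 257) <= 62 * 2 ^ h /\
  (3 * h + 4) * (140 * h + 157) <= 32 * 2 ^ h.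
Proof.
move=> lt; have -> : h = 11 + (h - 11) by lia.
elim: (h - 11) => [|i [IH1 IH2]]; first by rewrite (expnD 2 5 6) -[2 ^ 5]/32 -[2 ^ 6]/64; lia.
by rewrite (addnS 11 i) (expnS 2); move: (2 ^ _) IH1 IH2 => y; split; nia.
Qed.

Lemma far_tail_bound h : 19 < h -> (3 * h + 4) * (280 * h + 257) <= 2 * 2 ^ h.
Proof.
move=> lt; have -> : h = 20 + (h - 20) by lia.
elim: (h - 20) => [|i IH].
  by rewrite addn0 (expnD 2 10 10); have -> : 2 ^ 10 = 1024 by []; lia.
by rewrite (addnS 20 i) (expnS 2); move: (2 ^ _) IH => y; nia.
Qed.

(** * Numerical contradictions for [k = 2], [k = 4] and [k >= 6] *)

Section Numerics.
Local Open Scope ring_scope.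
Variable R : realType.

(** The cost of [b] rank classes at [G q], with [y = ln q] and [b] the valuation of [u_{z(q)}]. The
    hypothesis on [b y] is [lucas_rank_part_le]; it removes [b], and the result is linear in [L].
    The numbers [r] and [y0] bound [(q + 1) / (4 q)] from above and [ln q] from below. *)
Lemma excess_term_le (L y b al c q r y0 : R) : 0 < q -> 0 < y0 -> y0 <= y -> 0 <= b ->
  4 * (b * y) <= (q + 1) * L -> q + 1 <= 4 * r * q -> 0 <= L -> 0 <= al -> 0 <= c ->
  b * (al * y + c) / q <= L * r * (al + c / y0).
Proof.
move=> q0 y00 yy b0 hb hr L0 al0 c0; rewrite ler_pdivrMr //.
have z0 : 0 <= c / y0 by rewrite divr_ge0 // ltW.
have cz : c = c / y0 * y0 by rewrite divfK // gt_eqF.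
move: (c / y0) z0 cz => z z0 ->.
have h1 : b * (al * y + z * y0) <= b * y * (al + z).
  have : b * (z * y0) <= b * (z * y) by rewrite !ler_wpM2l.
  have -> : b * (al * y + z * y0) = b * al * y + b * (z * y0) by ring.
  have -> : b * y * (al + z) = b * al * y + b * (z * y) by ring.
  by rewrite lerD2l.
apply: le_trans h1 _.
have h2 : b * y <= r * q * L by have := ler_wpM2r L0 hr; lra.
have -> : L * r * (al + z) * q = r * q * L * (al + z) by ring.
by rewrite ler_wpM2r // addr_ge0.
Qed.

(** The values 3, 5 and at least 7 of [q] give [r = 1/3, 3/10, 2/7], and in each case the
    coefficient of [L] on the right is below 1. For 3 and 5 the class saved by [N <= b - 1] is also
    used. The last disjunction separates [P = 3], with [u_n] odd, from [P >= 4]. *)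
Lemma final_k2 (L y b N q lnu c2 lnP t : R) :
  0 <= b -> 0 <= q -> N <= b - 1 -> 4 * (b * y) <= (q + 1) * L ->
  (q = 3 /\ 109 / 100 <= y) \/ (q = 5 /\ 149 / 100 <= y) \/ (7 <= q /\ 19 / 10 <= y) ->
  lnP <= L / 2 ->
  (c2 <= 0 /\ 236 / 100 <= L /\ L - 1 / 10 <= lnu) \/
  (c2 <= 7 / 10 /\ 286 / 100 <= L /\ L - 1 / 17 <= lnu) ->
  t <= 16 / 100 -> lnu <= c2 + lnP / 2 + N * ((1 * y + 785 / 1000) / q) + t -> False.
Proof.
move=> b0 q00 hN hb hq hP hc ht H.
have L0 : 236 / 100 <= L by case: hc => [[_ []]|[_ []]]; clear; lra.
have q0 : 0 < q by case: hq => [[-> _]|[[-> _]|[+ _]]]; clear; lra.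
have y0 : 0 < y by case: hq => [[_ +]|[[_ +]|[_ +]]]; clear; lra.
have G0 : 0 <= (1 * y + 785 / 1000) / q by rewrite divr_ge0 ?ltW //; move: y0; clear; lra.
have H1 : N * ((1 * y + 785 / 1000) / q) <=
    b * (1 * y + 785 / 1000) / q - (1 * y + 785 / 1000) / q.
  by rewrite -[X in _ - X]mul1r -[X in X - _]mulrA -mulrBl ler_wpM2r.
have L00 : 0 <= L by move: L0; clear; lra.
have a0 : 0 <= 1 :> R by clear; lra.
have c0 : 0 <= 785 / 1000 :> R by clear; lra.
case: hq => [[q3 hy]|[[q5 hy]|[q7 hy]]].
- have r : q + 1 <= 4 * 3^-1 * q by move: q3; clear; lra.
  have Y : 0 < 109 / 100 :> R by clear; lra.
  have := excess_term_le q0 Y hy b0 hb r L00 a0 c0.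
  have : 625 / 1000 <= (1 * y + 785 / 1000) / q by rewrite q3; move: hy; clear; lra.
  move: H1 H hP ht hc; clear.
  move: (b * _ / q) ((1 * y + _) / q) (N * _) => A1 A2 A3 H1 H hP ht hc H2 H3.
  by case: hc => [[? []]|[? []]] ? ?; lra.
- have r : q + 1 <= 4 * (3 / 10) * q by move: q5; clear; lra.
  have Y : 0 < 149 / 100 :> R by clear; lra.
  have := excess_term_le q0 Y hy b0 hb r L00 a0 c0.
  have : 455 / 1000 <= (1 * y + 785 / 1000) / q by rewrite q5; move: hy; clear; lra.
  move: H1 H hP ht hc; clear.
  move: (b * _ / q) ((1 * y + _) / q) (N * _) => A1 A2 A3 H1 H hP ht hc H2 H3.
  by case: hc => [[? []]|[? []]] ? ?; lra.
have r : q + 1 <= 4 * (2 / 7) * q by move: q7; clear; lra.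
have Y : 0 < 19 / 10 :> R by clear; lra.
have := excess_term_le q0 Y hy b0 hb r L00 a0 c0.
move: G0 H1 H hP ht hc; clear.
move: (b * _ / q) ((1 * y + _) / q) (N * _) => A1 A2 A3 G0 H1 H hP ht hc H2.
by case: hc => [[? []]|[? []]] ? ?; lra.
Qed.

Lemma final_k4 (L y b N q lnu c2 lnP t d c : R) :
  0 <= b -> 0 <= q -> N <= b - 1 -> 4 * (b * y) <= (q + 1) * L ->
  (q = 3 /\ 109 / 100 <= y) \/ (5 <= q /\ 149 / 100 <= y) ->
  lnP <= L / 2 -> c2 <= 7 / 10 -> 236 / 100 <= L -> 2 * (L - 1 / 10) <= lnu ->
  1285 / 1000 <= c -> c <= 1985 / 1000 -> d <= 2 / 3 ->
  t <= 31 / 100 -> lnu <= c2 + lnP / 2 + d + N * ((3 / 2 * y + c) / q) + t -> False.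
Proof.
move=> b0 q00 hN hb hq hP hc hL hu c1 c2' hd ht H.
have q0 : 0 < q by case: hq => [[-> _]|[+ _]]; clear; lra.
have y0 : 0 < y by case: hq => [[_ +]|[_ +]]; clear; lra.
have G0 : 0 <= (3 / 2 * y + c) / q by rewrite divr_ge0 ?ltW //; move: y0 c1; clear; lra.
have H1 : N * ((3 / 2 * y + c) / q) <= b * (3 / 2 * y + c) / q - (3 / 2 * y + c) / q.
  by rewrite -[X in _ - X]mul1r -[X in X - _]mulrA -mulrBl ler_wpM2r.
have L00 : 0 <= L by move: hL; clear; lra.
have a0 : 0 <= 3 / 2 :> R by clear; lra.
have c0 : 0 <= c by move: c1; clear; lra.
case: hq => [[q3 hy]|[q5 hy]].
- have r : q + 1 <= 4 * 3^-1 * q by move: q3; clear; lra.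
  have Y : 0 < 109 / 100 :> R by clear; lra.
  have := excess_term_le q0 Y hy b0 hb r L00 a0 c0.
  have : 97 / 100 <= (3 / 2 * y + c) / q by rewrite q3; move: hy c1; clear; lra.
  have : L * 3^-1 * (3 / 2 + c / (109 / 100)) <= L * 3^-1 * (3 / 2 + 1985 / 1000 / (109 / 100)).
    by rewrite ler_wpM2l ?mulr_ge0 //; move: c2'; clear; lra.
  move: H1 H hP ht hL hu hc hd; clear.
  move: (b * _ / q) ((3 / 2 * y + _) / q) (N * _) (L * _ * (_ + c / _)) => A1 A2 A3 A4.
  by lra.
have r : q + 1 <= 4 * (3 / 10) * q by move: q5; clear; lra.
have Y : 0 < 149 / 100 :> R by clear; lra.
have := excess_term_le q0 Y hy b0 hb r L00 a0 c0.
have : L * (3 / 10) * (3 / 2 + c / (149 / 100)) <= L * (3 / 10) * (3 / 2 + 1985 / 1000 / (149 / 100)).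
  by rewrite ler_wpM2l ?mulr_ge0 //; move: c2'; clear; lra.
move: G0 H1 H hP ht hL hu hc hd; clear.
move: (b * _ / q) ((3 / 2 * y + _) / q) (N * _) (L * _ * (_ + c / _)) => A1 A2 A3 A4.
by lra.
Qed.

(* [j = k / 2 = exp l] is bounded below by a quadratic polynomial in [l - ln 3]. *)
Lemma final_k6 (L y b N q w lnu c2 lnP t d c j l l3 : R) :
  0 <= b -> 0 <= w -> 3 <= q -> N <= b + w -> 4 * (b * y) <= (q + 1) * L -> w * y <= l ->
  109 / 100 <= y -> lnP <= L / 2 -> c2 <= 7 / 10 -> 236 / 100 <= L ->
  j * (L - 1 / 10) <= lnu -> 0 <= c -> c <= 1635 / 1000 + l / 2 -> d <= (2 * j - 2) / 3 ->
  l3 <= 112 / 100 -> l3 <= l -> 3 * (1 + (l - l3) / 2) ^+ 2 <= j ->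
  t <= 1 / 100 -> lnu <= c2 + lnP / 2 + d + N * ((3 / 2 * y + c) / q) + t -> False.
Proof.
move=> b0 w0 q3 hN hb hw hy hP hc hL hu c0 c1 hd h3 ll hj ht H.
have q0 : 0 < q by move: q3; clear; lra.
have y0 : 0 < y by move: hy; clear; lra.
have G0 : 0 <= (3 / 2 * y + c) / q by rewrite divr_ge0 ?ltW //; move: y0 c0; clear; lra.
have H1 : N * ((3 / 2 * y + c) / q) <= b * (3 / 2 * y + c) / q + w * (3 / 2 * y + c) / q.
  by rewrite -[b * _ / q]mulrA -[w * _ / q]mulrA -mulrDl ler_wpM2r.
have L00 : 0 <= L by move: hL; clear; lra.
have a0 : 0 <= 3 / 2 :> R by clear; lra.
have l0 : 0 <= l by apply: le_trans hw; apply: mulr_ge0 => //; exact: ltW.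
have Y : 0 < 109 / 100 :> R by clear; lra.
have r : q + 1 <= 4 * 3^-1 * q by move: q3; clear; lra.
have H2 := excess_term_le q0 Y hy b0 hb r L00 a0 c0.
have H3 : w * (3 / 2 * y + c) / q <= l * 3^-1 * (3 / 2 + c / (109 / 100)).
  rewrite ler_pdivrMr //.
  have z0 : 0 <= c / (109 / 100) by rewrite divr_ge0 // ltW.
  have cz : c = c / (109 / 100) * (109 / 100) by rewrite divfK // gt_eqF.
  move: (c / (109 / 100)) z0 cz => z z0 cz; rewrite {1}cz.
  have h1 : w * (z * (109 / 100)) <= w * (z * y) by rewrite !ler_wpM2l.
  have h2 : w * y * (3 / 2 + z) <= l * (3 / 2 + z) by rewrite ler_wpM2r //; move: z0; clear; lra.
  have h4 : l * (3 / 2 + z) * 3 <= l * (3 / 2 + z) * q.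
    by rewrite ler_wpM2l // mulr_ge0 //; move: z0; clear; lra.
  by move: h1 h2 h4; clear; lra.
have cz : c / (109 / 100) <= 1635 / 1000 / (109 / 100) + l * (50 / 109) by move: c1; clear; lra.
have H4 : (L + l) * 3^-1 * (3 / 2 + c / (109 / 100)) <=
    (L + l) * 3^-1 * (3 / 2 + (1635 / 1000 / (109 / 100) + l * (50 / 109))).
  by rewrite ler_wpM2l ?mulr_ge0 //; move: L00 l0 cz; clear; lra.
have H5 : j * (L - 1 / 10) - (2 * j - 2) / 3 <= 7 / 10 + L / 4 + 1 / 100 +
    (L + l) * 3^-1 * (3 / 2 + (1635 / 1000 / (109 / 100) + l * (50 / 109))).
  move: H4 H2 H3 H1 H hu hP hc hd ht; clear; rewrite !(mulrDl L l) !(mulrDl (L * 3^-1)).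
  move: (b * _ / q) (w * _ / q) (N * _) => A1 A2 A3; lra.
clear H1 H2 H3 H4 H.
pose s := l - l3; have s0 : 0 <= s by rewrite /s subr_ge0.
have {}hj : 3 + 3 * s + 3 / 4 * (s * s) <= j by move: hj; rewrite -/s expr2; clear; lra.
have hJ : (3 + 3 * s + 3 / 4 * (s * s)) * (L - 23 / 30) <= j * (L - 23 / 30).
  by rewrite ler_wpM2r //; move: hL; clear; lra.
have hl : l <= 112 / 100 + s by move: h3; rewrite /s; clear; lra.
have hll : l * l <= (112 / 100 + s) * (112 / 100 + s) by rewrite ler_pM.
have hLl : L * l <= L * (112 / 100 + s) by rewrite ler_wpM2l.
have hs : 0 <= s * (L - 236 / 100) by rewrite mulr_ge0 // subr_ge0.
have hss : 0 <= s * s * (L - 236 / 100) by rewrite !mulr_ge0 // subr_ge0.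
have hs2 : 0 <= s * s by rewrite mulr_ge0.
move: H5 s0 hJ hl hll hLl hs hss hs2 hL; clear; lra.
Qed.

End Numerics.

Section TailTerm.
Local Open Scope ring_scope.
Variable R : realType.

Lemma ln_exp2_le h : ln (2 ^ h)%N%:R <= h%:R * (7 / 10) :> R.
Proof.
by rewrite natrX lnXn ?ltr0n // -(mulr_natl (ln 2)) ler_wpM2l ?ler0n // ln2_le.
Qed.

Lemma ln3_le : ln 3 <= 112 / 100 :> R.
Proof.
have := @ler_lnn R (3 ^ 5)%N%:R (2 ^ 8)%N%:R; rewrite ltr0n ler_nat => /(_ isT isT).
rewrite !natrX !lnXn ?ltr0n // -(mulr_natl (ln _)) -(mulr_natl (ln 2)).
by have := ln2_le R; lra.
Qed.

(** This is [1 + z <= exp z], squared. A quadratic bound is needed because the right side of the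
    inequality in [final_k6] contains the square of [ln j]. *)
Lemma quadratic_ln_le (x : R) : 3 <= x -> 3 * (1 + (ln x - ln 3) / 2) ^+ 2 <= x.
Proof.
move=> x3; set z := (_ / 2).
have z0 : 0 <= z by rewrite divr_ge0 // subr_ge0 ler_lnn.
have e1 := expR_ge1Dx z.
have e2 : (1 + z) ^+ 2 <= expR z ^+ 2 by rewrite lerXn2r // nnegrE ?expR_ge0 // addr_ge0.
have E : expR z ^+ 2 = x / 3.
  rewrite expr2 -exp.expRD; have -> : z + z = ln x - ln 3 by rewrite /z -splitr.
  by rewrite exp.expRD expRN !lnK // posrE; lra.
by move: e2; rewrite E; lra.
Qed.

Lemma tail_term_le (D h A B T : nat) (al c : R) : (D <= 3 * h + 4)%N ->
  ((3 * h + 4) * (A * h + B) <= T * 2 ^ h)%N -> 0 <= al * ln (2 ^ h)%N%:R + c ->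
  al * ln (2 ^ h)%N%:R + c <= (A%:R * h%:R + B%:R) / 200 ->
  D%:R * ((al * ln (2 ^ h)%N%:R + c) / (2 ^ h)%N%:R) <= T%:R / 200.
Proof.
move=> Dh AB g0 g1; have x0 : 0 < (2 ^ h)%N%:R :> R by rewrite ltr0n expn_gt0.
rewrite mulrA ler_pdivrMr // [leRHS]mulrAC ler_pdivlMr ?ltr0n // -natrM.
apply: le_trans (_ : (3 * h + 4)%N%:R * (A * h + B)%N%:R <= _); last by rewrite -natrM ler_nat.
have g2 : (al * ln (2 ^ h)%N%:R + c) * 200 <= (A * h + B)%N%:R.
  by rewrite -ler_pdivlMr ?ltr0n // natrD natrM.
rewrite -mulrA ler_pM ?ler0n ?ler_nat // mulr_ge0 // ler0n.
Qed.

Let ln_exp2_ge0 h : 0 <= ln (2 ^ h)%N%:R :> R.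
Proof. by rewrite ln_ge0 // ler1n expn_gt0. Qed.

Lemma tail_eq2_le (D h : nat) : (D <= 3 * h + 4)%N ->
  ((3 * h + 4) * (140 * h + 157) <= 32 * 2 ^ h)%N ->
  D%:R * ((1 * ln (2 ^ h)%N%:R + 785 / 1000) / (2 ^ h)%N%:R) <= 16 / 100 :> R.
Proof.
move=> Dh tb; have := ln_exp2_le h; have := ln_exp2_ge0 h => l20 l2.
by apply: le_trans (tail_term_le Dh tb _ _) _; lra.
Qed.

Lemma tail_ge4_le (D h B : nat) (lk : R) : (D <= 3 * h + 4)%N ->
  ((3 * h + 4) * (280 * h + 257) <= B * 2 ^ h)%N -> 0 <= lk -> lk <= ln (2 ^ h)%N%:R ->
  D%:R * ((3 / 2 * ln (2 ^ h)%N%:R + (1285 / 1000 + lk / 2)) / (2 ^ h)%N%:R) <= B%:R / 200.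
Proof.
move=> Dh tb lk0 lkh; have := ln_exp2_le h; have := ln_exp2_ge0 h => l20 l2.
by apply: tail_term_le Dh tb _ _; lra.
Qed.

End TailTerm.

Lemma totient_lt N : 1 < N -> totient N < N.
Proof.
move=> N1; have N0 := ltnW N1; rewrite totient_count_coprime.
rewrite big_ltn // [coprime N 0]/coprime gcdn0 (gtn_eqF N1) add0n.
apply: leq_ltn_trans (_ : \sum_(1 <= d < N) 1 < _); first by apply: leq_sum => d _; case: coprime.
by rewrite sum_nat_const_nat muln1; lia.
Qed.

Lemma lucas_odd_index_ge P j : (P ^ 2 + 1) ^ j <= lucas P (2 * j).+1.
Proof.
elim: j => // j IH; have -> : 2 * j.+1 = (2 * j).+2 by lia.
rewrite lucasSS (lucasSS P (2 * j)) expnS; move: (_ ^ j) IH => y IH.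
have : (P ^ 2 + 1) * y <= (P ^ 2 + 1) * lucas P (2 * j).+1 by rewrite leq_mul2l IH orbT.
by move: (lucas P _) (lucas P _) => a b; rewrite -mulnn; nia.
Qed.

(** * Even [n]: combination of the estimates *)

Section EvenIndexContradiction.
Variable P : nat.
Hypothesis hP : 2 < P.
Local Notation u := (lucas P).
Variables (n m : nat).
Hypotheses (m1 : 1 < m) (mn : m < n) (Ephi : totient (u n) = u m) (n_even : ~~ odd n).
Local Notation k := (n - m).
Local Notation s' := (size [seq p <- primes (u n) | odd p]).
Local Notation h := (s' %/ 3).
Local Notation n1 := (n %/ 2 ^ logn 2 n).

Let k2' : 1 < k. Proof. exact: (k2 hP m1 mn Ephi n_even). Qed.

Lemma card_third : 10 < h /\ s' <= 3 * h + 2.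
Proof.
have [s35 _] := card_odd_primes_ge hP m1 mn Ephi n_even.
have := divn_eq s' 3; have := ltn_pmod s' (isT : 0 < 3).
by move: s35; move: s' (_ %/ 3) (_ %% 3) => x y z; clear; lia.
Qed.

Lemma lucas_sqr_le : u k.+1 * u k.+1 <= 4 * (6 * h + 5).
Proof.
have [_ sh] := card_third; have := even_ratio_sqr hP m1 mn Ephi n_even.
rewrite -mulnn => le; apply: leq_trans le _; apply: leq_mul; first by case: ifP.
by move: sh; clear; lia.
Qed.

Lemma exp_index_le : P.+1 * k <= P ^ k /\ P ^ k <= 2 ^ h.
Proof.
split.
  have := k2'; elim: k => // j IH; rewrite leq_eqVlt => /orP[/eqP <-|lj].
    by rewrite expnS expn1; nia.
  have {}IH := IH lj; rewrite expnS; have : 3 * (P.+1 * j) <= P * P ^ j by apply: leq_mul.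
  have : P.+1 <= P.+1 * j by rewrite leq_pmulr //; lia.
  by rewrite mulnS; lia.
have [h11 _] := card_third; have [t1 _] := tail_bound h11.
have le := lucas_sqr_le; have ge := lucas_exp_ge hP k.
apply: leq_trans ge _; move: t1 le h11; move: (u _) (2 ^ h) (h) => a y z; clear => t1 le z11.
by apply: leq_trans (_ : a * a <= _); [case: (a) => // ?; rewrite leq_pmulr | nia].
Qed.

(** Of [2^s' >= 2^(3h)], one third of the exponent pays for the factor [(P + 1) k <= 2^h] in
    [n1_ge]. The other two thirds make [x = 2^h] admissible in [large_rank_sum_le]. *)
Lemma exp2_sqr_le : 2 ^ h * 2 ^ h <= n1.
Proof.
have [h11 _] := card_third; have [le1 le2] := exp_index_le.
have := n1_ge hP m1 mn Ephi n_even => ge.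
have : 2 ^ (h + h + h) <= 2 ^ s'.
  by rewrite leq_exp2l //; have := divn_eq s' 3; move: (s') (h) (_ %% _); clear; lia.
rewrite !expnD => le3; rewrite -(leq_pmul2r (_ : 0 < 2 ^ h)) ?expn_gt0 //.
apply: leq_trans le3 (leq_trans ge _); rewrite mulnC leq_mul2l; apply/orP; right.
exact: leq_trans le1 le2.
Qed.

Lemma size_divisors_third : size (divisors n1) <= 3 * h + 4.
Proof.
have [_ sh] := card_third; have := size_divisors_le hP m1 mn Ephi n_even.
by move: sh; clear; lia.
Qed.

Local Open Scope ring_scope.
Variable R : realType.
Local Notation L := (ln (P ^ 2 + 2)%N%:R : R).
Local Notation two_term := (if (2 %| u n)%N then ln 2 else 0 : R).

(** The numbers [11 = 3^2 + 2] and [18 = 4^2 + 2] are compared with powers of 3: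
    [13 * 1.09 / 6 >= 2.36] and [21 * 1.09 / 8 >= 2.86]. *)
Lemma ln_sqr2_ge : (236 / 100 <= L) /\ ((3 < P)%N -> 286 / 100 <= L).
Proof.
have aux (a b N : nat) : (0 < N)%N -> (0 < a)%N -> (3 ^ b <= N ^ a)%N -> (N <= P ^ 2 + 2)%N ->
    b%:R * (109 / 100) <= a%:R * L.
  move=> N0 a0 ab NP; apply: le_trans (ln_pow_ge R N0 a0 ab) _.
  by rewrite ler_wpM2l ?ler0n // ler_lnn ?ltr0n ?ler_nat.
split=> [|P4].
  have := @aux 6 13 11; rewrite -mulnn => /(_ isT isT).
  have -> : (3 ^ 13 <= 11 ^ 6)%N by rewrite (expnD 3 7 6) -[(3 ^ 7)%N]/(2187)%N -[(3 ^ 6)%N]/(729)%N (expnD 11 3 3) -[(11 ^ 3)%N]/(1331)%N; lia.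
  by move=> /(_ isT) H; have := H ltac:(nia); lra.
have := @aux 8 21 18; rewrite -mulnn => /(_ isT isT).
have -> : (3 ^ 21 <= 18 ^ 8)%N.
  by rewrite (expnM 3 7 3) -[(3 ^ 7)%N]/(2187)%N (expnM 18 2 4) -[(18 ^ 2)%N]/(324)%N !expnS !expn0; lia.
by move=> /(_ isT) H; have := H ltac:(nia); lra.
Qed.

Lemma ln_P_le : ln P%:R <= L / 2.
Proof.
have : 2 * ln P%:R <= L; last by lra.
apply: ln_sqr_le; first by rewrite ltr0n; lia.
by rewrite -natrM ler_nat -mulnn leq_addr.
Qed.

Lemma ln_sqr1_ge d : (0 < d)%N -> (d <= P ^ 2 + 1)%N -> L - d%:R^-1 <= ln (P ^ 2 + 1)%N%:R.
Proof.
move=> d0 dP; have := @log_ratio1_le R (P ^ 2 + 2) ltac:(lia).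
have -> : (P ^ 2 + 2).-1 = (P ^ 2 + 1)%N by lia.
have : (P ^ 2 + 1)%N%:R^-1 <= d%:R^-1 :> R by rewrite lef_pV2 ?posrE ?ltr0n ?ler_nat //; lia.
by lra.
Qed.

Section ExcessPrime.
Variable q : nat.
Hypotheses (q_pr : prime q) (q_odd : odd q) (q_lt : (logn q k < logn q n)%N).
Local Notation b := (logn q (u (lrank P q))).
Local Notation w := (logn q k).

Lemma ln_rank_part : 4 * (b%:R * ln q%:R) <= (q%:R + 1) * L.
Proof.
have q0 : (0 < q)%N by exact: prime_gt0.
have := lucas_rank_part_le hP q_pr q_odd (nondiscr hP m1 mn Ephi n_even q_pr q_odd q_lt).
move: b => B le; have := @ler_lnn R ((q ^ B) ^ 4)%N%:R ((P ^ 2 + 2) ^ q.+1)%N%:R.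
rewrite ltr0n !expn_gt0 q0 ler_nat => /(_ isT le).
rewrite !natrX !lnXn ?exprn_gt0 ?ltr0n ?addn_gt0 ?orbT // -[ln _ *+ B]mulr_natl -[_ *+ 4]mulr_natl.
by rewrite -[ln _ *+ q.+1]mulr_natl natr1.
Qed.

Lemma ln_index_part j : k = (2 * j)%N -> w%:R * ln q%:R <= ln j%:R :> R.
Proof.
move=> Ej; have q0 : (0 < q)%N by exact: prime_gt0.
have := excess_part_le hP m1 mn Ephi n_even q_pr q_odd; rewrite {2}Ej leq_pmul2l // => le.
have := @ler_lnn R (q ^ w)%N%:R j%:R; rewrite ltr0n expn_gt0 q0 ler_nat => /(_ isT le).
by rewrite natrX lnXn ?ltr0n // mulr_natl.
Qed.

Lemma ln_prime_ge : (q = 3 \/ q = 5 \/ 7 <= q)%N /\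
  [/\ 109 / 100 <= ln q%:R :> R, (5 <= q)%N -> 149 / 100 <= ln q%:R :> R &
    (7 <= q)%N -> 19 / 10 <= ln q%:R :> R].
Proof.
have q3 := odd_prime_gt2 q_odd q_pr.
have aux N : (0 < N)%N -> (N <= q)%N -> ln N%:R <= ln q%:R :> R.
  by move=> N0 Nq; rewrite ler_lnn ?ltr0n ?ler_nat.
split; last split.
- have [lt|ge] := ltnP q 7; last by right; right.
  by move: q3 lt q_odd; case: (q) => [|[|[|[|[|[|[|?]]]]]]] //; [left | right; left].
- by apply: le_trans (ln3_ge R) _; apply: aux.
- move=> q5; apply: le_trans (aux 5%N isT q5).
  have := @ln_pow_ge R 5 11 16 isT isT.
  have -> : (3 ^ 16 <= 5 ^ 11)%N.
    by rewrite (expnM 3 4 4) -[(3 ^ 4)%N]/(81)%N (expnD 5 5 6) (expnD 5 3 3) -[(5 ^ 5)%N]/(3125)%N -[(5 ^ 3)%N]/(125)%N !expnS !expn0; lia.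
  by move=> /(_ isT); lra.
move=> q7; apply: le_trans (aux 7%N isT q7).
have := @ln_pow_ge R 7 4 7 isT isT.
have -> : (3 ^ 7 <= 7 ^ 4)%N by [].
by move=> /(_ isT); lra.
Qed.

End ExcessPrime.

Lemma ln_two_term_le : two_term <= 7 / 10.
Proof. by case: ifP => _; [exact: ln2_le | lra]. Qed.

(** Here 4 does not divide [n], which gives the smaller [al] and [c]; moreover [q] does not divide
    [k] and the exceptional divisor is absent. For [P = 3], where [L] is smallest, [u_n] is odd and
    the term [ln 2] disappears. *)
Lemma index_ne2 : k <> 2%N.
Proof.
move=> k2.
have [q [q_pr q_odd q_lt q_min]] := exists_excess_prime hP m1 mn Ephi n_even.
have alc : ((logn 2 n <= 1)%N /\ (1 : R) = 1 /\ (785 / 1000 : R) = 785 / 1000) \/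
   ((1 : R) = 3 / 2 /\ (785 / 1000 : R) = 1285 / 1000 + ln k%:R / 2).
  by left; rewrite (logn2_k hP m1 mn Ephi n_even) k2.
have [h11 sh] := card_third.
have x2 : (2 < 2 ^ h)%N by apply: (@leq_trans (2 ^ 2)); rewrite ?leq_exp2l //; apply: leq_trans h11.
have S := large_rank_sum_le hP m1 mn Ephi n_even alc q_pr q_odd q_min x2 exp2_sqr_le.
have H := ln_lucas_le hP m1 mn Ephi n_even R.
have [_ tb] := tail_bound h11.
have T := tail_eq2_le R size_divisors_third tb.
have W : logn q k = 0%N.
  apply/eqP; have := excess_part_le hP m1 mn Ephi n_even q_pr q_odd.
  rewrite {2}k2; case: (logn q k) => // w; have := prime_gt1 q_pr; rewrite expnS.
  have : (0 < q ^ w)%N by rewrite expn_gt0 prime_gt0.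
  by clear; nia.
have exc0 : ((P == 3) && (3 %| n1))%N = false.
  by apply/negbTE/negP=> /(exc_k hP m1 mn Ephi n_even); rewrite k2.
have N1 := small_divisors_le hP m1 mn Ephi n_even q_pr q_odd q_lt.
rewrite W exc0 add0n addn0 -(ler_nat R) -natr1 in N1.
have [hq] := ln_prime_ge q_pr q_odd q_lt; case=> y3 y5 y7.
have [L3 L4] := ln_sqr2_ge.
have u3 : u 3 = (P ^ 2 + 1)%N by rewrite /lucas; ring.
have c2 := ln_two_term_le.
have hc : (two_term <= 0 /\ 236 / 100 <= L /\ L - 1 / 10 <= ln (P ^ 2 + 1)%N%:R) \/
    (two_term <= 7 / 10 /\ 286 / 100 <= L /\ L - 1 / 17 <= ln (P ^ 2 + 1)%N%:R).
  have [P4|P3] := ltnP 3 P.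
    right; split=> //; split; first exact: L4.
    by rewrite div1r; apply: (@ln_sqr1_ge 17) => //; rewrite -mulnn; clear - P4; nia.
  have EP : P = 3 by apply/eqP; rewrite eqn_leq P3.
  left; split; last split=> //; last by rewrite div1r; apply: (@ln_sqr1_ge 10) => //; rewrite EP.
  have Po : odd P by rewrite EP.
  have := lucas_n_odd hP m1 mn Ephi n_even Po; rewrite k2 => /(_ isT)[/negPf -> _].
  exact: lexx.
apply: (final_k2 (L := L) (y := ln q%:R) (N := (count (fun e => (e * e < n1) && ~~ (e %| k))%N (divisors n1))%:R)
   (q := q%:R) (lnu := ln (u k.+1)%:R) (lnP := ln P%:R) (ler0n R _) (ler0n R q) _
   (ln_rank_part q_pr q_odd q_lt) _ ln_P_le _ T).
- by rewrite lerBrDr.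
- case: hq => [Eq|[Eq|hq]]; [left | right; left | by right; right; rewrite (ler_nat R 7) y7].
    by split; [rewrite Eq | exact: y3].
  by split; [rewrite Eq | apply: y5; rewrite Eq].
- by rewrite k2 u3; exact: hc.
apply: le_trans H _; move: S; rewrite k2 subnn mul0r addr0 => S.
by rewrite -[leRHS]addrA lerD2l.
Qed.

Section IndexGt2.
Variable j : nat.
Hypotheses (Ej : k = (2 * j)%N) (j1 : (1 < j)%N).
Let k20 : (k - 2)%N = (2 * j - 2)%N. Proof. by rewrite Ej. Qed.

Let j1R : 2 <= j%:R :> R. Proof. by rewrite (ler_nat R 2). Qed.

Let ln_k : ln k%:R = ln 2 + ln j%:R :> R.
Proof. by rewrite Ej natrM lnM ?posrE ?ltr0n //; lia. Qed.

Let ln_j_ge0 : 0 <= ln j%:R :> R.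
Proof. by rewrite ln_ge0 // ler1n; lia. Qed.

Let ln2_ge0 : 0 <= ln 2 :> R.
Proof. by rewrite ln_ge0 // ler1n. Qed.

Lemma tail_gt2_le (B : nat) : ((3 * h + 4) * (280 * h + 257) <= B * 2 ^ h)%N ->
  (size (divisors n1))%:R *
    ((3 / 2 * ln (2 ^ h)%N%:R + (1285 / 1000 + ln k%:R / 2)) / (2 ^ h)%N%:R) <= B%:R / 200 :> R.
Proof.
have lk : ln k%:R <= ln (2 ^ h)%N%:R :> R.
  rewrite ler_lnn ?ltr0n ?ler_nat //; first exact: ltnW.
  have [h1 h2] := exp_index_le; apply: leq_trans (leq_trans h1 h2); exact: leq_pmull.
have lk0 : 0 <= ln k%:R :> R by rewrite ln_k addr_ge0.
by move=> tb; apply: tail_ge4_le size_divisors_third tb lk0 lk.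
Qed.

Lemma index_sum_le : (k - 2)%:R / P%:R <= (2 * j%:R - 2) / 3 :> R.
Proof.
have P3 : 3 <= P%:R :> R by rewrite (ler_nat R 3).
have P0 : 0 < P%:R :> R by lra.
have -> : (k - 2)%:R = 2 * j%:R - 2 :> R by rewrite k20 natrB ?natrM //; lia.
have j0 : 0 <= 2 * j%:R - 2 :> R by have := j1R; lra.
by rewrite ler_pdivrMr // mulrAC ler_pdivlMr // ler_wpM2l.
Qed.

Lemma ln_lucas_ge : j%:R * (L - 1 / 10) <= ln (u k.+1)%:R :> R.
Proof.
apply: le_trans (_ : ln ((P ^ 2 + 1) ^ j)%N%:R <= _); last first.
  by rewrite ler_lnn ?ltr0n ?expn_gt0 ?addn_gt0 ?orbT // ler_nat Ej lucas_odd_index_ge.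
rewrite natrX lnXn ?ltr0n ?addn_gt0 ?orbT // -(mulr_natl (ln _)) ler_wpM2l ?ler0n //.
by rewrite div1r; apply: (@ln_sqr1_ge 10) => //; rewrite -mulnn; nia.
Qed.

Let alc : ((logn 2 n <= 1)%N /\ (3 / 2 : R) = 1 /\ (1285 / 1000 + ln k%:R / 2 : R) = 785 / 1000) \/
   ((3 / 2 : R) = 3 / 2 /\ (1285 / 1000 + ln k%:R / 2 : R) = 1285 / 1000 + ln k%:R / 2).
Proof. by right. Qed.

Let x2 : (2 < 2 ^ h)%N.
Proof.
by have [h11 _] := card_third; apply: (@leq_trans (2 ^ 2)); rewrite ?leq_exp2l //; apply: leq_trans h11.
Qed.

(** As for [k = 2], [q] does not divide [k] and there is no exceptional divisor, so the small
    classes number at most [b - 1]. *)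
Lemma index_eq4_false : j = 2%N -> False.
Proof.
move=> Ej2; have Ek : k = 4%N by rewrite Ej Ej2.
have T31 : 62%:R / 200 <= 31 / 100 :> R by lra.
have d : (k - 2)%:R / P%:R <= 2 / 3 :> R.
  by apply: le_trans index_sum_le _; rewrite Ej2; lra.
have lj : ln j%:R <= 7 / 10 :> R by rewrite Ej2 ln2_le.
have l2 := ln2_le R.
have c1 : 1285 / 1000 <= 1285 / 1000 + ln k%:R / 2 :> R.
  by rewrite lerDl divr_ge0 // ln_k addr_ge0.
have c2 : 1285 / 1000 + ln k%:R / 2 <= 1985 / 1000 :> R by rewrite ln_k; lra.
have U := ln_lucas_ge.
have [q [q_pr q_odd q_lt q_min]] := exists_excess_prime hP m1 mn Ephi n_even.
have S := large_rank_sum_le hP m1 mn Ephi n_even alc q_pr q_odd q_min x2 exp2_sqr_le.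
have H := ln_lucas_le hP m1 mn Ephi n_even R.
have [h11 _] := card_third; have [tb _] := tail_bound h11.
have T := tail_gt2_le tb.
have W : logn q k = 0%N.
  apply/eqP; have := excess_part_le hP m1 mn Ephi n_even q_pr q_odd.
  rewrite {2}Ek; case: (logn q k) => // w; have := odd_prime_gt2 q_odd q_pr; rewrite expnS.
  have : (0 < q ^ w)%N by rewrite expn_gt0 prime_gt0.
  by clear; nia.
have exc0 : ((P == 3) && (3 %| n1))%N = false.
  by apply/negbTE/negP=> /(exc_k hP m1 mn Ephi n_even); rewrite Ek.
have N1 := small_divisors_le hP m1 mn Ephi n_even q_pr q_odd q_lt.
rewrite W exc0 add0n addn0 -(ler_nat R) -natr1 in N1.
have [hq] := ln_prime_ge q_pr q_odd q_lt; case=> y3 y5 y7.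
have [L3 _] := ln_sqr2_ge.
apply: (final_k4 (L := L) (y := ln q%:R) (N := (count (fun e => (e * e < n1) && ~~ (e %| k))%N (divisors n1))%:R)
   (q := q%:R) (lnu := ln (u k.+1)%:R) (lnP := ln P%:R) (ler0n R _) (ler0n R q) _
   (ln_rank_part q_pr q_odd q_lt) _ ln_P_le ln_two_term_le L3 _ c1 c2 d (le_trans T T31)).
- by rewrite lerBrDr.
- have q3 := odd_prime_gt2 q_odd q_pr.
  have [q5|q5] := leqP 5 q; first by right; rewrite (ler_nat R 5) y5.
  by left; split=> //; move: hq q3 q5; clear; move=> [->|[->|]] //; lia.
- by move: U; rewrite {1}Ej2.
apply: le_trans H _; move: S => S.
by rewrite -[leRHS]addrA lerD2l.
Qed.

(** The successor in [small_divisors_le] now only offsets a possible exceptional divisor, and [q]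
    may divide [k]. The lower bound [j (L - 1/10)] for [ln u_{k+1}] makes up for both, and
    [u_{k+1} >= 3^6] makes the tail negligible. *)
Lemma index_ge6_false : (2 < j)%N -> False.
Proof.
move=> j3.
have [q [q_pr q_odd q_lt q_min]] := exists_excess_prime hP m1 mn Ephi n_even.
have S := large_rank_sum_le hP m1 mn Ephi n_even alc q_pr q_odd q_min x2 exp2_sqr_le.
have H := ln_lucas_le hP m1 mn Ephi n_even R.
have h20 : (19 < h)%N.
  have u6 : (3 ^ 6 <= u k.+1)%N.
    apply: leq_trans (lucas_exp_ge hP k); apply: leq_trans (_ : P ^ 6 <= _)%N; first by rewrite leq_exp2r.
    rewrite leq_pexp2l //; first exact: ltn_trans hP.
    by rewrite Ej (leq_mul2l 2 3 j) j3.
  rewrite -[(3 ^ 6)%N]/(729)%N in u6; have := leq_trans (leq_mul u6 u6) lucas_sqr_le.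
  by clear; move: (h) => x; lia.
have T := tail_gt2_le (far_tail_bound h20).
have N1 := small_divisors_le hP m1 mn Ephi n_even q_pr q_odd q_lt.
have {}N1 : (count (fun e => (e * e < n1) && ~~ (e %| k))%N (divisors n1))%:R <=
    (logn q (u (lrank P q)))%:R + (logn q k)%:R :> R.
  rewrite -natrD ler_nat addnC; move: N1; clear.
  by move: (count _ _) (logn _ _ + _)%N => x y; case: (_ && _) => /=; lia.
have [_] := ln_prime_ge q_pr q_odd q_lt; case=> y3 _ _.
have [L3 _] := ln_sqr2_ge.
have q3 := odd_prime_gt2 q_odd q_pr.
have l2 := ln2_le R.
have c0 : 0 <= 1285 / 1000 + ln k%:R / 2 :> R.
  by rewrite addr_ge0 // divr_ge0 // ln_k addr_ge0.
have c1 : 1285 / 1000 + ln k%:R / 2 <= 1635 / 1000 + ln j%:R / 2 :> R by rewrite ln_k; lra.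
have lj3 : ln 3 <= ln j%:R :> R by rewrite ler_lnn // (ler_nat R 3).
have j3R : 3 <= j%:R :> R by rewrite (ler_nat R 3).
apply: (final_k6 (L := L) (y := ln q%:R) (q := q%:R) (lnu := ln (u k.+1)%:R) (lnP := ln P%:R)
   (ler0n R _) (ler0n R _) _ N1
   (ln_rank_part q_pr q_odd q_lt) (ln_index_part q_pr q_odd Ej) y3 ln_P_le ln_two_term_le L3
   ln_lucas_ge c0 c1 index_sum_le (ln3_le R) lj3 (quadratic_ln_le j3R) _).
- by rewrite (ler_nat R 3).
- by apply: le_trans T _; have -> : 1 / 100 = 2%:R / 200 :> R by lra.
apply: le_trans H _; move: S => S.
by rewrite -[leRHS]addrA lerD2l.
Qed.

End IndexGt2.

End EvenIndexContradiction.

(** * Conclusion *)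

Lemma no_even_index P (hP : 2 < P) n m : 1 < m -> m < n ->
  totient (lucas P n) = lucas P m -> ~~ odd n -> False.
Proof.
move=> m1 mn Ephi n_even.
have k2 : n - m = 2 * (n - m)./2.
  by rewrite mul2n -[LHS]odd_double_half (negPf (even_k hP m1 mn Ephi n_even)).
have [lt|] := ltnP 2 (n - m)./2.
  exact: (index_ge6_false hP m1 mn Ephi n_even Rdefinitions.R k2 (ltnW lt) lt).
rewrite leq_eqVlt => /orP[/eqP e|].
  by apply: (index_eq4_false hP m1 mn Ephi n_even Rdefinitions.R k2 _ e); rewrite e.
rewrite ltnS leq_eqVlt => /orP[/eqP e|].
  by apply: (index_ne2 hP m1 mn Ephi n_even Rdefinitions.R); rewrite k2 e.
by case: ((n - m)./2) k2 => // k2 _; have := subn_gt0 m n; rewrite k2 mn.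
Qed.

Theorem theorem1 (P : nat) (hP : 3 <= P) (n m : nat) (hn : 0 < n) (hm : 0 < m) :
  totient (lucas P n) = lucas P m <-> n = 1 /\ m = 1.
Proof.
split=> [E|[-> ->]] //.
have u0 := lucas_gt0 hP hn.
have u2 : lucas P 2 = P by rewrite /lucas; lia.
have [n1|n1] := leqP n 1.
  have En : n = 1 by lia.
  split=> //; move: E; rewrite En => E.
  have [m2|] := leqP m 1; first by lia.
  by move/(lucas_mono hP); rewrite u2 -E => /(leq_trans hP).
have ge3 : 2 < lucas P n by apply: (leq_trans hP); have := lucas_mono hP n1; rewrite u2.
have m1 : 1 < m.
  by rewrite ltnNge; apply/negP=> m1; have := totient_gt1 (lucas P n); rewrite ge3 E (_ : m = 1) //; lia.
have mn : m < n.
  rewrite ltnNge; apply/negP=> /(lucas_mono hP); rewrite -E leqNgt => /negP; apply.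
  by apply: totient_lt; apply: leq_trans ge3.
exfalso; case: (boolP (odd n)) => [n_odd|n_even].
  exact: (no_odd_index hP m1 mn E n_odd).
exact: (no_even_index hP m1 mn E n_even).
Qed.
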